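(* Let $\alpha>0$ and let $\boldsymbol{y_d}\in\boldsymbol{L^2}(Q)$ be weakly divergence-free, i.e. $(\boldsymbol{y_d}(t),\nabla v)_\Omega=0$ for all $v\in H^1_0(\Omega)$ and a.e. $t\in(0,T)$. Let $$\mathcal{B}((\boldsymbol{y},\boldsymbol{p}),(\boldsymbol{v},\boldsymbol{q}))=\int_Q\Big(\boldsymbol{y}\cdot\boldsymbol{v}-\nu\,\mathbf{curl}\,\boldsymbol{p}\cdot\mathbf{curl}\,\boldsymbol{v}+\sigma\,\partial_t^{1/2}\boldsymbol{p}\cdot\partial_t^{1/2}\boldsymbol{v}^\perp+\nu\,\mathbf{curl}\,\boldsymbol{y}\cdot\mathbf{curl}\,\boldsymbol{q}+\sigma\,\partial_t^{1/2}\boldsymbol{y}\cdot\partial_t^{1/2}\boldsymbol{q}^\perp+\frac1\alpha\,\boldsymbol{p}\cdot\boldsymbol{q}\Big)d\boldsymbol{x}\,dt,$$ and let $(\boldsymbol{y},\boldsymbol{p})\in(\boldsymbol{H}^{\mathbf{curl},\frac12}_{0,per}(Q))^2$ be the exact state and adjoint state, i.e. $\mathcal{B}((\boldsymbol{y},\boldsymbol{p}),(\boldsymbol{v},\boldsymbol{q}))=\int_Q\boldsymbol{y_d}\cdot\boldsymbol{v}\,d\boldsymbol{x}\,dt$ for all $(\boldsymbol{v},\boldsymbol{q})\in(\boldsymbol{H}^{\mathbf{curl},\frac12}_{0,per}(Q))^2$. Let $\boldsymbol{\eta},\boldsymbol{\zeta}\in\boldsymbol{H}^{\mathbf{curl},1}_{0,per}(Q)$.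 Let $\mathcal{B}$ fulfill the inf-sup condition $$\underline{c}\,\|(\boldsymbol{w},\boldsymbol{r})\|_{\boldsymbol{H}^{\mathbf{curl},\frac12}}\le\sup_{0\neq(\boldsymbol{v},\boldsymbol{q})\in(\boldsymbol{H}^{\mathbf{curl},\frac12}_{0,per}(Q))^2}\frac{\mathcal{B}((\boldsymbol{w},\boldsymbol{r}),(\boldsymbol{v},\boldsymbol{q}))}{\|(\boldsymbol{v},\boldsymbol{q})\|_{\boldsymbol{H}^{\mathbf{curl},\frac12}}}\qquad\text{for all }(\boldsymbol{w},\boldsymbol{r})\in(\boldsymbol{H}^{\mathbf{curl},\frac12}_{0,per}(Q))^2$$ with $$\underline{c}=\Big(1+2\max\{\alpha,\tfrac1\alpha\}\Big)^{-1/2}\min\{\tfrac1{\sqrt\alpha},\underline{\nu},\underline{\sigma}\}\,\min\{\sqrt\alpha,\tfrac1{\sqrt\alpha}\}.$$ Then for all $\boldsymbol{\tau},\boldsymbol{\rho}\in\boldsymbol{H}^{\mathbf{curl},0}(Q)$, $$\|(\boldsymbol{y}-\boldsymbol{\eta},\boldsymbol{p}-\boldsymbol{\zeta})\|_{\boldsymbol{H}^{\mathbf{curl},\frac12}}\le\frac1{\underline{c}}\Big(\|\mathcal{R}_1(\boldsymbol{\eta},\boldsymbol{\zeta},\boldsymbol{\rho})\|^2+\|\mathcal{R}_3(\boldsymbol{\eta},\boldsymbol{\zeta},\boldsymbol{\tau})\|^2+\|\mathcal{R}_2(\boldsymbol{\eta},\boldsymbol{\tau})\|^2+\|\mathcal{R}_4(\boldsymbol{\zeta},\boldsymbol{\rho})\|^2\Big)^{1/2},$$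 where $$\mathcal{R}_1(\boldsymbol{\eta},\boldsymbol{\zeta},\boldsymbol{\rho})=\sigma\,\partial_t\boldsymbol{\zeta}-\mathbf{curl}\,\boldsymbol{\rho}+\boldsymbol{\eta}-\boldsymbol{y_d},\qquad \mathcal{R}_2(\boldsymbol{\eta},\boldsymbol{\tau})=\boldsymbol{\tau}-\nu\,\mathbf{curl}\,\boldsymbol{\eta},$$ $$\mathcal{R}_3(\boldsymbol{\eta},\boldsymbol{\zeta},\boldsymbol{\tau})=\sigma\,\partial_t\boldsymbol{\eta}+\mathbf{curl}\,\boldsymbol{\tau}+\alpha^{-1}\boldsymbol{\zeta},\qquad \mathcal{R}_4(\boldsymbol{\zeta},\boldsymbol{\rho})=\boldsymbol{\rho}-\nu\,\mathbf{curl}\,\boldsymbol{\zeta}.$$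
   Context: $\Omega \subset \mathbb{R}^3$ is a bounded Lipschitz domain with boundary $\Gamma$ and unit outward normal $\boldsymbol{n}$; $T>0$, $\omega = 2\pi/T$, $Q = \Omega\times(0,T)$, $\Sigma = \Gamma\times(0,T)$. The coefficients $\sigma=\sigma(\boldsymbol{x})$ and $\nu=\nu(\boldsymbol{x})$ are measurable with $0<\underline{\sigma}\le\sigma(\boldsymbol{x})\le\overline{\sigma}$ and $0<\underline{\nu}\le\nu(\boldsymbol{x})\le\overline{\nu}$ for $\boldsymbol{x} \in \Omega$. All functions are real. $\boldsymbol{L^2}(\Omega)=[L^2(\Omega)]^3$, $\boldsymbol{L^2}(Q)=[L^2(Q)]^3$; $(\cdot,\cdot)_\Omega$, $\|\cdot\|_\Omega$ denote the $L^2(\Omega)$ inner product and norm, and $\|\cdot\|$ the $L^2(Q)$ norm. $\mathbf{curl}$ is the weak spatial curl and $\partial_t$ the weak time derivative. Each $\boldsymbol{v}\in\boldsymbol{L^2}(Q)$ has the time Fourier expansion $\boldsymbol{v}(\boldsymbol{x},t)=\boldsymbol{v}_0^c(\boldsymbol{x})+\sum_{k\ge1}\big(\boldsymbol{v}_k^c(\boldsymbol{x})\cos(k\omega t)+\boldsymbol{v}_k^s(\boldsymbol{x})\sin(k\omega t)\big)$ with $\boldsymbol{v}_0^c=\frac1T\int_0^T\boldsymbol{v}\,dt$, $\boldsymbol{v}_k^c=\frac2T\int_0^T\boldsymbol{v}\cos(k\omega t)\,dt$, $\boldsymbol{v}_k^s=\frac2T\int_0^T\boldsymbol{v}\sin(k\omega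 t)\,dt$. Write $\boldsymbol{v}_k=(\boldsymbol{v}_k^c,\boldsymbol{v}_k^s)^T$, $\boldsymbol{v}_k^\perp=(-\boldsymbol{v}_k^s,\boldsymbol{v}_k^c)^T$, $\mathbf{curl}\,\boldsymbol{v}_k=(\mathbf{curl}\,\boldsymbol{v}_k^c,\mathbf{curl}\,\boldsymbol{v}_k^s)^T$; inner products and norms of such pairs are the sums over both components. Define $\|\partial_t^{1/2}\boldsymbol{v}\|^2=\frac T2\sum_{k\ge1}k\omega\|\boldsymbol{v}_k\|_\Omega^2$ and, by definition, $$\int_Q\sigma\,\partial_t^{1/2}\boldsymbol{y}\cdot\partial_t^{1/2}\boldsymbol{v}^\perp\,d\boldsymbol{x}\,dt:=\frac T2\sum_{k=1}^\infty k\omega\,(\sigma\boldsymbol{y}_k,\boldsymbol{v}_k^\perp)_\Omega .$$ Spaces (tangential traces in the usual weak sense): $\boldsymbol{H}^{\mathbf{curl},0}(Q)=\{\boldsymbol{v}\in\boldsymbol{L^2}(Q):\mathbf{curl}\,\boldsymbol{v}\in\boldsymbol{L^2}(Q)\}$; $\boldsymbol{H}^{\mathbf{curl},1}_{0,per}(Q)=\{\boldsymbol{v}\in\boldsymbol{H}^{\mathbf{curl},0}(Q):\partial_t\boldsymbol{v}\in\boldsymbol{L^2}(Q),\ \boldsymbol{v}\times\boldsymbol{n}=0\text{ on }\Sigma,\ \boldsymbol{v}(\boldsymbol{x},0)=\boldsymbol{v}(\boldsymbol{x},T)\text{ for a.e. }\boldsymbol{x}\in\Omega\}$; $\boldsymbol{H}^{\mathbf{curl},\frac12}_{0,per}(Q)=\{\boldsymbol{v}\in\boldsymbol{H}^{\mathbf{curl},0}(Q):\|\partial_t^{1/2}\boldsymbol{v}\|<\infty,\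 \boldsymbol{v}\times\boldsymbol{n}=0\text{ on }\Sigma\}$. The norm is $$\|\boldsymbol{v}\|_{\boldsymbol{H}^{\mathbf{curl},\frac12}}^2=T\big(\|\boldsymbol{v}_0^c\|_\Omega^2+\|\mathbf{curl}\,\boldsymbol{v}_0^c\|_\Omega^2\big)+\frac T2\sum_{k=1}^\infty\big((1+k\omega)\|\boldsymbol{v}_k\|_\Omega^2+\|\mathbf{curl}\,\boldsymbol{v}_k\|_\Omega^2\big),$$ and for pairs $\|(\boldsymbol{v},\boldsymbol{q})\|_{\boldsymbol{H}^{\mathbf{curl},\frac12}}^2=\|\boldsymbol{v}\|_{\boldsymbol{H}^{\mathbf{curl},\frac12}}^2+\|\boldsymbol{q}\|_{\boldsymbol{H}^{\mathbf{curl},\frac12}}^2$. *)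

(* Defs.v *)
From HB Require Import structures.
From mathcomp Require Import all_boot all_order all_algebra.
From mathcomp Require Import all_classical all_reals all_analysis.
From mathcomp Require Import measurable_realfun.
Set Implicit Arguments.
Unset Strict Implicit.
Unset Printing Implicit Defensive.
Import Order.TTheory GRing.Theory Num.Theory.
Import numFieldNormedType.Exports.

Local Open Scope classical_set_scope.
Local Open Scope ring_scope.

(* The library's product measure, with the sigma-finite structure on it that
   canonical inference does not find for [m1 \x m2]; it is what allows products
   to be iterated and Fubini's theorem to be applied. *)
Section product_measure.
Local Open Scope ereal_scope.
Context d1 d2 (T1 : measurableType d1) (T2 : measurableType d2) (R : realType).
Context (m1 : {sigma_finite_measure set T1 -> \bar R}).
Context (m2 : {sigma_finite_measure set T2 -> \bar R}).

Definition prod_measure : set (T1 * T2) -> \bar R := m1 \x m2.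

HB.instance Definition _ := Measure.on prod_measure.

Lemma prod_measure_sigma_finite : sigma_finite setT prod_measure.
Proof.
have /sigma_finiteP[F [TF ndF Foo]] := sigma_finiteT m1.
have /sigma_finiteP[G [TG ndG Goo]] := sigma_finiteT m2.
exists (fun n => F n `*` G n).
  rewrite -setXTT TF TG predeqE => -[x y]; split.
    move=> [/= [n _ Fnx] [k _ Gky]]; exists (maxn n k) => //; split.
    - by move: x Fnx; exact/subsetPset/ndF/leq_maxl.
    - by move: y Gky; exact/subsetPset/ndG/leq_maxr.
  by move=> [n _ []/= ? ?]; split; exists n.
move=> k; have [? ?] := Foo k; have [? ?] := Goo k.
split; first exact: measurableX.
by rewrite /prod_measure product_measure1E// lte_mul_pinfty// ge0_fin_numE.
Qed.

HB.instance Definition _ := Measure_isSigmaFinite.Build _ _ _ prod_measure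
  prod_measure_sigma_finite.

End product_measure.

Notation point1 R := (measurableTypeR R).
Notation point3 R := (point1 R * point1 R * point1 R)%type.
Notation point4 R := (point3 R * point1 R)%type.
(* Vector fields are given by their three components. *)
Notation vfield R X := ('I_3 -> X -> R).

Definition leb1 (R : realType) : {sigma_finite_measure set (point1 R) -> \bar R} :=
  @lebesgue_measure R.
Definition leb3 (R : realType) : {sigma_finite_measure set (point3 R) -> \bar R} :=
  prod_measure (prod_measure (leb1 R) (leb1 R)) (leb1 R).
Definition leb4 (R : realType) :
    {sigma_finite_measure set (point4 R) -> \bar R} :=
  prod_measure (leb3 R) (leb1 R).

Section smooth.
Context {R : realType} {V : normedModType R}.
Implicit Types (f : V -> R) (D : set V).

Fixpoint Ck (k : nat) f : Prop :=
  continuous f /\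
  if k is k'.+1 then
    forall u : V, (forall x, derivable f x u) /\ Ck k' (fun x => 'D_u f x)
  else True.

Definition smooth f := forall k, Ck k f.

Definition test_function D f :=
  smooth f /\
  exists K : set V, [/\ compact K, K `<=` D & forall x, ~ K x -> f x = 0].

(* The classical curl with respect to the directions [e 0], [e 1], [e 2];
   indices are added modulo 3. *)
Definition cl_curl (e : 'I_3 -> V) (v : vfield R V) : vfield R V := fun i x =>
  'D_(e (i + 1)) (v (i + 2%:R)) x - 'D_(e (i + 2%:R)) (v (i + 1)) x.

End smooth.

Section L2.
Context {d} {X : measurableType d} {R : realType}.
Variable mu : {measure set X -> \bar R}.
Implicit Types (D : set X) (f : X -> R) (u v : vfield R X).

Definition scalL2 D f :=
  measurable_fun D f /\ (\int[mu]_(x in D) (f x ^+ 2)%:E < +oo)%E.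

Definition L2 D v := forall i, scalL2 D (v i).

Definition ip D u v : R := \int[mu]_(x in D) (\sum_(i < 3) u i x * v i x).

Definition nrm2 D v : R := ip D v v.

(* Pairs (cosine part, sine part) of fields. *)
Definition pip D (p q : vfield R X * vfield R X) : R :=
  ip D p.1 q.1 + ip D p.2 q.2.

Definition pnrm2 D (p : vfield R X * vfield R X) : R := pip D p p.

Definition perp (p : vfield R X * vfield R X) : vfield R X * vfield R X :=
  (fun i x => - p.2 i x, p.1).

End L2.

Section domain.
Context {R : realType}.
Implicit Types (a x : point3 R) (Omega : set (point3 R)).

Definition dot3 a x : R := a.1.1 * x.1.1 + a.1.2 * x.1.2 + a.2 * x.2.

Definition orthonormal_frame (a : 'I_3 -> point3 R) :=
  forall i j, dot3 (a i) (a j) = (i == j)%:R.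

(* Near each boundary point, in suitable Cartesian coordinates, [Omega] is the
   set of points lying strictly above the graph of a Lipschitz function. *)
Definition lipschitz_boundary Omega :=
  forall x0, (closure Omega `\` Omega) x0 ->
  exists (a : 'I_3 -> point3 R) (gamma : (R * R)%type -> R) (U : set (point3 R)),
    [/\ orthonormal_frame a, exists L : R, L.-lipschitz gamma, nbhs x0 U &
        forall x, U x ->
          (Omega x <-> gamma (dot3 (a 0) x, dot3 (a 1) x) < dot3 (a 2%:R) x)].

Definition bounded_lipschitz_domain Omega :=
  [/\ open Omega, connected Omega, Omega !=set0, bounded_set Omega &
      lipschitz_boundary Omega].

Definition e3 (i : 'I_3) : point3 R :=
  ((i == 0)%:R, (i == 1)%:R, (i == 2%:R)%:R).

Definition e4 (i : 'I_3) : point4 R := (e3 i, 0).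

Definition et : point4 R := (0, 1).

End domain.

(* Operators acting on fields over [Omega]. Each weak derivative is an L2
   function unique up to a null set; the operator selects one when it exists. *)
Section space_operators.
Context {R : realType}.
Variable Omega : set (point3 R).

Definition is_curl3 (v w : vfield R (point3 R)) :=
  L2 (leb3 R) Omega w /\
  forall phi : vfield R (point3 R), (forall i, test_function Omega (phi i)) ->
    ip (leb3 R) Omega w phi = ip (leb3 R) Omega v (cl_curl e3 phi).

Definition curl3 (v : vfield R (point3 R)) : vfield R (point3 R) :=
  xget (fun _ _ => 0) [set w | is_curl3 v w].

Definition pcurl3 (p : vfield R (point3 R) * vfield R (point3 R)) :=
  (curl3 p.1, curl3 p.2).

Definition cl_grad (f : point3 R -> R) : vfield R (point3 R) :=
  fun i x => 'D_(e3 i) f x.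

Definition is_grad3 (f : point3 R -> R) (g : vfield R (point3 R)) :=
  L2 (leb3 R) Omega g /\
  forall (i : 'I_3) (phi : point3 R -> R), test_function Omega phi ->
    \int[leb3 R]_(x in Omega) (g i x * phi x) =
    - \int[leb3 R]_(x in Omega) (f x * 'D_(e3 i) phi x).

Definition grad3 (f : point3 R -> R) : vfield R (point3 R) :=
  xget (fun _ _ => 0) [set g | is_grad3 f g].

(* The closure of the test functions in H^1. *)
Definition H10 (f : point3 R -> R) :=
  [/\ scalL2 (leb3 R) Omega f, exists g, is_grad3 f g &
      forall eps : R, 0 < eps -> exists2 phi : point3 R -> R, test_function Omega phi &
        \int[leb3 R]_(x in Omega) ((f x - phi x) ^+ 2) +
        nrm2 (leb3 R) Omega (fun i (x : point3 R) => grad3 f i x - cl_grad phi i x) < eps].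

End space_operators.

Section spacetime.
Context {R : realType}.
Variables (Omega : set (point3 R)) (T : R).

Definition Q : set (point4 R) := Omega `*` `]0, T[.

Definition omega : R := 2 * pi / T.

Implicit Types u v w : vfield R (point4 R).

Definition slice v (t : R) : vfield R (point3 R) := fun i x => v i (x, t).

Definition is_curl v w :=
  L2 (leb4 R) Q w /\
  forall phi : vfield R (point4 R), (forall i, test_function Q (phi i)) ->
    ip (leb4 R) Q w phi = ip (leb4 R) Q v (cl_curl e4 phi).

Definition curl v : vfield R (point4 R) :=
  xget (fun _ _ => 0) [set w | is_curl v w].

Definition is_dt v w :=
  L2 (leb4 R) Q w /\
  forall phi : vfield R (point4 R), (forall i, test_function Q (phi i)) ->
    ip (leb4 R) Q w phi = - ip (leb4 R) Q v (fun i z => 'D_et (phi i) z).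

Definition dt v : vfield R (point4 R) :=
  xget (fun _ _ => 0) [set w | is_dt v w].

(* The weak tangential trace of a field [v] with a weak curl is the functional
   sending [phi], smooth up to the boundary, to
   \int_Q (curl v . phi - v . curl phi); for smooth [v] this is the integral
   over the lateral boundary of [(n x v) . phi]. *)
Definition tangential_trace_zero v :=
  forall phi : vfield R (point4 R), (forall i, smooth (phi i)) ->
    ip (leb4 R) Q (curl v) phi = ip (leb4 R) Q v (cl_curl e4 phi).

(* A field with a weak time derivative in L2 has a representative that is
   continuous from [0, T] to L2 of [Omega]; its values at the endpoints, which
   are determined up to null sets, are [v(., 0)] and [v(., T)]. *)
Definition time_periodic v :=
  exists u : vfield R (point4 R),
    [/\ {ae leb4 R, forall z, Q z -> forall i, u i z = v i z},
        forall t : R, t \in `[0, T] -> L2 (leb3 R) Omega (slice u t),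
        forall t : R, t \in `[0, T] -> forall eps : R, 0 < eps ->
          exists2 delta : R, 0 < delta &
            forall s : R, s \in `[0, T] -> `|s - t| < delta ->
              nrm2 (leb3 R) Omega (fun i (x : point3 R) => slice u s i x - slice u t i x)
                < eps &
        {ae leb3 R, forall x, Omega x -> forall i, u i (x, 0) = u i (x, T)}].

Definition coef0 v : vfield R (point3 R) := fun i x =>
  T^-1 * \int[leb1 R]_(t in `]0, T[) v i (x, t).

Definition coefc v (k : nat) : vfield R (point3 R) := fun i x =>
  2 / T * \int[leb1 R]_(t in `]0, T[) (v i (x, t) * cos (k%:R * omega * t)).

Definition coefs v (k : nat) : vfield R (point3 R) := fun i x =>
  2 / T * \int[leb1 R]_(t in `]0, T[) (v i (x, t) * sin (k%:R * omega * t)).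

Definition coef v (k : nat) := (coefc v k, coefs v k).

(* The square of the L2(Q)-norm of the half-order time derivative. *)
Definition half_nrm2 v : \bar R :=
  ((T / 2)%:E * \sum_(1 <= k <oo)
     (k%:R * omega * pnrm2 (leb3 R) Omega (coef v k))%:E)%E.

(* \int_Q s d_t^{1/2} y . d_t^{1/2} v^perp, for a weight [s] on [Omega]. *)
Definition half_form (s : point3 R -> R) y v : R :=
  T / 2 * limn (fun n => \sum_(1 <= k < n) k%:R * omega *
    pip (leb3 R) Omega
      ((fun i x => s x * coefc y k i x), (fun i x => s x * coefs y k i x))
      (perp (coef v k))).

Definition Hcurl0 v := L2 (leb4 R) Q v /\ exists w, is_curl v w.

Definition Hcurl1_0per v :=
  [/\ Hcurl0 v, exists w, is_dt v w, tangential_trace_zero v & time_periodic v].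

Definition Hcurlhalf_0per v :=
  [/\ Hcurl0 v, (half_nrm2 v < +oo)%E & tangential_trace_zero v].

(* The square of the H^{curl,1/2}-norm. *)
Definition Hnrm2 v : \bar R :=
  ((T * (nrm2 (leb3 R) Omega (coef0 v) +
         nrm2 (leb3 R) Omega (curl3 Omega (coef0 v))))%:E +
   (T / 2)%:E * \sum_(1 <= k <oo)
     ((1 + k%:R * omega) * pnrm2 (leb3 R) Omega (coef v k) +
      pnrm2 (leb3 R) Omega (pcurl3 Omega (coef v k)))%:E)%E.

(* The H^{curl,1/2}-norm of a pair, a real number because [Hnrm2] is finite on
   [Hcurlhalf_0per]. *)
Definition Hnorm v w : R := Num.sqrt (fine (Hnrm2 v + Hnrm2 w)%E).

Definition ae_zero_pair v w :=
  {ae leb4 R, forall z, Q z -> forall i, v i z = 0 /\ w i z = 0}.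

Definition weakly_divergence_free v :=
  forall f : point3 R -> R, H10 Omega f ->
    {ae leb1 R, forall t, `]0, T[%classic t ->
      ip (leb3 R) Omega (slice v t) (grad3 Omega f) = 0}.

(* Multiplication by a weight depending on the space variable only. *)
Definition wmul (s : point3 R -> R) v : vfield R (point4 R) :=
  fun i z => s z.1 * v i z.

Section problem.
Variables (sigma nu : point3 R -> R) (alpha : R) (yd : vfield R (point4 R)).

Definition B (y p v q : vfield R (point4 R)) : R :=
  ip (leb4 R) Q y v
  - ip (leb4 R) Q (wmul nu (curl p)) (curl v)
  + half_form sigma p v
  + ip (leb4 R) Q (wmul nu (curl y)) (curl q)
  + half_form sigma y q
  + alpha^-1 * ip (leb4 R) Q p q.

Definition infsup (c : R) :=
  forall w r, Hcurlhalf_0per w -> Hcurlhalf_0per r ->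
    ((c * Hnorm w r)%:E <=
     ereal_sup [set b | exists v q,
       [/\ Hcurlhalf_0per v, Hcurlhalf_0per q, ~ ae_zero_pair v q &
           b = (B w r v q / Hnorm v q)%:E]])%E.

Definition res1 (eta zeta rho : vfield R (point4 R)) :
    vfield R (point4 R) :=
  fun i z => sigma z.1 * dt zeta i z - curl rho i z + eta i z - yd i z.

Definition res2 (eta tau : vfield R (point4 R)) : vfield R (point4 R) :=
  fun i z => tau i z - nu z.1 * curl eta i z.

Definition res3 (eta zeta tau : vfield R (point4 R)) :
    vfield R (point4 R) :=
  fun i z => sigma z.1 * dt eta i z + curl tau i z + alpha^-1 * zeta i z.

Definition res4 (zeta rho : vfield R (point4 R)) : vfield R (point4 R) :=
  fun i z => rho i z - nu z.1 * curl zeta i z.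

End problem.

End spacetime.

Definition infsup_const (R : realType) (alpha nu_lo sigma_lo : R) : R :=
  (Num.sqrt (1 + 2 * Num.max alpha alpha^-1))^-1
  * Num.min (Num.min (Num.sqrt alpha)^-1 nu_lo) sigma_lo
  * Num.min (Num.sqrt alpha) (Num.sqrt alpha)^-1.

(* Main.v *)
Require Import Defs.
From HB Require Import structures.
From mathcomp Require Import all_boot all_order all_algebra.
From mathcomp Require Import all_classical all_reals all_analysis.
From mathcomp Require Import measurable_realfun ring lra.
Set Implicit Arguments.
Unset Strict Implicit.
Unset Printing Implicit Defensive.
Import Order.TTheory GRing.Theory Num.Theory.
Import numFieldNormedType.Exports.
Local Open Scope classical_set_scope.
Local Open Scope ring_scope.

(** Testing the optimality system against (v, q) and inserting tau and rho gives
    B((y - eta, p - zeta), (v, q)) =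
      - (R1, v) - (R3, q) + (R2, curl q) - (R4, curl v),
    so Cauchy-Schwarz together with |v|^2 + |curl v|^2 <= Hnrm2 v bounds the quotient in the
    inf-sup condition by the root of the sum of the squared residuals.  Two facts enter.
    First, (curl rho, v) = (rho, curl v) as soon as v has zero tangential trace: by the weak
    form of the trace condition, v extended by zero has a curl on the whole space, and since
    the cylinder is locally starlike in a suitable direction, an inward shift followed by a
    mollification approximates v by test functions; a partition by plateau functions makes
    this local.  Second, the half-order form of eta and q equals (sigma dt eta, q): the Fourier
    coefficients of dt eta are those of eta rotated and multiplied by k omega, so this is
    Parseval's identity for the trigonometric system, whose completeness is obtained by
    averaging against the kernels (1 + cos (w (t - s)))^n.
    Finally, |curl v|^2 <= Hnrm2 v holds because taking the curl commutes with taking Fourier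
    coefficients in time. *)

(** * Smooth functions and test functions *)

Section Ck_calculus.
Context {R : realType}.
Implicit Types V W : normedModType R.

(** The field [rho] has a weak curl but no boundary condition, so its weak identity may be tested
    only with fields compactly supported in the cylinder. The approximation therefore has to act on
    [v], and all that is known of [v] at the boundary is the dual form of the trace condition, in
    which every smooth field is an admissible test field. This is why a translated mollifier, smooth
    but not supported in the domain, may be inserted there. The same freedom, with fields phi(x)
    theta(t) that do not vanish at the end times, lets curls and time coefficients commute. In time
    the situation is reversed: [is_dt] admits only test functions vanishing near 0 and T, so the
    periodicity of [eta] enters through the boundary term of a cutoff. The weak operators select
    representatives, hence identities between curls of differences hold almost everywhere and are
    used through pairings. The factor 1/c stands alone because the four pairings are estimated by
    one Cauchy-Schwarz inequality in the product space, and the energy norm dominates exactly the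
    norms of v, q and their curls. *)

Lemma CkSP V k (f : V -> R) :
  Ck k.+1 f <-> continuous f /\
    forall u, (forall x, derivable f x u) /\ Ck k (fun x => 'D_u f x).
Proof. by []. Qed.

Lemma Ck_pred V k (f : V -> R) : Ck k.+1 f -> Ck k f.
Proof.
elim: k f => [|k ih] f /CkSP[cf df]; first by split.
by apply/CkSP; split => // u; have [d c] := df u; split => //; exact: ih.
Qed.

Lemma Ck_cst V k (c : R) : Ck k (cst c : V -> R).
Proof.
elim: k c => [|k ih] c; first by split => //; exact: cst_continuous.
apply/CkSP; split; first exact: cst_continuous.
move=> u; split; first by move=> x; exact: derivable_cst.
rewrite (_ : (fun _ => _) = cst 0); first exact: ih.
by apply/funext => x; rewrite derive_cst.
Qed.

Lemma CkD V k (f g : V -> R) : Ck k f -> Ck k g -> Ck k (fun x => f x + g x).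
Proof.
elim: k f g => [|k ih] f g.
  by move=> [cf _] [cg _]; split => // x; apply: continuousD; [exact: cf|exact: cg].
move=> /CkSP[cf df] /CkSP[cg dg]; apply/CkSP; split.
  by move=> x; apply: continuousD; [exact: cf|exact: cg].
move=> u; have [f1 f2] := df u; have [g1 g2] := dg u; split.
  by move=> x; exact: derivableD.
rewrite (_ : (fun _ => _) = fun x => 'D_u f x + 'D_u g x); first exact: ih.
by apply/funext => x; exact: deriveD.
Qed.

Lemma CkM V k (f g : V -> R) : Ck k f -> Ck k g -> Ck k (fun x => f x * g x).
Proof.
elim: k f g => [|k ih] f g.
  by move=> [cf _] [cg _]; split => // x; apply: continuousM; [exact: cf|exact: cg].
move=> /[dup] /Ck_pred pf /CkSP[cf df] /[dup] /Ck_pred pg /CkSP[cg dg].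
apply/CkSP; split.
  by move=> x; apply: continuousM; [exact: cf|exact: cg].
move=> u; have [f1 f2] := df u; have [g1 g2] := dg u; split.
  by move=> x; exact: derivableM.
rewrite (_ : (fun _ => _) = fun x => f x * 'D_u g x + g x * 'D_u f x).
  by apply: CkD; exact: ih.
by apply/funext => x; exact: deriveM.
Qed.

Lemma CkV V k (f : V -> R) : (forall x, f x != 0) -> Ck k f ->
  Ck k (fun x => (f x)^-1).
Proof.
move=> f0; elim: k => [|k ih].
  by move=> [cf _]; split => // x; apply: cvgV => //; exact: cf.
move=> /[dup] /Ck_pred /ih pf /CkSP[cf df]; apply/CkSP; split.
  by move=> x; apply: cvgV => //; exact: cf.
move=> u; have [f1 f2] := df u; split.
  by move=> x; exact: derivableV.
rewrite (_ : (fun _ => _) =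
    fun x => cst (-1) x * (((f x)^-1 * (f x)^-1) * 'D_u f x)).
  by apply: CkM; [exact: Ck_cst|apply: CkM => //; exact: CkM].
apply/funext => x; rewrite (deriveV (f0 x) (f1 x)) /=.
by rewrite mulN1r expr2 invfM scaleNr.
Qed.

(** [L] is the linear part of the affine map [A]. The difference quotients of the composite along
    [u] are literally those of [f] along [L u], so derivatives transfer by rewriting. Projections,
    reflections and lines are the instances used. *)
Lemma Ck_affine V W k (A L : V -> W) (f : W -> R) : continuous A ->
  (forall x u (h : R), A (h *: u + x) = h *: L u + A x) ->
  Ck k f -> Ck k (fun x => f (A x)).
Proof.
move=> cA AL; have E (g : W -> R) x u :
    (fun h : R => h^-1 *: (((fun x => g (A x)) \o shift x) (h *: u) - g (A x))) =
    (fun h : R => h^-1 *: ((g \o shift (A x)) (h *: L u) - g (A x))).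
  by apply/funext => h /=; rewrite AL.
elim: k f => [|k ih] f.
  by move=> [cf _]; split => // x; apply: (@continuous_comp _ _ _ A f); [exact: cA|exact: cf].
move=> /CkSP[cf df]; apply/CkSP; split.
  by move=> x; apply: (@continuous_comp _ _ _ A f); [exact: cA|exact: cf].
move=> u; have [f1 f2] := df (L u); split.
  by move=> x; rewrite /derivable E; exact: f1.
rewrite (_ : (fun _ => _) = fun x => 'D_(L u) f (A x)); first exact: (ih ('D_(L u) f)).
by apply/funext => x; rewrite /derive E.
Qed.

Lemma derive_affine V W (A L : V -> W) (f : W -> R) x u :
  (forall x u (h : R), A (h *: u + x) = h *: L u + A x) ->
  'D_u (fun x => f (A x)) x = 'D_(L u) f (A x).
Proof.
move=> AL; rewrite /derive.
rewrite (_ : (fun h => _) =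
  (fun h : R => h^-1 *: ((f \o shift (A x)) (h *: L u) - f (A x))))//.
by apply/funext => h /=; rewrite AL.
Qed.

(** Restriction to the line through [x] brings the one-variable derivative rules to bear on
    directional derivatives. *)
Lemma derive_line V (f : V -> R) x u : 'D_u f x = 'D_1 (fun t : R => f (t *: u + x)) 0.
Proof.
rewrite /derive; set a := fun t => _; set b := fun t => _.
suff -> : a = b by [].
by apply/funext => t; rewrite /a /b /= addr0 scale0r add0r [_%:A]mulr1.
Qed.

Lemma is_derive_comp V (F : R -> R) (f : V -> R) x u :
  derivable f x u -> derivable F (f x) 1 ->
  is_derive x u (fun x => F (f x)) ('D_1 F (f x) * 'D_u f x).
Proof.
move=> /derivable1P df dF; pose g := fun h : R => f (h *: u + x).
have Dg : is_derive (0 : R) 1 g ('D_1 g 0) by apply: derivableP; exact: df.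
have DF : is_derive (g 0) 1 F ('D_1 F (f x)).
  by rewrite /g scale0r add0r; exact: derivableP.
have [h1 h2] := @is_derive1_comp _ F g 0 _ _ DF Dg.
by split; [apply/derivable1P; exact: h1|rewrite derive_line (derive_line f); exact: h2].
Qed.

Lemma Ck_comp V k (F : R -> R) (f : V -> R) : Ck k F -> Ck k f ->
  Ck k (fun x => F (f x)).
Proof.
elim: k F => [|k ih] F.
  by move=> [cF _] [cf _]; split => // x; apply: (@continuous_comp _ _ _ f F); [exact: cf|exact: cF].
move=> /CkSP[cF dF] /[dup] /Ck_pred pf /CkSP[cf df]; apply/CkSP; split.
  by move=> x; apply: (@continuous_comp _ _ _ f F); [exact: cf|exact: cF].
move=> u; have [f1 f2] := df u; have [F1 F2] := dF 1.
have dFf x := is_derive_comp (f1 x) (F1 (f x)).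
split; first by move=> x; have [] := dFf x.
rewrite (_ : (fun _ => _) = fun x => 'D_1 F (f x) * 'D_u f x).
  by apply: CkM => //; exact: (ih ('D_1 F)).
by apply/funext => x; have [] := dFf x.
Qed.

(* On the line, the directional derivatives are multiples of a single one. *)
Lemma Ck_line k (F : R -> R) : continuous F ->
  (forall x, derivable F x 1) -> Ck k (fun x => 'D_1 F x) -> Ck k.+1 F.
Proof.
move=> cF dF CF; apply/CkSP; split=> [|u]; first exact: cF.
have dFu x : is_derive x u F (u * 'D_1 F x).
  have := @is_derive_comp _ F id x u.
  rewrite derive_id mulrC; apply => //; exact: derivable_id.
split; first by move=> x; have [] := dFu x.
rewrite (_ : (fun _ => _) = fun x => cst u x * 'D_1 F x).
  by apply: CkM => //; exact: Ck_cst.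
by apply/funext => x; have [] := dFu x.
Qed.

End Ck_calculus.

Section smooth_calculus.
Context {R : realType}.
Implicit Types V W : normedModType R.

Lemma smooth_continuous V (f : V -> R) : smooth f -> continuous f.
Proof. by move=> /(_ 0%N) []. Qed.

Lemma smooth_derivable V (f : V -> R) x u : smooth f -> derivable f x u.
Proof. by move=> /(_ 1%N)/CkSP[_ /(_ u)[]]. Qed.

Lemma smooth_derive V (f : V -> R) u : smooth f -> smooth (fun x => 'D_u f x).
Proof. by move=> sf k; have /CkSP[_ /(_ u)[]] := sf k.+1. Qed.

Lemma smooth_cst V (c : R) : smooth (cst c : V -> R).
Proof. by move=> k; exact: Ck_cst. Qed.

Lemma smoothD V (f g : V -> R) : smooth f -> smooth g -> smooth (fun x => f x + g x).
Proof. by move=> sf sg k; exact: CkD. Qed.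

Lemma smoothM V (f g : V -> R) : smooth f -> smooth g -> smooth (fun x => f x * g x).
Proof. by move=> sf sg k; exact: CkM. Qed.

Lemma smoothZ V (c : R) (f : V -> R) : smooth f -> smooth (fun x => c * f x).
Proof. by move=> sf; apply: smoothM => //; exact: smooth_cst. Qed.

Lemma smoothN V (f : V -> R) : smooth f -> smooth (fun x => - f x).
Proof.
move=> sf; rewrite (_ : (fun _ => _) = fun x => -1 * f x); first exact: smoothZ.
by apply/funext => x; rewrite mulN1r.
Qed.

Lemma smoothB V (f g : V -> R) : smooth f -> smooth g -> smooth (fun x => f x - g x).
Proof. by move=> sf sg; apply: smoothD => //; exact: smoothN. Qed.

Lemma smoothV V (f : V -> R) : (forall x, f x != 0) -> smooth f ->
  smooth (fun x => (f x)^-1).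
Proof. by move=> f0 sf k; exact: CkV. Qed.

Lemma smooth_affine V W (A L : V -> W) (f : W -> R) : continuous A ->
  (forall x u (h : R), A (h *: u + x) = h *: L u + A x) ->
  smooth f -> smooth (fun x => f (A x)).
Proof. by move=> cA AL sf k; exact: (Ck_affine cA AL). Qed.

Lemma smooth_comp V (F : R -> R) (f : V -> R) : smooth F -> smooth f ->
  smooth (fun x => F (f x)).
Proof. by move=> sF sf k; exact: Ck_comp. Qed.

Lemma smooth_id : smooth (id : R -> R).
Proof.
case=> [|k]; first by split => // x; exact: cvg_id.
apply: Ck_line; [by move=> x; exact: cvg_id|by move=> x; exact: derivable_id|].
rewrite (_ : 'D_1 (id : R -> R) = cst 1); first exact: Ck_cst.
by apply/funext => x; rewrite derive_id.
Qed.

Lemma smooth_fst V W (f : V -> R) : smooth f -> smooth (fun z : V * W => f z.1).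
Proof.
apply: (@smooth_affine (V * W)%type V fst fst) => //.
by move=> x; exact: cvg_fst.
Qed.

Lemma smooth_snd V W (f : W -> R) : smooth f -> smooth (fun z : V * W => f z.2).
Proof.
apply: (@smooth_affine (V * W)%type W snd snd) => //.
by move=> x; exact: cvg_snd.
Qed.

(** A joint induction, since each derivative is the other function up to sign. *)
Lemma Ck_cos_sin k : Ck k (@cos R) /\ Ck k (@sin R).
Proof.
elim: k => [|k [ihc ihs]].
  by split; split => // x; [exact: continuous_cos|exact: continuous_sin].
split; apply: Ck_line.
- by move=> x; exact: continuous_cos.
- by move=> x; exact: ex_derive.
- rewrite (_ : (fun _ => _) = fun x => cst (-1) x * sin x).
    by apply: CkM => //; exact: Ck_cst.
  by apply/funext => x; rewrite derive_val mulN1r.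
- by move=> x; exact: continuous_sin.
- by move=> x; exact: ex_derive.
- rewrite (_ : (fun _ => _) = @cos R)//.
  by apply/funext => x; rewrite derive_val.
Qed.

Lemma smooth_cos : smooth (@cos R).
Proof. by move=> k; have [] := Ck_cos_sin k. Qed.

Lemma smooth_sin : smooth (@sin R).
Proof. by move=> k; have [] := Ck_cos_sin k. Qed.

End smooth_calculus.

(** * A smooth step built from exp(-1/t) *)

Section flat_function.
Context {R : realType}.
Implicit Types (t x : R) (m n : nat).

(* The powers [t ^- m] make the family stable under derivation up to linear combinations. *)
Definition flat m (t : R) : R := if 0 < t then t ^- m * expR (- t^-1) else 0.

Lemma flat_ge0 m t : 0 <= flat m t.
Proof.
by rewrite /flat; case: ifP => // t0; rewrite mulr_ge0 ?expR_ge0// invr_ge0 exprn_ge0// ltW.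
Qed.

Lemma flat_le0 m t : t <= 0 -> flat m t = 0.
Proof. by rewrite /flat leNgt => /negbTE ->. Qed.

Lemma flat_gt0 m t : 0 < t -> 0 < flat m t.
Proof. by move=> t0; rewrite /flat t0 mulr_gt0 ?expR_gt0// invr_gt0 exprn_gt0. Qed.

Lemma flat_le1 t : flat 0 t <= 1.
Proof.
rewrite /flat; case: ifP => // t0.
by rewrite expr0 invr1 mul1r expR_le1 oppr_le0 invr_ge0 ltW.
Qed.

Lemma flat_ge t : 0 < t -> 1 - t^-1 <= flat 0 t.
Proof. by move=> t0; rewrite /flat t0 expr0 invr1 mul1r; exact: expR_ge1Dx. Qed.

(** The exponential series gives exp(1/t) >= t^-(m+1) / (m+1)!, which absorbs the power t^-m and
    leaves one factor t. The vanishing of the difference quotients at 0 rests on this factor. *)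
Lemma flat_bound m t : `|flat m t| <= m.+1`!%:R * `|t|.
Proof.
rewrite ger0_norm ?flat_ge0// /flat; case: ifP => t0; last first.
  by rewrite mulr_ge0.
rewrite expRN ler_pdivrMr ?expR_gt0// gtr0_norm//.
have t0' : 0 <= t^-1 by rewrite invr_ge0 ltW.
have := expR_ge1Dxn m t0' => h.
apply: (@le_trans _ _ (m.+1`!%:R * t * (t^-1 ^+ m.+1 / m.+1`!%:R))).
  rewrite [leRHS](_ : _ = t * t^-1 ^+ m.+1); last first.
    by rewrite mulrACA mulrC mulrA mulrVK ?unitfE ?pnatr_eq0 -?lt0n ?fact_gt0// mulrC.
  by rewrite exprS mulrA divff ?gt_eqF// mul1r exprVn.
apply: ler_wpM2l; first by rewrite mulr_ge0// ltW.
by apply: le_trans h; rewrite lerDr.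
Qed.

Lemma flat_derive m t :
  is_derive t 1 (flat m) (flat m.+2 t - m%:R * flat m.+1 t).
Proof.
have [t0|t0|->] := ltgtP t 0.
- rewrite !flat_le0 ?(ltW t0)// mulr0 subr0.
  apply: (@near_eq_is_derive _ _ _ (cst 0)).
  near=> x; rewrite flat_le0// ltW//; near: x; exact: lt_nbhsl.
- rewrite /flat t0.
  have t1 : t != 0 by rewrite gt_eqF.
  have tm0 : t ^+ m != 0 by rewrite expf_neq0.
  have dV : is_derive t 1 (fun x : R => - x^-1) (t ^- 2).
    have := is_deriveV t1 (is_derive_id t (1 : R)).
    move=> /is_deriveN h; apply: (is_derive_eq h).
    by rewrite scaleNr opprK /= [_ *: _]mulr1.
  have dE : is_derive t 1 (fun x : R => expR (- x^-1)) (expR (- t^-1) * t ^- 2).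
    exact: (@is_derive1_comp _ expR (fun x => - x^-1) _ _ _ (is_derive_expR (- t^-1)) dV).
  have dX : is_derive t 1 (fun x : R => (x ^+ m)^-1)
      (- (t ^+ m) ^- 2 * (m%:R * t ^+ m.-1)).
    have dm : is_derive t 1 (fun x : R => x ^+ m) (m%:R * t ^+ m.-1).
      split; first exact: exprn_derivable.
      by rewrite exp_derive [_ *: _]mulr1.
    by apply: (is_derive_eq (@is_deriveV _ (fun x => x ^+ m) _ _ _ tm0 dm)).
  have dF : is_derive t 1 (fun x => (x ^+ m)^-1 * expR (- x^-1))
      (t ^- m.+2 * expR (- t^-1) - m%:R * (t ^- m.+1 * expR (- t^-1))).
    apply: (is_derive_eq (is_deriveM dX dE)).
    rewrite /GRing.scale/=.
    case: m tm0 {dX} => [|m] tm0; first by rewrite /=; field.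
    rewrite /= !exprS; field.
    by rewrite t1 expf_neq0.
  apply: (near_eq_is_derive _ dF); near=> x.
  rewrite ifT//; near: x; exact: lt_nbhsr.
- rewrite !flat_le0// mulr0 subr0.
  have c : (fun h : R => h^-1 *: ((flat m \o shift 0) (h *: 1) - flat m 0)) @ 0^' --> (0:R).
    have c0 : (fun h : R => m.+2`!%:R * `|h|) @ 0^' --> (0 : R).
      have n0 : (fun h : R => `|h|) @ 0^' --> (0 : R).
        have /cvg_norm : (h : R) @[h --> 0^'] --> (0 : R) by apply: cvg_within.
        by rewrite normr0.
      have := cvgMl_tmp (a := m.+2`!%:R : R) n0; rewrite mulr0; exact.
    have c1 : (fun h : R => - (m.+2`!%:R * `|h|)) @ 0^' --> (0 : R).
      by have := cvgN c0; rewrite oppr0; exact.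
    apply: squeeze_cvgr c1 c0; near=> h; rewrite -ler_norml.
    (* Dividing by h raises the power of 1/h by one, so the difference quotient at 0 is the next
       member of the family. *)
    have -> : h^-1 *: ((flat m \o shift 0) (h *: 1) - flat m 0) = flat m.+1 h.
      rewrite (@flat_le0 m 0)// subr0 /= addr0 [_%:A]mulr1 /flat.
      case: ifP => h0; last by rewrite scaler0.
      by rewrite exprS invfM -mulrA.
    exact: flat_bound.
  split; first by apply/cvg_ex; exists 0.
  exact: cvg_lim c.
Unshelve. all: by end_near. Qed.

Lemma flat_continuous m : continuous (flat m).
Proof.
move=> t; apply/differentiable_continuous/derivable1_diffP.
by have [] := flat_derive m t.
Qed.

Lemma smooth_flat m : smooth (flat m).
Proof.
move=> k; elim: k m => [|k ih] m; first by split => //; exact: flat_continuous.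
apply: Ck_line; first exact: flat_continuous.
  by move=> x; have [] := flat_derive m x.
rewrite (_ : (fun _ => _) = fun t => flat m.+2 t + cst (- m%:R) t * flat m.+1 t).
  by apply: CkD => //; apply: CkM => //; exact: Ck_cst.
by apply/funext => t; have [_ ->] := flat_derive m t; rewrite /= mulNr.
Qed.

(** The usual smooth transition from 0 to 1 across the unit interval; the denominator is positive
    since [t] and [1 - t] are never both nonpositive. *)
Definition step t := flat 0 t / (flat 0 t + flat 0 (1 - t)).

Lemma step_den_gt0 t : 0 < flat 0 t + flat 0 (1 - t).
Proof.
have [t0|t0] := ltP 0 t; first by rewrite ltr_pwDl ?flat_gt0 ?flat_ge0.
by rewrite ltr_wpDl ?flat_ge0// flat_gt0//; lra.
Qed.

Lemma step_le0 t : t <= 0 -> step t = 0.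
Proof. by move=> t0; rewrite /step flat_le0// mul0r. Qed.

Lemma step_ge1 t : 1 <= t -> step t = 1.
Proof.
move=> t1; rewrite /step (@flat_le0 _ (1 - t)); last lra.
by rewrite addr0 divff// gt_eqF// flat_gt0//; lra.
Qed.

Lemma step_ge0 t : 0 <= step t.
Proof. by rewrite divr_ge0 ?flat_ge0// ltW ?step_den_gt0. Qed.

Lemma step_le1 t : step t <= 1.
Proof. by rewrite ler_pdivrMr ?step_den_gt0// mul1r lerDl flat_ge0. Qed.

Lemma smooth_aff (a b : R) : smooth (fun t : R => a * t + b).
Proof.
by apply: smoothD; [apply: smoothM; [exact: smooth_cst|exact: smooth_id]|exact: smooth_cst].
Qed.

Lemma smooth_step : smooth step.
Proof.
apply: smoothM; first exact: smooth_flat.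
apply: smoothV; first by move=> x; rewrite gt_eqF ?step_den_gt0.
apply: smoothD; first exact: smooth_flat.
apply: smooth_comp; first exact: smooth_flat.
rewrite (_ : (fun _ => _) = fun x => -1 * x + 1); first exact: smooth_aff.
by apply/funext => x; rewrite mulN1r addrC.
Qed.

End flat_function.

(** * Cutoff sequences and countable bases of open sets *)

Section test_functions.
Context {R : realType}.
Implicit Types V W : normedModType R.

Lemma test_function0 V (D : set V) : test_function D (cst 0 : V -> R).
Proof. by split; [exact: smooth_cst|exists set0; split => //; exact: compact0]. Qed.

Lemma test_functionD V (D : set V) (f g : V -> R) :
  test_function D f -> test_function D g -> test_function D (fun x => f x + g x).
Proof.
move=> [sf [K [cK KD fK]]] [sg [K' [cK' KD' gK]]]; split; first exact: smoothD.
exists (K `|` K'); split; first exact: compactU.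
  by rewrite subUset.
by move=> x /not_orP[Kx K'x]; rewrite fK// gK// addr0.
Qed.

Lemma test_functionM V (D : set V) (f g : V -> R) :
  test_function D f -> smooth g -> test_function D (fun x => f x * g x).
Proof.
move=> [sf [K [cK KD fK]]] sg; split; first exact: smoothM.
by exists K; split => // x Kx; rewrite fK// mul0r.
Qed.

Lemma test_functionZ V (D : set V) c (f : V -> R) :
  test_function D f -> test_function D (fun x => c * f x).
Proof.
move=> tf; rewrite (_ : (fun _ => _) = fun x => f x * cst c x).
  by apply: test_functionM => //; exact: smooth_cst.
by apply/funext => x; rewrite mulrC.
Qed.

Lemma test_functionS V (D E : set V) (f : V -> R) : D `<=` E ->
  test_function D f -> test_function E f.
Proof.
move=> DE [sf [K [cK KD fK]]]; split => //; exists K; split => //.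
exact: subset_trans DE.
Qed.

Lemma test_function_out V (D : set V) (f : V -> R) x : test_function D f ->
  ~ D x -> f x = 0.
Proof. by move=> [sf [K [cK KD fK]]] Dx; apply: fK => /KD. Qed.

Lemma test_function_setX V W (D : set V) (E : set W) (f : V -> R) (g : W -> R) :
  test_function D f -> test_function E g ->
  test_function (D `*` E) (fun z : V * W => f z.1 * g z.2).
Proof.
move=> [sf [K [cK KD fK]]] [sg [L [cL LE gL]]]; split.
  by apply: smoothM; [exact: smooth_fst|exact: smooth_snd].
exists (K `*` L); split; first exact: compact_setX.
  by move=> z [/= Kz Lz]; split; [exact: KD|exact: LE].
move=> [x y] /= /not_andP[Kx|Ly]; first by rewrite fK ?mul0r.
by rewrite gL ?mulr0.
Qed.

(** Together with the support condition this is pointwise convergence to the indicator of [D] on the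
    whole space, bounded by 1: the form in which dominated convergence uses it. *)
Definition cutoff V (D : set V) := exists chi : nat -> V -> R,
  [/\ forall n, test_function D (chi n), forall n x, 0 <= chi n x <= 1 &
      forall x, D x -> chi ^~ x @ \oo --> (1 : R)].

(** The complements are multiplied: 1 - prod_(i < n) (1 - chi i n) stays in [0, 1], has its support
    in finitely many of the sets, and tends to 1 wherever one factor of the product tends to 0. *)
Lemma cutoff_bigcup V (B : nat -> set V) : (forall n, cutoff (B n)) ->
  cutoff (\bigcup_n B n).
Proof.
move=> /choice[chi chiP].
pose P m n x : R := \prod_(i < m) (1 - chi i n x).
have P01 m n x : 0 <= P m n x <= 1.
  rewrite prodr_ge0 => [|i _]; last first.
    by have [_ /(_ n x)/andP[_]] := chiP i; rewrite subr_ge0.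
  apply: prodr_ile1 => i _; have [_ /(_ n x)/andP[c0 c1] _] := chiP i.
  by rewrite subr_ge0 c1 gerBl.
exists (fun n x => 1 - P n n x); split.
- move=> n; suff h m : test_function (\bigcup_n B n) (fun x => 1 - P m n x) by [].
  elim: m => [|m ih].
    rewrite (_ : (fun _ => _) = cst 0); first exact: test_function0.
    by apply/funext => x; rewrite /P big_ord0 subrr.
  have [/(_ n) tm _ _] := chiP m.
  have {}tm := test_functionS (bigcup_sup (i := m) (P := setT) (F := B) I) tm.
  (* The recursion 1 - P m.+1 = (1 - P m) + chi m P m keeps the compact support visible; the factor
     P m is written 1 - (1 - P m) so that its smoothness comes from the induction hypothesis. *)
  rewrite (_ : (fun _ => _) = fun x => (1 - P m n x) +
      chi m n x * (1 - (1 - P m n x))).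
    apply: test_functionD => //; apply: test_functionM => //.
    by apply: smoothB; [exact: smooth_cst|case: ih].
  by apply/funext => x; rewrite /P big_ord_recr /=; ring.
- by move=> n x; have /andP[P0 P1] := P01 n n x; rewrite subr_ge0 P1 gerBl.
- move=> x [i _ Bix]; have [_ c01 /(_ _ Bix) ci] := chiP i.
  have Pc : \forall n \near \oo, 0 <= P n n x <= 1 - chi i n x.
    near=> n; have /andP[P0 _] := P01 n n x; rewrite P0/=.
    have ni : (i < n)%N by near: n; exact: nbhs_infty_gt.
    rewrite /P (bigD1 (Ordinal ni))//=.
    have /andP[c0 c1] := c01 n x.
    rewrite ler_piMr ?subr_ge0//; apply: prodr_ile1 => j _.
    have [_ /(_ n x)/andP[d0 d1] _] := chiP j.
    by rewrite subr_ge0 d1 gerBl.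
  have c1 : (fun n => 1 - chi i n x) @ \oo --> (0 : R).
    by have := cvgB (cvg_cst (1 : R)) ci; rewrite subrr; exact.
  have := cvgB (cvg_cst (1 : R)) (squeeze_cvgr Pc (cvg_cst 0) c1).
  by rewrite subr0; exact.
Unshelve. all: by end_near. Qed.

Lemma cutoff_setX V W (D : set V) (E : set W) : cutoff D -> cutoff E ->
  cutoff (D `*` E).
Proof.
move=> [f [tf f01 f1]] [g [tg g01 g1]].
exists (fun n z => f n z.1 * g n z.2); split.
- by move=> n; exact: test_function_setX.
- move=> n z; have /andP[? ?] := f01 n z.1; have /andP[? ?] := g01 n z.2.
  by rewrite mulr_ge0// mulr_ile1.
- move=> z [Dz Ez]; have := cvgM (f1 _ Dz) (g1 _ Ez); rewrite mulr1; exact.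
Qed.

Lemma cutoff_itv (a b : R) : cutoff (`]a, b[%classic : set R).
Proof.
(* The offset -1 makes the product vanish outside [a + 1 / n.+1, b - 1 / n.+1], a compact subset of
   the interval; for a fixed interior x both arguments tend to infinity and [flat 0] tends to 1. *)
exists (fun n x => flat 0 (n.+1%:R * (x - a) - 1) * flat 0 (n.+1%:R * (b - x) - 1)).
have fl (c : R) : 0 < c -> (fun n : nat => flat 0 (n.+1%:R * c - 1)) @ \oo --> (1 : R).
  move=> c0; apply/cvgrPdist_le => e e0; near=> n.
  have h : 1 + e^-1 < n.+1%:R * c.
    rewrite -ltr_pdivrMr//; near: n; exists (Num.truncn ((1 + e^-1) / c)) => // n /= nb.
    by apply: lt_le_trans (truncnS_gt _) _; rewrite ler_nat.
  have e1 : 0 < e^-1 by rewrite invr_gt0.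
  have h0 : 0 < n.+1%:R * c - 1 by lra.
  have h1 := flat_ge h0; have h2 := flat_le1 (n.+1%:R * c - 1).
  rewrite ger0_norm ?subr_ge0// lerBlDr -lerBlDl.
  apply: le_trans h1; rewrite lerD2l lerN2 -[leRHS]invrK lef_pV2 ?posrE//.
  by rewrite lerBrDl ltW.
split.
- move=> n; split.
    apply: smoothM; apply: smooth_comp; try exact: smooth_flat.
      rewrite (_ : (fun _ => _) = fun x => n.+1%:R * x + (- n.+1%:R * a - 1)).
        exact: smooth_aff.
      by apply/funext => x; ring.
    rewrite (_ : (fun _ => _) = fun x => - n.+1%:R * x + (n.+1%:R * b - 1)).
      exact: smooth_aff.
    by apply/funext => x; ring.
  have n0 : (0 : R) < n.+1%:R by rewrite ltr0n.
  have i0 : (0 : R) < n.+1%:R^-1 by rewrite invr_gt0.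
  exists `[a + n.+1%:R^-1, b - n.+1%:R^-1]%classic; split.
  + exact: segment_compact.
  + by move=> x /=; rewrite !in_itv/= => /andP[h1 h2];
      rewrite (lt_le_trans _ h1) ?ltrDl// (le_lt_trans h2)// ltrBlDr ltrDl.
  + move=> x /=; rewrite in_itv/= => /negP; rewrite negb_and -!ltNge => /orP[h|h].
      rewrite flat_le0 ?mul0r// subr_le0 -[leRHS](mulfV (lt0r_neq0 n0)).
      by rewrite ler_pM2l// lerBlDl ltW.
    rewrite mulrC flat_le0 ?mul0r// subr_le0 -[leRHS](mulfV (lt0r_neq0 n0)).
    by rewrite ler_pM2l// lerBlDl -lerBlDr ltW.
- by move=> n x; rewrite mulr_ge0 ?flat_ge0// mulr_ile1 ?flat_ge0 ?flat_le1.
- move=> x /=; rewrite in_itv/= => /andP[ax xb].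
  have xa0 : 0 < x - a by rewrite subr_gt0.
  have bx0 : 0 < b - x by rewrite subr_gt0.
  by have := cvgM (fl _ xa0) (fl _ bx0); rewrite mulr1; exact.
Unshelve. all: by end_near. Qed.

(** A countable base: every open set is a countable union of base sets, which reduces both
    measurability and cutoffs to boxes. *)
Definition neighborhood_base (V : topologicalType) (B : nat -> set V) :=
  forall (D : set V) x, open D -> D x -> exists2 n, B n x & B n `<=` D.

Lemma base_bigcup (V : topologicalType) (B : nat -> set V) (D : set V) :
  neighborhood_base B -> open D ->
  D = \bigcup_n (if `[< B n `<=` D >] then B n else set0).
Proof.
move=> BB oD; apply/seteqP; split => [x Dx|x [n _]].
  by have [n Bx BD] := BB _ _ oD Dx; exists n => //; rewrite asboolT.
by case: asboolP => // h; exact: h.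
Qed.

Lemma cutoff_open V (B : nat -> set V) (D : set V) : neighborhood_base B ->
  (forall n, cutoff (B n)) -> open D -> cutoff D.
Proof.
move=> BB cB oD; rewrite (base_bigcup BB oD); apply: cutoff_bigcup => n.
case: ifP => // _; exists (fun _ => cst 0); split => //.
- by move=> _; exact: test_function0.
- by move=> _ x /=; rewrite lexx ler01.
Qed.

Lemma measurable_open_base d (X : measurableType d) (V : topologicalType)
    (B : nat -> set V) (f : X -> V) (D : set V) : neighborhood_base B ->
  (forall n, measurable (f @^-1` (B n))) -> open D -> measurable (f @^-1` D).
Proof.
move=> BB mB oD; rewrite (base_bigcup BB oD) preimage_bigcup.
by apply: bigcup_measurable => n _; case: ifP => // _; rewrite preimage_set0.
Qed.

Definition prod_base (T U : Type) (B : nat -> set T) (C : nat -> set U) (n : nat) :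
    set (T * U) :=
  if @unpickle (nat * nat)%type n is Some ij then B ij.1 `*` C ij.2 else set0.

Lemma prod_base_nbhs V W (B : nat -> set V) (C : nat -> set W) :
  neighborhood_base B -> neighborhood_base C -> neighborhood_base (prod_base B C).
Proof.
move=> BB CC D [x y] oD Dxy.
have : nbhs (x, y) D by exact: open_nbhs_nbhs.
move=> [[P Q] /= [nP nQ] PQD].
move: nP; rewrite nbhsE => -[P' [oP' P'x] P'P].
move: nQ; rewrite nbhsE => -[Q' [oQ' Q'y] Q'Q].
have [i Bx BP] := BB _ _ oP' P'x.
have [j Cy CQ] := CC _ _ oQ' Q'y.
exists (pickle (i, j)); rewrite /prod_base pickleK//=.
by move=> [a b] [/= Ba Cb]; apply: PQD; split => /=; [exact/P'P/BP|exact/Q'Q/CQ].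
Qed.

Lemma prod_base_cutoff V W (B : nat -> set V) (C : nat -> set W) :
  (forall n, cutoff (B n)) -> (forall n, cutoff (C n)) ->
  forall n, cutoff (prod_base B C n).
Proof.
move=> cB cC n; rewrite /prod_base; case: unpickle => [ij|]; first exact: cutoff_setX.
exists (fun _ => cst 0); split => //.
- by move=> _; exact: test_function0.
- by move=> _ x /=; rewrite lexx ler01.
Qed.

Lemma prod_base_measurable d d' (X : measurableType d) (Y : measurableType d')
  (B : nat -> set X) (C : nat -> set Y) :
  (forall n, measurable (B n)) -> (forall n, measurable (C n)) ->
  forall n, measurable (prod_base B C n).
Proof.
move=> mB mC n; rewrite /prod_base; case: unpickle => [ij|//].
exact: measurableX.
Qed.

Definition base1 (n : nat) : set (point1 R) :=
  if @unpickle (rat * rat)%type n is Some cr then ball (ratr cr.1 : R) (ratr cr.2)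
  else set0.

Lemma base1E n : exists a b : R, base1 n = `]a, b[%classic.
Proof.
rewrite /base1; case: unpickle => [[c r]|].
  by exists (ratr c - ratr r), (ratr c + ratr r); rewrite ball_itv.
by exists 0, 0; rewrite set_itv_ge// bnd_simp ltxx.
Qed.

Lemma base1_nbhs : neighborhood_base (V := point1 R) base1.
Proof.
move=> D x oD /mem_set Dx; have [c [r [/set_mem xB BD]]] := open_subball_rat oD Dx.
by exists (pickle (c, r)); rewrite /base1 pickleK.
Qed.

Lemma base1_cutoff n : cutoff (V := point1 R) (base1 n).
Proof. by have [a [b ->]] := base1E n; exact: cutoff_itv. Qed.

Lemma base1_measurable n : measurable (base1 n).
Proof. by have [a [b ->]] := base1E n; exact: measurable_itv. Qed.

Definition base3 : nat -> set (point3 R) := prod_base (prod_base base1 base1) base1.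
Definition base4 : nat -> set (point4 R) := prod_base base3 base1.

Lemma base3_nbhs : neighborhood_base base3.
Proof. by do !apply: prod_base_nbhs; exact: base1_nbhs. Qed.

Lemma base4_nbhs : neighborhood_base base4.
Proof. by apply: prod_base_nbhs; [exact: base3_nbhs|exact: base1_nbhs]. Qed.

Lemma base3_measurable n : measurable (base3 n).
Proof.
by apply: prod_base_measurable => {}n;
  [apply: prod_base_measurable => {}n|]; exact: base1_measurable.
Qed.

Lemma base4_measurable n : measurable (base4 n).
Proof.
by apply: prod_base_measurable => {}n; [exact: base3_measurable|exact: base1_measurable].
Qed.

Lemma cutoff_open3 (D : set (point3 R)) : open D -> cutoff D.
Proof.
apply: (cutoff_open base3_nbhs); do 2 ?apply: prod_base_cutoff => //; exact: base1_cutoff.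
Qed.

Lemma cutoff_open4 (D : set (point4 R)) : open D -> cutoff D.
Proof.
apply: (cutoff_open base4_nbhs); do 3 ?apply: prod_base_cutoff => //; exact: base1_cutoff.
Qed.

Lemma open3_measurable (D : set (point3 R)) : open D -> measurable D.
Proof. by move=> oD; have := @measurable_open_base _ (point3 R) (point3 R) base3 id D base3_nbhs base3_measurable oD. Qed.

Lemma open4_measurable (D : set (point4 R)) : open D -> measurable D.
Proof. by move=> oD; have := @measurable_open_base _ (point4 R) (point4 R) base4 id D base4_nbhs base4_measurable oD. Qed.

End test_functions.

(** * Square-integrable functions and fields *)

Lemma discriminant_le (R : realType) (a b c : R) : 0 <= a -> 0 <= b ->
  (forall t, 0 <= t ^+ 2 * a + b + 2 * (t * c)) -> c ^+ 2 <= a * b.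
Proof.
move=> a0 b0 h; move: a0; rewrite le_eqVlt => /predU1P[a0|a0].
  rewrite -a0 mul0r; have [->|c0] := eqVneq c 0; first by rewrite expr0n.
  (* For a = 0 the expression is affine in t, and at this t it equals -1. *)
  have := h (- (b + 1) / (2 * c)); rewrite -a0 mulr0 add0r.
  have -> : 2 * (- (b + 1) / (2 * c) * c) = - (b + 1) by field.
  by move: b0; lra.
have := h (- c / a).
have -> : (- c / a) ^+ 2 * a + b + 2 * (- c / a * c) = b - c ^+ 2 / a.
  by field; rewrite gt_eqF.
by rewrite subr_ge0 ler_pdivrMr// mulrC.
Qed.

Section real_integrals.
Context {d} {X : measurableType d} {R : realType}.
Variables (mu : {measure set X -> \bar R}) (D : set X).
Hypothesis mD : measurable D.
Implicit Types f g : X -> R.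
Local Notation intble f := (mu.-integrable D (EFin \o f)).

Lemma intble_measurable f : intble f -> measurable_fun D f.
Proof. by move=> /measurable_int/measurable_EFinP. Qed.

Lemma intbleD f g : intble f -> intble g -> intble (fun x => f x + g x).
Proof. by move=> intf intg; have := integrableD mD intf intg. Qed.

Lemma intbleB f g : intble f -> intble g -> intble (fun x => f x - g x).
Proof. by move=> intf intg; have := integrableB mD intf intg. Qed.

Lemma intbleZ c f : intble f -> intble (fun x => c * f x).
Proof. by move=> intf; have := integrableZl mD c intf. Qed.

Lemma intble_sum (I : Type) (s : seq I) (F : I -> X -> R) :
  (forall i, intble (F i)) -> intble (fun x => \sum_(i <- s) F i x).
Proof.
move=> h; elim: s => [|i s ih].
  by under eq_fun do rewrite big_nil; exact: integrable0.
by under eq_fun do rewrite big_cons; exact: intbleD.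
Qed.

Lemma intble_le f g : measurable_fun D f -> (forall x, D x -> `|f x| <= g x) ->
  intble g -> intble f.
Proof.
move=> mf fg ig; apply: le_integrable ig => //; first exact/measurable_EFinP.
by move=> x Dx /=; rewrite lee_fin (le_trans (fg _ Dx))// ler_norm.
Qed.

Lemma intble_ge0 f : measurable_fun D f -> (forall x, D x -> 0 <= f x) ->
  (\int[mu]_(x in D) (f x)%:E < +oo)%E -> intble f.
Proof.
move=> mf f0 foo; apply/integrableP; split; first exact/measurable_EFinP.
rewrite (eq_integral (fun x => (f x)%:E))// => x /set_mem Dx /=.
by rewrite ger0_norm ?f0.
Qed.

Lemma intble_eq f g : {in D, f =1 g} -> intble f -> intble g.
Proof. by move=> fg; apply: eq_integrable => // x xD /=; rewrite fg. Qed.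

Lemma intble_fin f : intble f ->
  (\int[mu]_(x in D) (f x)%:E = (\int[mu]_(x in D) f x)%:E)%E.
Proof. by move=> intf; rewrite /Rintegral fineK//; exact: integrable_fin_num. Qed.

Lemma Rintegral_sum (I : Type) (s : seq I) (F : I -> X -> R) :
  (forall i, intble (F i)) ->
  \int[mu]_(x in D) (\sum_(i <- s) F i x) = \sum_(i <- s) \int[mu]_(x in D) F i x.
Proof.
move=> h; elim: s => [|i s ih].
  by rewrite big_nil; under eq_Rintegral do rewrite big_nil;
    rewrite Rintegral_cst// mul0r.
rewrite big_cons -ih -RintegralD//; last exact: intble_sum.
by apply: eq_Rintegral => x _; rewrite big_cons.
Qed.

Lemma dominated_Rintegral (f_ : nat -> X -> R) f g :
  (forall n, measurable_fun D (f_ n)) -> measurable_fun D f ->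
  (forall x, D x -> f_ ^~ x @ \oo --> f x) -> intble g ->
  (forall x n, D x -> `|f_ n x| <= g x) ->
  \int[mu]_(x in D) f_ n x @[n --> \oo] --> \int[mu]_(x in D) f x.
Proof.
move=> mf_ mf cf ig fg.
have [] := @dominated_convergence _ _ _ mu D mD (fun n x => (f_ n x)%:E)
    (fun x => (f x)%:E) (fun x => (g x)%:E).
- by move=> n; exact/measurable_EFinP.
- exact/measurable_EFinP.
- by apply: aeW => x Dx; apply: cvg_EFin; [exact: nearW|exact: cf].
- exact: ig.
- by apply: aeW => x n Dx; rewrite /= lee_fin fg.
move=> intf _; rewrite intble_fin// => c.
exact: (fine_cvg c).
Qed.

Lemma Rintegral0_ae f : intble f -> (forall x, D x -> 0 <= f x) ->
  \int[mu]_(x in D) f x <= 0 -> {ae mu, forall x, D x -> f x = 0}.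
Proof.
move=> intf f0 i0.
have : (\int[mu]_(x in D) `|(f x)%:E| = 0)%E.
  rewrite (eq_integral (fun x => (f x)%:E)); last first.
    by move=> x /set_mem Dx; rewrite gee0_abs// lee_fin f0.
  rewrite intble_fin//; congr EFin; apply/eqP; rewrite eq_le i0/=.
  exact: Rintegral_ge0.
move=> /(ae_eq_integral_abs mu mD (measurable_int _ intf)).
by apply: filterS => x h Dx; have [] := h Dx.
Qed.

Lemma ae_eq_Rintegral f g : measurable_fun D f -> measurable_fun D g ->
  {ae mu, forall x, D x -> f x = g x} ->
  \int[mu]_(x in D) f x = \int[mu]_(x in D) g x.
Proof.
move=> mf mg fg; rewrite /Rintegral; congr fine; apply: ae_eq_integral => //.
- exact/measurable_EFinP.
- exact/measurable_EFinP.
- by apply: filterS fg => x h Dx; rewrite h.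
Qed.

End real_integrals.

Section square_integrable.
Context {d} {X : measurableType d} {R : realType}.
Variables (mu : {measure set X -> \bar R}) (D : set X).
Hypothesis mD : measurable D.
Implicit Types f g : X -> R.
Local Notation intble f := (mu.-integrable D (EFin \o f)).
Local Notation scalL2 := (scalL2 mu D).
Local Notation sq f := (\int[mu]_(x in D) ((f x) ^+ 2)).

Lemma scalL2_sqr f : scalL2 f -> intble (fun x => f x ^+ 2).
Proof.
move=> [mf foo]; apply: intble_ge0 => //; first exact: measurable_funX.
by move=> x _; rewrite sqr_ge0.
Qed.

Lemma scalL2P f : measurable_fun D f -> intble (fun x => f x ^+ 2) -> scalL2 f.
Proof.
move=> mf intf; split => //; rewrite (intble_fin mD intf); exact: ltry.
Qed.

Lemma scalL2_le f g : measurable_fun D f -> (forall x, D x -> `|f x| <= `|g x|) ->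
  scalL2 g -> scalL2 f.
Proof.
move=> mf fg /scalL2_sqr ig; apply: scalL2P => //.
apply: intble_le ig => //; first exact: measurable_funX.
by move=> x Dx; rewrite normrX -(real_normK (num_real (g x))) lerXn2r ?nnegrE// fg.
Qed.

Lemma scalL2M_int f g : scalL2 f -> scalL2 g -> intble (fun x => f x * g x).
Proof.
move=> Lf Lg; apply: (@intble_le _ _ _ mu D mD _ (fun x => f x ^+ 2 + g x ^+ 2)).
- by apply: measurable_funM; [case: Lf|case: Lg].
- move=> x _; rewrite normrM -(real_normK (num_real (f x))).
  rewrite -(real_normK (num_real (g x))).
  have := sqr_ge0 (`|f x| - `|g x|).
  have := mulr_ge0 (normr_ge0 (f x)) (normr_ge0 (g x)).
  move: (`|f x|) (`|g x|) => a b; nra.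
- by apply: intbleD => //; exact: scalL2_sqr.
Qed.

Lemma scalL2D f g : scalL2 f -> scalL2 g -> scalL2 (fun x => f x + g x).
Proof.
move=> Lf Lg; apply: scalL2P; first by apply: measurable_funD; [case: Lf|case: Lg].
suff h : intble (fun x => (f x ^+ 2 + g x ^+ 2) + 2 * (f x * g x)).
  by apply: intble_eq h => // x _; ring.
apply: intbleD => //; last by apply: intbleZ => //; exact: scalL2M_int.
by apply: intbleD => //; exact: scalL2_sqr.
Qed.

Lemma scalL2Z c f : scalL2 f -> scalL2 (fun x => c * f x).
Proof.
move=> Lf; apply: scalL2P; first by apply: measurable_funM => //; case: Lf.
suff h : intble (fun x => c ^+ 2 * (f x ^+ 2)).
  by apply: intble_eq h => // x _; rewrite exprMn.
by apply: intbleZ => //; exact: scalL2_sqr.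
Qed.

Lemma scalL2B f g : scalL2 f -> scalL2 g -> scalL2 (fun x => f x - g x).
Proof.
move=> Lf Lg; rewrite (_ : (fun _ => _) = fun x => f x + -1 * g x).
  by apply: scalL2D => //; exact: scalL2Z.
by apply/funext => x; rewrite mulN1r.
Qed.

Lemma scalL2_bnd (b : X -> R) (M : R) f : measurable_fun D b ->
  (forall x, D x -> `|b x| <= M) -> scalL2 f -> scalL2 (fun x => b x * f x).
Proof.
move=> mb bM Lf; apply: scalL2_le (scalL2Z M Lf).
  by apply: measurable_funM => //; case: Lf.
move=> x Dx; rewrite !normrM ler_wpM2r//.
by apply: le_trans (bM _ Dx) _; rewrite ler_norm.
Qed.

Lemma scalL2_0 : scalL2 (fun=> 0).
Proof.
split => //; under eq_integral do rewrite expr0n/=.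
by rewrite integral0 ltry.
Qed.

Lemma scalL2_sum (I : Type) (s : seq I) (F : I -> X -> R) :
  (forall i, scalL2 (F i)) -> scalL2 (fun x => \sum_(i <- s) F i x).
Proof.
move=> h; elim: s => [|i s ih].
  by under eq_fun do rewrite big_nil; exact: scalL2_0.
by under eq_fun do rewrite big_cons; exact: scalL2D.
Qed.

Lemma sq_ge0 f : 0 <= sq f.
Proof. by apply: Rintegral_ge0 => x _; exact: sqr_ge0. Qed.

Lemma sqZ c f : scalL2 f -> sq (fun x => c * f x) = c ^+ 2 * sq f.
Proof.
move=> Lf; rewrite -RintegralZl//; last exact: scalL2_sqr.
by apply: eq_Rintegral => x _; rewrite exprMn.
Qed.

Lemma sqD f g : scalL2 f -> scalL2 g ->
  sq (fun x => f x + g x) = sq f + sq g + 2 * \int[mu]_(x in D) (f x * g x).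
Proof.
move=> Lf Lg.
have if2 := scalL2_sqr Lf; have ig2 := scalL2_sqr Lg; have ifg := scalL2M_int Lf Lg.
rewrite -RintegralZl// -RintegralD// -RintegralD//.
- by apply: eq_Rintegral => x _; ring.
- exact: intbleD.
- exact: intbleZ.
Qed.

Lemma sqD_le f g : scalL2 f -> scalL2 g ->
  sq (fun x => f x + g x) <= 2 * sq f + 2 * sq g.
Proof.
move=> Lf Lg; have h1 := sqD Lf Lg.
have := sqD Lf (scalL2Z (-1) Lg); rewrite sqZ// sqrrN expr1n mul1r.
have := sq_ge0 (fun x => f x + -1 * g x).
have -> : \int[mu]_(x in D) (f x * (-1 * g x)) = - \int[mu]_(x in D) (f x * g x).
  rewrite -[RHS]mulN1r -RintegralZl//; last exact: scalL2M_int.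
  by apply: eq_Rintegral => x _; ring.
by rewrite h1; lra.
Qed.

Lemma cauchy_schwarz f g : scalL2 f -> scalL2 g ->
  (\int[mu]_(x in D) (f x * g x)) ^+ 2 <= sq f * sq g.
Proof.
move=> Lf Lg; set I := \int[mu]_(x in D) _.
have h (t : R) : 0 <= t ^+ 2 * sq f + sq g + 2 * (t * I).
  rewrite -sqZ// -RintegralZl//; last exact: scalL2M_int.
  rewrite (_ : \int[mu]_(x in D) (t * (f x * g x)) =
               \int[mu]_(x in D) ((t * f x) * g x)); last first.
    by apply: eq_Rintegral => x _; rewrite mulrA.
  by rewrite -sqD ?sq_ge0//; exact: scalL2Z.
by apply: discriminant_le h; exact: sq_ge0.
Qed.

Lemma sq_cvg (f_ : nat -> X -> R) f g :
  (forall n, measurable_fun D (f_ n)) -> measurable_fun D f ->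
  (forall x, D x -> f_ ^~ x @ \oo --> f x) -> scalL2 g ->
  (forall x n, D x -> `|f_ n x| <= g x) ->
  sq (fun x => f_ n x - f x) @[n --> \oo] --> (0 : R).
Proof.
move=> mf_ mf cf ig fg.
have fg' x : D x -> `|f x| <= g x.
  move=> Dx; have h : `|f_ n x| @[n --> \oo] --> `|f x| by apply: cvg_norm; exact: cf.
  rewrite -(cvg_lim _ h)//; apply: limr_le; first by apply/cvg_ex; eexists; exact: h.
  by apply: nearW => n; exact: fg.
have -> : (0 : R) = \int[mu]_(x in D) 0 by rewrite Rintegral_cst// mul0r.
apply: (@dominated_Rintegral _ _ _ mu D mD _ _ (fun x => (2 * g x) ^+ 2)) => //.
- by move=> n; apply: measurable_funX; exact: measurable_funB.
- move=> x Dx; have h : f_ n x - f x @[n --> \oo] --> (0 : R).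
    by rewrite -(subrr (f x)); apply: cvgB; [exact: cf|exact: cvg_cst].
  by have := cvgM h h; rewrite mulr0; exact.
- by apply: scalL2_sqr; exact: scalL2Z.
- move=> x n Dx; rewrite normrX lerXn2r ?nnegrE//.
    by rewrite mulr_ge0// (le_trans _ (fg x 0%N Dx)).
  by rewrite (le_trans (ler_normB _ _))// mulr_natl mulr2n lerD ?fg ?fg'.
Qed.

End square_integrable.

(** * Density in L2 from an intersection-stable generator *)

Section density.
Import HBNNSimple.
Context {d} {X : measurableType d} {R : realType}.
Variables (mu : {measure set X -> \bar R}) (D : set X).
Implicit Types f g : X -> R.
Hypotheses (mD : measurable D) (Doo : (mu D < +oo)%E).
Variable TF : set (X -> R).
Hypothesis TF_measurable : forall f, TF f -> measurable_fun D f.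
Hypothesis TF0 : TF (fun=> 0).
Hypothesis TFD : forall f g, TF f -> TF g -> TF (fun x => f x + g x).
Hypothesis TFZ : forall c f, TF f -> TF (fun x => c * f x).
Variable G : set (set X).
Hypotheses (GI : setI_closed G) (GT : G setT) (sG : measurable = <<s G >>).
Hypothesis GTF : forall A, G A -> exists chi : nat -> X -> R,
  [/\ forall n, TF (chi n), forall n x, 0 <= chi n x <= 1 &
      forall x, D x -> chi ^~ x @ \oo --> (\1_A x : R)].
Local Notation scalL2 := (scalL2 mu D).
Local Notation sq f := (\int[mu]_(x in D) ((f x) ^+ 2)).

(** Membership in the L2 closure of [TF]. The square integrability of [phi] is recorded because
    members of [TF] are only assumed measurable. *)
Definition TF_limit (f : X -> R) := scalL2 f /\
  forall e : R, 0 < e -> exists2 phi, TF phi /\ scalL2 phi & sq (fun x => f x - phi x) < e.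

Lemma scalL2_finite f (M : R) : measurable_fun D f -> (forall x, D x -> `|f x| <= M) ->
  scalL2 f.
Proof.
move=> mf fM; apply: scalL2P => //.
apply: measurable_bounded_integrable => //; first exact: measurable_funX.
exists (M ^+ 2); split; first exact: num_real.
move=> y My x Dx; rewrite /= normrX.
by apply: le_trans (ltW My); rewrite lerXn2r ?nnegrE ?fM// (le_trans _ (fM _ Dx)).
Qed.

Lemma TF_limit_closed f : scalL2 f ->
  (forall e : R, 0 < e -> exists2 g, TF_limit g & sq (fun x => f x - g x) < e) ->
  TF_limit f.
Proof.
move=> Lf h; split => // e e0.
have [|g [Lg gP] fg] := h (e / 4); first by rewrite divr_gt0.
have [|phi [tphi Lphi] gphi] := gP (e / 4); first by rewrite divr_gt0.
exists phi => //.
have := sqD_le mD (scalL2B mD Lf Lg) (scalL2B mD Lg Lphi).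
rewrite (_ : \int[mu]_(x in D) ((f x - g x + (g x - phi x)) ^+ 2) =
    sq (fun x => f x - phi x)); last by apply: eq_Rintegral => x _; ring.
by move=> /le_lt_trans; apply; lra.
Qed.

Lemma TF_limitD f g : TF_limit f -> TF_limit g -> TF_limit (fun x => f x + g x).
Proof.
move=> [Lf fP] [Lg gP]; split; first exact: scalL2D.
move=> e e0; have [|p [tp Lp] fp] := fP (e / 4); first by rewrite divr_gt0.
have [|q [tq Lq] gq] := gP (e / 4); first by rewrite divr_gt0.
exists (fun x => p x + q x); first by split; [exact: TFD|exact: scalL2D].
have := sqD_le mD (scalL2B mD Lf Lp) (scalL2B mD Lg Lq).
rewrite (_ : \int[mu]_(x in D) ((f x - p x + (g x - q x)) ^+ 2) =
    sq (fun x => f x + g x - (p x + q x))); last by apply: eq_Rintegral => x _; ring.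
by move=> /le_lt_trans; apply; lra.
Qed.

Lemma TF_limitZ c f : TF_limit f -> TF_limit (fun x => c * f x).
Proof.
move=> [Lf fP]; split; first exact: scalL2Z.
move=> e e0; have c0 : 0 < c ^+ 2 + 1 by rewrite ltr_wpDl ?sqr_ge0.
have [|p [tp Lp] fp] := fP (e / (c ^+ 2 + 1)); first by rewrite divr_gt0.
exists (fun x => c * p x); first by split; [exact: TFZ|exact: scalL2Z].
rewrite (_ : \int[mu]_(x in D) ((c * f x - c * p x) ^+ 2) =
    sq (fun x => c * (f x - p x))); last by apply: eq_Rintegral => x _; ring.
rewrite sqZ//; last exact: scalL2B.
move: fp; rewrite ltr_pdivlMr//; apply: le_lt_trans; rewrite mulrC.
by rewrite ler_wpM2l ?sq_ge0// lerDl.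
Qed.

Lemma TF_limit_TF f : TF f -> scalL2 f -> TF_limit f.
Proof.
move=> tf Lf; split => // e e0; exists f => //.
under eq_Rintegral do rewrite subrr expr0n/=.
by rewrite Rintegral_cst// mul0r.
Qed.

Lemma TF_limit_cvg (f_ : nat -> X -> R) f g : (forall n, TF_limit (f_ n)) ->
  measurable_fun D f -> (forall x, D x -> f_ ^~ x @ \oo --> f x) -> scalL2 g ->
  (forall x n, D x -> `|f_ n x| <= g x) -> TF_limit f.
Proof.
move=> tf mf cf Lg fg.
have mf_ n : measurable_fun D (f_ n) by have [[]] := tf n.
have Lf : scalL2 f.
  apply: scalL2_le Lg => // x Dx; apply: le_trans (ler_norm _).
  have h : `|f_ n x| @[n --> \oo] --> `|f x| by apply: cvg_norm; exact: cf.
  rewrite -(cvg_lim _ h)//; apply: limr_le; first by apply/cvg_ex; eexists; exact: h.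
  by apply: nearW => n; exact: fg.
apply: TF_limit_closed => // e e0.
have := sq_cvg mD mf_ mf cf Lg fg => /cvgr0Pnorm_lt/(_ _ e0)[N _ /(_ N (leqnn N))].
rewrite ger0_norm ?sq_ge0// => h; exists (f_ N) => //.
rewrite (_ : \int[mu]_(x in D) ((f x - f_ N x) ^+ 2) =
  \int[mu]_(x in D) ((f_ N x - f x) ^+ 2))//.
by apply: eq_Rintegral => x _; ring.
Qed.

(** The sets whose indicator is a limit form a Dynkin system: complements come from subtraction from
    1, disjoint unions from dominated convergence of the partial sums. It contains the
    intersection-stable generator [G] by the cutoff sequences. *)
Lemma TF_limit_indic A : measurable A -> TF_limit (\1_A : X -> R).
Proof.
have L1 : scalL2 (fun=> 1) by apply: (@scalL2_finite _ 1) => // x _; rewrite normr1.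
have GL B : G B -> TF_limit (\1_B : X -> R).
  move=> GB; have [chi [tchi chi01 chi1]] := GTF GB.
  have chiL n x : `|chi n x| <= 1.
    by rewrite ger0_norm; have /andP[] := chi01 n x.
  apply: (@TF_limit_cvg chi _ (fun=> 1)) => //.
    move=> n; apply: TF_limit_TF => //; apply: (@scalL2_finite _ 1) => //.
    exact: TF_measurable.
  apply: measurable_funTS; apply: measurable_indic.
  by rewrite sG; exact: sub_gen_smallest.
have LT : TF_limit (fun=> 1) by have := GL _ GT; rewrite indicT.
rewrite sG; move: A.
apply: (@dynkin_induction _ X G (fun A => TF_limit (\1_A : X -> R))) => //.
- exact: GL.
- move=> S mS LS; have := TF_limitD LT (TF_limitZ (-1) LS).
  congr TF_limit; apply/funext => x; rewrite !indicE in_setC.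
  by case: (x \in S); rewrite /= ?mulr1 ?mulr0 ?addr0 ?subrr.
- move=> F mF tF LF.
  pose s n (x : X) := \sum_(k < n) (\1_(F k) x : R).
  have sE n x : s n x = \1_(\big[setU/set0]_(k < n) F k) x.
    elim: n => [|n ih]; first by rewrite /s !big_ord0 indic0.
    rewrite /s big_ord_recr/= -/(s n x) ih big_ord_recr/=.
    rewrite !indicE in_setU; have [h1|] := boolP (x \in \big[setU/set0]_(i < n) F i);
      have [h2|] := boolP (x \in F n); rewrite ?addr0 ?add0r//.
    move: h1; rewrite inE -bigcup_mkord => -[k /= kn Fkx].
    move: h2; rewrite inE => Fnx.
    have kn' := tF k n I I (ex_intro _ x (conj Fkx Fnx)).
    by move: kn; rewrite kn' ltnn.
  apply: (@TF_limit_cvg s _ (fun=> 1)) => //.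
  + elim=> [|n ih].
      rewrite (_ : s 0%N = (fun=> 0 * 1)); first exact: TF_limitZ.
      by apply/funext => x; rewrite /s big_ord0 mul0r.
    rewrite (_ : s n.+1 = fun x => s n x + \1_(F n) x); first exact: TF_limitD.
    by apply/funext => x; rewrite /s big_ord_recr.
  + by apply: measurable_funTS; apply: measurable_indic; exact: bigcup_measurable.
  + move=> x _; have [[k _ Fkx]|nF] := pselect ((\bigcup_k F k) x).
      apply: cvg_near_cst; near=> n.
      rewrite sE !indicE [in RHS]mem_set; last by exists k.
      rewrite mem_set// -bigcup_mkord; exists k => //=.
      by near: n; exact: nbhs_infty_gt.
    apply: cvg_near_cst; near=> n.
    rewrite sE !indicE !memNset//.
    by rewrite -bigcup_mkord => -[k _ Fkx]; apply: nF; exists k.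
  + by move=> x n _; rewrite sE indicE ger0_norm//; case: (_ \in _).
Unshelve. all: by end_near. Qed.

(** Simple functions increase to [f] and are dominated by [f] itself, so the limit is also one in
    L2. *)
Lemma TF_limit_ge0 f : scalL2 f -> (forall x, 0 <= f x) -> TF_limit f.
Proof.
move=> Lf f0; have mf : measurable_fun D (EFin \o f) by apply/measurable_EFinP; case: Lf.
have f0' x : D x -> (0 <= (EFin \o f) x)%E by rewrite lee_fin.
have cf x : D x -> (fun n => nnsfun_approx mD mf n x) @ \oo --> f x.
  by move=> Dx; exact: (fine_cvg (cvg_nnsfun_approx mD mf f0' Dx)).
apply: (@TF_limit_cvg (fun n => nnsfun_approx mD mf n) _ f) => //.
- move=> n; rewrite nnsfun_approxE /approx.
  apply: TF_limitD; last first.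
    apply: TF_limitZ; apply: TF_limit_indic.
    exact: emeasurable_fun_c_infty.
  have zero : TF_limit (fun=> 0) by apply: TF_limit_TF => //; exact: scalL2_0.
  rewrite (_ : (fun _ => _) = fun x => \sum_(k <- index_enum 'I_(n * 2 ^ n))
    k%:R * 2 ^- n * \1_(dyadic_approx D (EFin \o f) n k) x)//.
  elim: (index_enum _) => [|k s ih]; first by under eq_fun do rewrite big_nil.
  under eq_fun do rewrite big_cons.
  apply: TF_limitD => //; apply: TF_limitZ; apply: TF_limit_indic.
  rewrite /dyadic_approx; case: ifPn => // _; rewrite -preimage_comp.
  have h := mf; apply: h => //; apply/measurable_image_EFin; exact: measurable_itv.
- by case: Lf.
- move=> x n Dx; rewrite ger0_norm//.
  have nd := nd_nnsfun_approx mD mf.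
  rewrite -(cvg_lim _ (cf x Dx))//; apply: nondecreasing_cvgn_le.
    by move=> m k mk; have /lefP := nd _ _ mk; exact.
  by apply/cvg_ex; eexists; exact: cf.
Qed.

Theorem TF_dense f : scalL2 f -> forall e : R, 0 < e ->
  exists2 phi, TF phi /\ scalL2 phi & sq (fun x => f x - phi x) < e.
Proof.
move=> Lf; suff [] : TF_limit f by [].
have L1 : scalL2 (f \max cst 0).
  apply: (scalL2_le mD _ _ Lf); first by apply: measurable_maxr => //; case: Lf.
  by move=> x _ /=; case: (ltP (f x) 0) => h; rewrite ?normr0.
have L2 : scalL2 ((fun x => - f x) \max cst 0).
  apply: (scalL2_le mD _ _ Lf).
    by apply: measurable_maxr => //; apply: measurableT_comp => //; case: Lf.
  by move=> x _ /=; case: (ltP (- f x) 0) => h; rewrite ?normr0// normrN.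
have := TF_limitD (TF_limit_ge0 L1 _) (TF_limitZ (-1) (TF_limit_ge0 L2 _)).
rewrite (_ : (fun x => (f \max cst 0) x + _) = f).
  by apply => x; rewrite /= le_max lexx orbT.
apply/funext => x; rewrite /= mulN1r.
have [h|h] := leP (f x) 0; first by rewrite max_l ?oppr_ge0// add0r opprK.
by rewrite max_r ?oppr_le0 ?ltW// subr0.
Qed.

End density.

Lemma ae_mono d (X : measurableType d) (R : realType) (mu : {measure set X -> \bar R})
  (P P' : X -> Prop) : (forall x, P x -> P' x) -> {ae mu, forall x, P x} -> {ae mu, forall x, P' x}.
Proof. by move=> PP'; apply: filterS. Qed.

Lemma scalL2_int d (Z : measurableType d) (R : realType) (nu : {measure set Z -> \bar R}) (D : set Z) g :
  measurable D -> (nu D < +oo)%E -> scalL2 nu D g -> nu.-integrable D (EFin \o g).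
Proof.
move=> mD Doo Lg; have L1 : scalL2 nu D (fun=> 1).
  by apply: (@scalL2_finite _ _ _ nu D mD Doo _ 1) => // x _; rewrite normr1.
by have := scalL2M_int mD Lg L1; apply: intble_eq => // x _; rewrite mulr1.
Qed.

Section inner_product.
Context {d} {X : measurableType d} {R : realType}.
Variables (mu : {measure set X -> \bar R}) (D : set X).
Hypothesis mD : measurable D.
Implicit Types u v : vfield R X.

Lemma L2_prod u v i : L2 mu D u -> L2 mu D v ->
  mu.-integrable D (EFin \o (fun x => u i x * v i x)).
Proof. by move=> Lu Lv; exact: scalL2M_int. Qed.

Lemma ipE u v : L2 mu D u -> L2 mu D v ->
  ip mu D u v = \sum_(i < 3) \int[mu]_(x in D) (u i x * v i x).
Proof. by move=> Lu Lv; rewrite /ip Rintegral_sum// => i; exact: L2_prod. Qed.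

Lemma L2_add u v : L2 mu D u -> L2 mu D v -> L2 mu D (fun i x => u i x + v i x).
Proof. by move=> Lu Lv i; exact: scalL2D. Qed.

Lemma L2_sub u v : L2 mu D u -> L2 mu D v -> L2 mu D (fun i x => u i x - v i x).
Proof. by move=> Lu Lv i; exact: scalL2B. Qed.

Lemma L2_scale c u : L2 mu D u -> L2 mu D (fun i x => c * u i x).
Proof. by move=> Lu i; exact: scalL2Z. Qed.

Lemma ip_comm u v : ip mu D u v = ip mu D v u.
Proof. by apply: eq_Rintegral => x _; apply: eq_bigr => i _; rewrite mulrC. Qed.

Lemma ip_addl u u' v : L2 mu D u -> L2 mu D u' -> L2 mu D v ->
  ip mu D (fun i x => u i x + u' i x) v = ip mu D u v + ip mu D u' v.
Proof.
move=> Lu Lu' Lv; have Ls := L2_add Lu Lu'; rewrite !ipE// -big_split/=.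
apply: eq_bigr => i _; under eq_Rintegral do rewrite mulrDl.
by rewrite RintegralD//; exact: L2_prod.
Qed.

Lemma ip_addr u v v' : L2 mu D u -> L2 mu D v -> L2 mu D v' ->
  ip mu D u (fun i x => v i x + v' i x) = ip mu D u v + ip mu D u v'.
Proof. by move=> Lu Lv Lv'; rewrite ip_comm ip_addl// (ip_comm v) (ip_comm v'). Qed.

(** Test fields with a single nonzero component reduce weak identities between fields to scalar
    ones. *)
Lemma ip_component u f i :
  ip mu D u (fun j x => (j == i)%:R * f x) = \int[mu]_(x in D) (u i x * f x).
Proof.
apply: eq_Rintegral => x _; rewrite (bigD1 i)//= big1 ?addr0 ?eqxx ?mul1r//.
by move=> j /negbTE ->; rewrite mul0r mulr0.
Qed.

Lemma ip_scalel c u v : L2 mu D u -> L2 mu D v ->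
  ip mu D (fun i x => c * u i x) v = c * ip mu D u v.
Proof.
move=> Lu Lv; have Ls := L2_scale c Lu; rewrite !ipE// mulr_sumr.
apply: eq_bigr => i _; under eq_Rintegral do rewrite -mulrA.
by rewrite RintegralZl//; exact: L2_prod.
Qed.

Lemma ip_subl u u' v : L2 mu D u -> L2 mu D u' -> L2 mu D v ->
  ip mu D (fun i x => u i x - u' i x) v = ip mu D u v - ip mu D u' v.
Proof.
move=> Lu Lu' Lv.
have -> : (fun i x => u i x - u' i x) = fun i x => u i x + -1 * u' i x.
  by apply/funext => i; apply/funext => x; rewrite mulN1r.
by rewrite ip_addl ?ip_scalel ?mulN1r//; exact: L2_scale.
Qed.

Lemma ip_ae u u' v : L2 mu D u -> L2 mu D u' -> L2 mu D v ->
  (forall i, {ae mu, forall x, D x -> u i x = u' i x}) -> ip mu D u v = ip mu D u' v.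
Proof.
move=> Lu Lu' Lv uu'; rewrite !ipE//; apply: eq_bigr => i _.
apply: ae_eq_Rintegral => //.
- by apply: measurable_funM; [case: (Lu i)|case: (Lv i)].
- by apply: measurable_funM; [case: (Lu' i)|case: (Lv i)].
- by apply: ae_mono (uu' i) => x h Dx; rewrite h.
Qed.

Lemma nrm2_ae u u' : L2 mu D u -> L2 mu D u' ->
  (forall i, {ae mu, forall x, D x -> u i x = u' i x}) -> nrm2 mu D u = nrm2 mu D u'.
Proof.
move=> Lu Lu' uu'; rewrite /nrm2 (@ip_ae u u')// ip_comm (@ip_ae u u')//.
Qed.

Lemma nrm2_ge0 u : 0 <= nrm2 mu D u.
Proof. by apply: Rintegral_ge0 => x _; apply: sumr_ge0 => i _; rewrite -expr2 sqr_ge0. Qed.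

Lemma nrm2_add u v : L2 mu D u -> L2 mu D v ->
  nrm2 mu D (fun i x => u i x + v i x) = nrm2 mu D u + nrm2 mu D v + 2 * ip mu D u v.
Proof.
move=> Lu Lv; have Ls := L2_add Lu Lv; rewrite /nrm2 ip_addl//.
rewrite (ip_comm u) (ip_comm v (fun i x => _)) !ip_addl// (ip_comm v u).
by move: (ip mu D u u) (ip mu D v v) (ip mu D u v) => a b c; ring.
Qed.

Lemma nrm2_scale c u : L2 mu D u -> nrm2 mu D (fun i x => c * u i x) = c ^+ 2 * nrm2 mu D u.
Proof.
move=> Lu; have Ls := L2_scale c Lu.
by rewrite /nrm2 ip_scalel// ip_comm ip_scalel// mulrA.
Qed.

Lemma nrm2_sub_le u v : L2 mu D u -> L2 mu D v ->
  nrm2 mu D (fun i x => u i x - v i x) <= 2 * nrm2 mu D u + 2 * nrm2 mu D v.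
Proof.
move=> Lu Lv; have Lv' := L2_scale (-1) Lv.
have -> : (fun i x => u i x - v i x) = fun i x => u i x + -1 * v i x.
  by apply/funext => i; apply/funext => x; rewrite mulN1r.
rewrite nrm2_add// nrm2_scale// sqrrN expr1n mul1r [ip _ _ _ _]ip_comm ip_scalel//.
have := nrm2_ge0 (fun i x => u i x + v i x); rewrite nrm2_add// [ip _ _ v u]ip_comm.
by move: (nrm2 mu D u) (nrm2 mu D v) (ip mu D u v) => a b c; lra.
Qed.

Lemma ip_le_nrm2 u v : L2 mu D u -> L2 mu D v ->
  `|ip mu D u v| <= 2^-1 * (nrm2 mu D u + nrm2 mu D v).
Proof.
move=> Lu Lv; have Lv' := L2_scale (-1) Lv.
have := nrm2_ge0 (fun i x => u i x + v i x); rewrite nrm2_add//.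
have := nrm2_ge0 (fun i x => u i x + -1 * v i x).
rewrite nrm2_add// nrm2_scale// sqrrN expr1n mul1r [ip _ _ _ (fun i x => _)]ip_comm.
rewrite ip_scalel// [ip _ _ v u]ip_comm ler_norml.
by move: (nrm2 mu D u) (nrm2 mu D v) (ip mu D u v) => a b c h1 h2; apply/andP; split; lra.
Qed.

Lemma component_le_nrm2 u i : L2 mu D u ->
  \int[mu]_(x in D) (u i x ^+ 2) <= nrm2 mu D u.
Proof.
move=> Lu; rewrite /nrm2 ipE// (bigD1 i)//= lerDl.
by apply: sumr_ge0 => j _; apply: Rintegral_ge0 => x _; rewrite -expr2 sqr_ge0.
Qed.

End inner_product.

(** * Borel sets of the product spaces and the fundamental lemma *)

Section open_generation.
Context {R : realType}.

(** Preimages under a projection commute with complements and countable unions, so generators of the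
    factors pull back to generators of the product. *)
Lemma measurable_prod_sub d1 d2 (U : measurableType d1) (V : measurableType d2)
    (GU : set (set U)) (GV : set (set V)) (G : set (set (U * V))) :
  measurable `<=` <<s GU >> -> measurable `<=` <<s GV >> ->
  (forall A, GU A -> G (fst @^-1` A)) -> (forall B, GV B -> G (snd @^-1` B)) ->
  measurable `<=` <<s G >>.
Proof.
move=> hU hV GUG GVG.
have sT T1 (g : U * V -> T1) (H : set (set T1)) : (forall A, H A -> G (g @^-1` A)) ->
    <<s H >> `<=` [set A | <<s G >> (g @^-1` A)].
  move=> HG; apply: smallest_sub; last first.
    by move=> A HA; apply: sub_gen_smallest; exact: HG.
  split => /=.
  - by rewrite preimage_set0; exact: sigma_algebra0.
  - move=> A sA; rewrite setTD -preimage_setC -setTD; exact: sigma_algebraCD.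
  - by move=> F sF; rewrite preimage_bigcup; exact: sigma_algebra_bigcup.
rewrite measurable_prod_measurableType; apply: smallest_sub.
  exact: smallest_sigma_algebra.
move=> _ [A mA [B mB <-]].
rewrite (_ : A `*` B = (fst @^-1` A) `&` (snd @^-1` B))//.
have h1 : <<s G >> (fst @^-1` A) by exact: (sT _ fst GU GUG _ (hU _ mA)).
have h2 : <<s G >> (snd @^-1` B) by exact: (sT _ snd GV GVG _ (hV _ mB)).
exact: (@measurableI _ (g_sigma_algebraType G)).
Qed.

Lemma measurable1_sub : (measurable : set (set (point1 R))) `<=`
  <<s (open : set (set (point1 R))) >>.
Proof.
have -> : (measurable : set (set (point1 R))) = <<s [set A : set R | exists x y, A = `]x, y[%classic] >>.
  exact: RGenOpens.measurableE.
apply: smallest_sub; first exact: smallest_sigma_algebra.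
move=> _ [x [y ->]]; apply: sub_gen_smallest.
have o : open (`]x, y[%classic : set R) by exact: interval_open.
exact: o.
Qed.

Lemma open_fst (U V : topologicalType) (A : set U) : open A -> open (@fst U V @^-1` A).
Proof. by move=> oA; apply: open_comp => // x _; exact: cvg_fst. Qed.

Lemma open_snd (U V : topologicalType) (A : set V) : open A -> open (@snd U V @^-1` A).
Proof. by move=> oA; apply: open_comp => // x _; exact: cvg_snd. Qed.

Lemma measurable2_sub : (measurable : set (set (point1 R * point1 R))) `<=`
  <<s (open : set (set (point1 R * point1 R))) >>.
Proof.
apply: (measurable_prod_sub measurable1_sub measurable1_sub).
  exact: open_fst.
exact: open_snd.
Qed.

Lemma measurable3_sub : (measurable : set (set (point3 R))) `<=`
  <<s (open : set (set (point3 R))) >>.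
Proof.
apply: (measurable_prod_sub measurable2_sub measurable1_sub).
  exact: open_fst.
exact: open_snd.
Qed.

Lemma measurable4_sub : (measurable : set (set (point4 R))) `<=`
  <<s (open : set (set (point4 R))) >>.
Proof.
apply: (measurable_prod_sub measurable3_sub measurable1_sub).
  exact: open_fst.
exact: open_snd.
Qed.

(** Smoothness refers to the product topology, integration to the product sigma-algebra. The latter
    consists of the Borel sets of the former because the topology has a countable base of measurable
    boxes. *)
Lemma measurable3E : (measurable : set (set (point3 R))) =
  <<s (open : set (set (point3 R))) >>.
Proof.
rewrite eqEsubset; split; first exact: measurable3_sub.
apply: smallest_sub; first exact: sigma_algebra_measurable.
by move=> A; exact: open3_measurable.
Qed.

Lemma measurable4E : (measurable : set (set (point4 R))) =
  <<s (open : set (set (point4 R))) >>.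
Proof.
rewrite eqEsubset; split; first exact: measurable4_sub.
apply: smallest_sub; first exact: sigma_algebra_measurable.
by move=> A; exact: open4_measurable.
Qed.

Lemma continuous3_measurable (f : point3 R -> R) D : continuous f -> measurable_fun D f.
Proof.
move=> /continuousP cf; apply: measurable_funTS.
apply: (measurability _ (RGenOpens.measurableE R)) => _ [_ [a [b ->]] <-].
rewrite setTI; apply: open3_measurable; apply: cf; exact: interval_open.
Qed.

Lemma continuous4_measurable (f : point4 R -> R) D : continuous f -> measurable_fun D f.
Proof.
move=> /continuousP cf; apply: measurable_funTS.
apply: (measurability _ (RGenOpens.measurableE R)) => _ [_ [a [b ->]] <-].
rewrite setTI; apply: open4_measurable; apply: cf; exact: interval_open.
Qed.

Lemma dense3 (D : set (point3 R)) (f : point3 R -> R) : open D ->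
  (leb3 R D < +oo)%E -> scalL2 (leb3 R) D f -> forall e : R, 0 < e ->
  exists2 phi, test_function D phi /\ scalL2 (leb3 R) D phi &
    \int[leb3 R]_(x in D) ((f x - phi x) ^+ 2) < e.
Proof.
move=> oD Doo; apply: (TF_dense (open3_measurable oD) Doo _ _ _ _ _ _ measurable3E).
- by move=> g [sg _]; apply: continuous3_measurable; exact: smooth_continuous.
- exact: test_function0.
- exact: test_functionD.
- by move=> c g; exact: test_functionZ.
- exact: openI.
- exact: openT.
- move=> A oA; have [chi [tchi chi01 chi1]] := cutoff_open3 (openI oD oA).
  exists chi; split => // [n|x Dx]; first exact: test_functionS (tchi n).
  rewrite indicE; have [xA|xA] := boolP (x \in A); rewrite /=.
    by apply: chi1; split => //; exact/set_mem.
  have -> : chi ^~ x = fun=> 0; last exact: cvg_cst.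
  apply/funext => n; apply: (test_function_out (tchi n)) => -[_ Ax].
  by move: xA; rewrite mem_set.
Qed.

Lemma dense4 (D : set (point4 R)) (f : point4 R -> R) : open D ->
  (leb4 R D < +oo)%E -> scalL2 (leb4 R) D f -> forall e : R, 0 < e ->
  exists2 phi, test_function D phi /\ scalL2 (leb4 R) D phi &
    \int[leb4 R]_(x in D) ((f x - phi x) ^+ 2) < e.
Proof.
move=> oD Doo; apply: (TF_dense (open4_measurable oD) Doo _ _ _ _ _ _ measurable4E).
- by move=> g [sg _]; apply: continuous4_measurable; exact: smooth_continuous.
- exact: test_function0.
- exact: test_functionD.
- by move=> c g; exact: test_functionZ.
- exact: openI.
- exact: openT.
- move=> A oA; have [chi [tchi chi01 chi1]] := cutoff_open4 (openI oD oA).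
  exists chi; split => // [n|x Dx]; first exact: test_functionS (tchi n).
  rewrite indicE; have [xA|xA] := boolP (x \in A); rewrite /=.
    by apply: chi1; split => //; exact/set_mem.
  have -> : chi ^~ x = fun=> 0; last exact: cvg_cst.
  apply/funext => n; apply: (test_function_out (tchi n)) => -[_ Ax].
  by move: xA; rewrite mem_set.
Qed.

(** Orthogonality gives int f^2 = int f (f - phi), so by Cauchy-Schwarz the square of int f^2 is at
    most e times int f^2. After division, int f^2 <= e for every e. *)
Lemma orthogonal_ae0 d (X : measurableType d) (mu : {measure set X -> \bar R})
    (D : set X) (TF : set (X -> R)) f : measurable D -> scalL2 mu D f ->
  (forall e : R, 0 < e -> exists2 phi, TF phi /\ scalL2 mu D phi &
    \int[mu]_(x in D) ((f x - phi x) ^+ 2) < e) ->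
  (forall phi, TF phi -> scalL2 mu D phi -> \int[mu]_(x in D) (f x * phi x) = 0) ->
  {ae mu, forall x, D x -> f x = 0}.
Proof.
move=> mD Lf dn h; suff : {ae mu, forall x, D x -> f x ^+ 2 = 0}.
  by apply: filterS => x + Dx => /(_ Dx)/eqP; rewrite sqrf_eq0 => /eqP.
apply: Rintegral0_ae => //; first exact: scalL2_sqr.
  by move=> x _; exact: sqr_ge0.
apply/ler_addgt0Pr => e e0; rewrite add0r.
have [phi [tphi Lphi] fphi] := dn _ e0.
have hE : \int[mu]_(x in D) (f x * (f x - phi x)) = \int[mu]_(x in D) (f x ^+ 2).
  under eq_Rintegral do rewrite mulrBr -expr2.
  have i1 := scalL2_sqr Lf; have i2 := scalL2M_int mD Lf Lphi.
  by rewrite RintegralB// (h phi)// subr0.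
have := cauchy_schwarz mD Lf (scalL2B mD Lf Lphi).
rewrite hE expr2; have : 0 <= \int[mu]_(x in D) (f x ^+ 2) by exact: sq_ge0.
rewrite le_eqVlt => /predU1P[<-|f0].
  by move=> _; exact: ltW.
by rewrite ler_pM2l// => /le_trans; apply; exact: ltW.
Qed.

Lemma fundamental3 (D : set (point3 R)) f : open D -> (leb3 R D < +oo)%E ->
  scalL2 (leb3 R) D f ->
  (forall phi, test_function D phi -> \int[leb3 R]_(x in D) (f x * phi x) = 0) ->
  {ae leb3 R, forall x, D x -> f x = 0}.
Proof.
move=> oD Doo Lf h.
apply: (orthogonal_ae0 (mu := leb3 R) (TF := test_function D) (open3_measurable oD) Lf).
  exact: dense3.
by move=> phi tphi _; exact: h.
Qed.

Lemma fundamental4 (D : set (point4 R)) f : open D -> (leb4 R D < +oo)%E ->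
  scalL2 (leb4 R) D f ->
  (forall phi, test_function D phi -> \int[leb4 R]_(x in D) (f x * phi x) = 0) ->
  {ae leb4 R, forall x, D x -> f x = 0}.
Proof.
move=> oD Doo Lf h.
apply: (orthogonal_ae0 (mu := leb4 R) (TF := test_function D) (open4_measurable oD) Lf).
  exact: dense4.
by move=> phi tphi _; exact: h.
Qed.

End open_generation.

(** * Invariance of Lebesgue measure under shifts and reflections *)

Section measure_invariance.
Context {R : realType}.

Definition invariant_under d (X : measurableType d) (mu : {measure set X -> \bar R})
  (phi : X -> X) :=
  measurable_fun setT phi /\ forall A, measurable A -> mu (phi @^-1` A) = mu A.

Lemma invariant_integral d (X : measurableType d) (mu : {measure set X -> \bar R})
    (phi : X -> X) (f : X -> R) : invariant_under mu phi ->
  measurable_fun setT f -> (forall x, 0 <= f x) ->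
  (\int[mu]_x (f (phi x))%:E = \int[mu]_x (f x)%:E)%E.
Proof.
move=> [mphi inv] mf f0.
have mf' : measurable_fun setT (fun x => (f x)%:E) by exact/measurable_EFinP.
have f0' : {in setT, forall y, (0 <= (f y)%:E)%E} by move=> x _; rewrite lee_fin.
have := ge0_integral_pushforward mphi mu measurableT mf' f0'.
rewrite preimage_setT => <-.
apply: eq_measure_integral => A mA _; exact: inv.
Qed.

(** The image measure agrees with the product measure on rectangles, and such a measure is
    unique. *)
Lemma invariant_prod d1 d2 (X : measurableType d1) (Y : measurableType d2)
    (m1 : {sigma_finite_measure set X -> \bar R})
    (m2 : {sigma_finite_measure set Y -> \bar R}) phi psi :
  invariant_under m1 phi -> invariant_under m2 psi ->
  invariant_under (prod_measure m1 m2) (fun z => (phi z.1, psi z.2)).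
Proof.
move=> [mphi iphi] [mpsi ipsi].
have mf : measurable_fun setT (fun z : X * Y => (phi z.1, psi z.2)).
  apply/measurable_fun_pair.
    exact: measurableT_comp.
  exact: measurableT_comp.
split => // A mA.
apply/esym; apply: (@product_measure_unique _ _ _ _ _ m1 m2
  (pushforward (prod_measure m1 m2) (fun z : X * Y => (phi z.1, psi z.2)))) => //.
move=> B C mB mC.
change (prod_measure m1 m2 ((phi @^-1` B) `*` (psi @^-1` C)) = (m1 B * m2 C)%E).
rewrite /prod_measure product_measure1E; last 2 first.
- by rewrite -[X in measurable X]setTI; exact: mphi.
- by rewrite -[X in measurable X]setTI; exact: mpsi.
by rewrite iphi// ipsi.
Qed.

Lemma invariant_leb1 (a : R) :
  invariant_under (leb1 R) (fun x => a - x) /\ invariant_under (leb1 R) (fun x => x - a).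
Proof.
have m1 : measurable_fun [set: point1 R] (fun x : point1 R => a - x : point1 R).
  exact: measurable_funB.
have m2 : measurable_fun [set: point1 R] (fun x : point1 R => x - a : point1 R).
  exact: measurable_funB.
split; split => // A mA.
- apply/esym; apply: (@lebesgue_measure_unique R
    (pushforward (leb1 R) (fun x : point1 R => a - x : point1 R))) => //.
  move=> _ [[x y] _ <-].
  (* The reflection exchanges the open and the closed end of the interval; the lengths agree all the
     same. *)
  transitivity (lebesgue_measure (`[a - y, a - x[%classic : set (point1 R))).
    rewrite !lebesgue_measure_itv/= !lte_fin ltrD2l ltrN2.
    by case: ifPn => // _; rewrite -!EFinD; congr EFin; lra.
  rewrite /pushforward/=; congr lebesgue_measure.
  apply/seteqP; split => z /=; rewrite !in_itv/= => /andP[h1 h2]; apply/andP.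
    by split; [rewrite ltrBrDl -ltrBrDr|rewrite lerBlDl -lerBlDr].
  by split; [rewrite lerBlDl -lerBlDr|rewrite ltrBrDl -ltrBrDr].
- apply/esym; apply: (@lebesgue_measure_unique R
    (pushforward (leb1 R) (fun x : point1 R => x - a : point1 R))) => //.
  move=> _ [[x y] _ <-].
  transitivity (lebesgue_measure (`]x + a, y + a]%classic : set (point1 R))).
    rewrite !lebesgue_measure_itv/= !lte_fin ltrD2r.
    by case: ifPn => // _; rewrite -!EFinD; congr EFin; lra.
  rewrite /pushforward/=; congr lebesgue_measure.
  by apply/seteqP; split => z /=; rewrite !in_itv/= ltrBrDr lerBlDr.
Qed.

Lemma invariant_leb4 (a : point4 R) :
  invariant_under (leb4 R) (fun z => a - z) /\ invariant_under (leb4 R) (fun z => z - a).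
Proof.
case: a => [[[a b] c] t].
have [a1 a2] := invariant_leb1 a; have [b1 b2] := invariant_leb1 b.
have [c1 c2] := invariant_leb1 c; have [t1 t2] := invariant_leb1 t.
split.
  exact: (invariant_prod (invariant_prod (invariant_prod a1 b1) c1) t1).
exact: (invariant_prod (invariant_prod (invariant_prod a2 b2) c2) t2).
Qed.

End measure_invariance.

(** * Convolution *)

Section test_function_bounds.
Context {R : realType}.
Implicit Types V : normedModType R.

Lemma test_function_bounded V (D : set V) (f : V -> R) : test_function D f ->
  exists2 M : R, 0 <= M & forall x, `|f x| <= M.
Proof.
move=> [sf [K [cK _ fK]]].
have cfK : compact (f @` K).
  by apply: continuous_compact => //; apply: continuous_subspaceT; exact: smooth_continuous.
have [M [_ Mb]] := compact_bounded cfK.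
exists (`|M| + 1); first by rewrite addr_ge0.
move=> x; have [Kx|Kx] := pselect (K x); last by rewrite fK// normr0 addr_ge0.
by apply: Mb; [rewrite (le_lt_trans (ler_norm M))// ltrDl|exists x].
Qed.

Lemma test_function_derive V (D : set V) (f : V -> R) u : test_function D f ->
  test_function D (fun x => 'D_u f x).
Proof.
move=> [sf [K [cK KD fK]]]; split; first exact: smooth_derive.
exists K; split => // x Kx.
have oK : open (~` K) by apply: closed_openC; apply: compact_closed.
rewrite (@near_eq_derive _ _ _ _ (cst 0)) ?derive_cst//.
have : nbhs x (~` K) by exact: open_nbhs_nbhs.
by apply: filterS => z Kz; rewrite fK.
Qed.

(** Dominated convergence speaks of sequences, so the continuity of a convolution is checked along
    sequences; a failure of continuity yields a bad point in each ball of radius 1 / n.+1. *)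
Lemma seq_continuous V (F : V -> R) :
  (forall z (zn : nat -> V), zn @ \oo --> z -> F \o zn @ \oo --> F z) -> continuous F.
Proof.
move=> h z; apply/cvgrPdist_lt => e e0; apply: contrapT => nF.
have : forall n : nat, exists y, `|z - y| < n.+1%:R^-1 /\ ~ (`|F z - F y| < e).
  move=> n; apply: contrapT => /forallNP hn; apply: nF.
  apply/nbhs_ballP; exists n.+1%:R^-1; first by rewrite /= invr_gt0.
  move=> y /= yz; apply: contrapT => nFy; apply: (hn y); split => //.
  by move: yz; rewrite -ball_normE.
move=> /choice[zn znP].
have zc : zn @ \oo --> z.
  apply/cvgrPdist_lt => d d0; near=> n; have [zd _] := znP n.
  apply: (lt_trans zd); rewrite -[ltRHS]invrK ltf_pV2 ?posrE ?invr_gt0//.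
  near: n; exists (Num.truncn d^-1) => // n /= nb.
  by apply: lt_le_trans (truncnS_gt _) _; rewrite ler_nat.
have /cvgrPdist_lt/(_ e e0)[N _ /(_ N (leqnn N))] := h _ _ zc.
by have [_] := znP N.
Unshelve. all: by end_near. Qed.

End test_function_bounds.

Section convolution.
Context {R : realType}.
Variable D : set (point4 R).
Hypotheses (oD : open D) (Doo : (leb4 R D < +oo)%E).
Let mD : measurable D := open4_measurable oD.
Let mu := leb4 R.
Implicit Types (k f g : point4 R -> R) (z w : point4 R).
Local Notation intble f := (mu.-integrable D (EFin \o f)).

(** Integration over [D] amounts to extending [g] by zero, so the convolution is defined on the
    whole space. *)
Definition convol k g z : R := \int[mu]_(w in D) (k (z - w) * g w).

Lemma test_reflect_measurable k z : smooth k -> measurable_fun D (fun w => k (z - w)).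
Proof.
move=> sk; apply: continuous4_measurable => w.
apply: (@continuous_comp _ _ _ (fun w => z - w) k); last exact: smooth_continuous.
by apply: cvgB; [exact: cvg_cst|exact: cvg_id].
Qed.

Lemma conv_intble k g z : test_function setT k -> intble g ->
  intble (fun w => k (z - w) * g w).
Proof.
move=> tk ig; have [M M0 kM] := test_function_bounded tk.
apply: (@intble_le _ _ _ mu D mD _ (fun w => `|M * g w|)).
- apply: measurable_funM; last exact: intble_measurable ig.
  by apply: test_reflect_measurable; case: tk.
- by move=> w Dw; rewrite !normrM ler_wpM2r// (ger0_norm M0).
- by apply: integrable_norm; exact: intbleZ.
Qed.

Lemma conv_continuous k g : test_function setT k -> intble g -> continuous (convol k g).
Proof.
move=> tk ig; have [M M0 kM] := test_function_bounded tk.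
apply: seq_continuous => z zn znz.
apply: (@dominated_Rintegral _ _ _ mu D mD _ _ (fun w => `|M * g w|)).
- by move=> n; apply: intble_measurable; exact: conv_intble.
- by apply: intble_measurable; exact: conv_intble.
- move=> w Dw; apply: cvgM; last exact: cvg_cst.
  apply: (@cvg_comp _ _ _ (fun n => zn n - w) k); last first.
    by apply: smooth_continuous; case: tk.
  by apply: cvgB => //; exact: cvg_cst.
- by apply: integrable_norm; exact: intbleZ.
- by move=> w n Dw; rewrite !normrM ler_wpM2r// (ger0_norm M0).
Qed.

Lemma conv_derive k g z u : test_function setT k -> intble g ->
  derivable (convol k g) z u /\ 'D_u (convol k g) z = convol (fun z => 'D_u k z) g z.
Proof.
move=> tk ig; have tDk := test_function_derive u tk.
have [M M0 kM] := test_function_bounded tDk.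
have sk : smooth k by case: tk.
pose f (h : R) w := k (h *: u + z - w) * g w.
have kh (h : R) w : is_derive h 1 (fun h : R => k (h *: u + z - w)) ('D_u k (h *: u + z - w)).
  have AE : (fun t : R => t^-1 *: (((fun h : R => k (h *: u + z - w)) \o shift h) (t *: 1) -
        k (h *: u + z - w))) =
      (fun t : R => t^-1 *: ((k \o shift (h *: u + z - w)) (t *: u) - k (h *: u + z - w))).
    by apply/funext => t /=; rewrite [_%:A]mulr1 scalerDl -!addrA.
  split; first by rewrite /derivable AE; exact: smooth_derivable.
  by rewrite /derive AE.
have df (h : R) w : is_derive h 1 (f ^~ w) ('D_u k (h *: u + z - w) * g w).
  have := is_deriveM (kh h w) (is_derive_cst (g w) h 1) => H.
  apply: (is_derive_eq H).
  by rewrite scaler0 add0r /GRing.scale/= mulrC.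
have intf h : intble (f h) by exact: conv_intble.
have zero : (`]-1, 1[%classic : set R) 0 by rewrite /= in_itv/=; apply/andP; split; lra.
have d1E h w : partial1of2 f h w = 'D_u k (h *: u + z - w) * g w.
  by rewrite partial1of2E; have [_ ->] := df h w.
have iG : intble (fun w => `|M * g w|) by apply: integrable_norm; exact: intbleZ.
have ub (h : R) w : (`]-1, 1[%classic : set R) h -> D w -> `|partial1of2 f h w| <= `|M * g w|.
  by move=> _ Dw; rewrite d1E !normrM ler_wpM2r// (ger0_norm M0).
have dF : derivable (fun h : R => convol k g (h *: u + z)) 0 1.
  apply: (@derivable_under_integral _ _ _ mu f D mD 0 (-1) 1 zero _ _ (fun w => `|M * g w|)) => //.
have DF : derive1 (fun h : R => convol k g (h *: u + z)) 0 = convol (fun z => 'D_u k z) g z.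
  have := @differentiation_under_integral _ _ _ mu f D mD 0 (-1) 1 zero
    (fun h _ => intf h) _ (fun w => `|M * g w|).
  by move=> ->//; apply: eq_Rintegral => w _; rewrite d1E scale0r add0r.
split; first exact/derivable1P.
by rewrite -DF derive1E derive_line.
Qed.

Lemma conv_smooth k g : test_function setT k -> intble g -> smooth (convol k g).
Proof.
move=> tk ig n; elim: n k tk => [|n ih] k tk.
  by split => //; exact: conv_continuous.
apply/CkSP; split; first exact: conv_continuous.
move=> u; split; first by move=> x; have [] := conv_derive x u tk ig.
rewrite (_ : (fun _ => _) = convol (fun z => 'D_u k z) g).
  by apply: ih; exact: test_function_derive.
by apply/funext => z; have [_] := conv_derive z u tk ig.
Qed.

End convolution.

(** * Mollification in L2 *)

Section approximate_identity.
Context {R : realType}.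
Variable D : set (point4 R).
Hypotheses (oD : open D) (Doo : (leb4 R D < +oo)%E).
Let mD : measurable D := open4_measurable oD.
Let mu := leb4 R.
Implicit Types (k f g : point4 R -> R) (z w : point4 R).
Local Notation intble f := (mu.-integrable D (EFin \o f)).
Local Notation sq f := (\int[mu]_(x in D) ((f x) ^+ 2)).

Definition unit_kernel k := [/\ test_function setT k, forall z, 0 <= k z &
  (\int[mu]_z (k z)%:E = 1)%E].

Lemma kernel_measurable k : unit_kernel k -> measurable_fun setT k.
Proof. by move=> [[sk _] _ _]; apply: continuous4_measurable; exact: smooth_continuous. Qed.

Lemma kernel_reflect k z : unit_kernel k -> (\int[mu]_w (k (z - w))%:E = 1)%E.
Proof.
move=> uk; have [_ k0 <-] := uk.
exact: (invariant_integral (invariant_leb4 z).1 (kernel_measurable uk) k0).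
Qed.

Lemma kernel_shift k w : unit_kernel k -> (\int[mu]_z (k (z - w))%:E = 1)%E.
Proof.
move=> uk; have [_ k0 <-] := uk.
exact: (invariant_integral (invariant_leb4 w).2 (kernel_measurable uk) k0).
Qed.

Lemma kernel_reflect_intble k z : unit_kernel k ->
  mu.-integrable setT (EFin \o (fun w => k (z - w))).
Proof.
move=> uk; have [[sk _] k0 _] := uk; apply: intble_ge0 => //.
  exact: test_reflect_measurable.
by rewrite kernel_reflect// ltry.
Qed.

Lemma kernel_mass_le1 k z : unit_kernel k -> \int[mu]_(w in D) (k (z - w)) <= 1.
Proof.
move=> uk; have [[sk _] k0 _] := uk.
have ik := kernel_reflect_intble z uk.
rewrite -lee_fin -intble_fin//; last exact: integrableS ik.
rewrite -(kernel_reflect z uk); apply: ge0_subset_integral => //.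
- by apply/measurable_EFinP; exact: test_reflect_measurable.
- by move=> w _; rewrite lee_fin.
Qed.

(** Jensen's inequality for a weight of mass at most 1: the nonnegative integral of k (z - w) (g w -
    c)^2 is expanded, with c the value of the convolution. *)
Lemma conv_sq_pointwise k g z : unit_kernel k -> scalL2 mu D g ->
  (convol D k g z) ^+ 2 <= \int[mu]_(w in D) (k (z - w) * g w ^+ 2).
Proof.
move=> uk Lg; have [tk k0 _] := uk; have ig := scalL2_int mD Doo Lg.
have ig2 := scalL2_sqr Lg; have ikg := conv_intble oD z tk ig.
have ikg2 := conv_intble oD z tk ig2.
have ik : intble (fun w => k (z - w)) by exact: integrableS (kernel_reflect_intble z uk).
set c := convol D k g z; set K := \int[mu]_(w in D) (k (z - w)).
have K1 : K <= 1 by exact: kernel_mass_le1.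
have : 0 <= \int[mu]_(w in D) (k (z - w) * (g w - c) ^+ 2).
  by apply: Rintegral_ge0 => w _; rewrite mulr_ge0// sqr_ge0.
rewrite (_ : \int[mu]_(w in D) (k (z - w) * (g w - c) ^+ 2) =
  \int[mu]_(w in D) ((k (z - w) * g w ^+ 2 + (- (2 * c)) * (k (z - w) * g w))
    + c ^+ 2 * k (z - w))); last by apply: eq_Rintegral => w _; ring.
rewrite RintegralD//; last 2 first.
- by apply: intbleD => //; exact: intbleZ.
- exact: intbleZ.
rewrite RintegralD//; last exact: intbleZ.
rewrite RintegralZl// RintegralZl// -/(convol D k g z) -/c -/K.
have : 0 <= c ^+ 2 * (1 - K) by rewrite mulr_ge0 ?sqr_ge0// subr_ge0.
by rewrite expr2; lra.
Qed.

(** Young's inequality: the pointwise bound is integrated, the integrals are exchanged by Tonelli,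
    and the kernel has mass one in [z] as well. The function [G] is the square of [g] extended by
    zero. *)
Lemma conv_sq k g : unit_kernel k -> scalL2 mu D g ->
  scalL2 mu D (convol D k g) /\ sq (convol D k g) <= sq g.
Proof.
move=> uk Lg; have [tk k0 _] := uk; have ig := scalL2_int mD Doo Lg.
have ig2 := scalL2_sqr Lg.
pose G := (fun w => g w ^+ 2) \_ D.
have mG : measurable_fun setT G.
  apply/(measurable_restrictT _ mD); apply: measurable_funX; by case: Lg.
have G0 w : 0 <= G w by rewrite /G patchE; case: ifP => // _; rewrite sqr_ge0.
pose F (zw : point4 R * point4 R) : \bar R := (k (zw.1 - zw.2) * G zw.2)%:E.
have mF : measurable_fun setT F.
  apply/measurable_EFinP; apply: measurable_funM; last exact: measurableT_comp.
  apply: (measurableT_comp (kernel_measurable uk)).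
  by do 3 (apply/measurable_fun_pair; last (apply: measurable_funB;
    do ?[apply: (measurableT_comp measurable_fst)|apply: (measurableT_comp measurable_snd)];
    exact: measurable_id));
  apply: measurable_funB;
    do ?[apply: (measurableT_comp measurable_fst)|apply: (measurableT_comp measurable_snd)];
    exact: measurable_id.
have F0 zw : (0 <= F zw)%E by rewrite lee_fin mulr_ge0.
have F1 w : (\int[mu]_z F (z, w) = (G w)%:E)%E.
  rewrite /F /=; under eq_integral do rewrite mulrC EFinM.
  rewrite ge0_integralZl ?lee_fin//; last 2 first.
  - apply/measurable_EFinP.
    have [m _] := (invariant_leb4 w).2.
    exact: (measurableT_comp (kernel_measurable uk) m).
  - by move=> z _; rewrite lee_fin.
  by rewrite kernel_shift// mule1.
have F2 z : (\int[mu]_w F (z, w) =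
    (\int[mu]_(w in D) (k (z - w) * g w ^+ 2))%:E)%E.
  rewrite -intble_fin//; last exact: conv_intble.
  rewrite [RHS]integral_mkcond; apply: eq_integral => w _.
  rewrite /F /G /= !patchE; case: ifP => //= _.
  by rewrite mulr0.
have mc : measurable_fun D (convol D k g).
  by apply: continuous4_measurable; exact: conv_continuous.
have le : (\int[mu]_(z in D) (convol D k g z ^+ 2)%:E <=
    \int[mu]_(w in D) (g w ^+ 2)%:E)%E.
  apply: (@le_trans _ _ (\int[mu]_z \int[mu]_w F (z, w))%E).
    apply: (@le_trans _ _ (\int[mu]_(z in D) \int[mu]_w F (z, w))%E).
      apply: ge0_le_integral => //.
      - by move=> z _; rewrite lee_fin sqr_ge0.
      - by apply/measurable_EFinP; exact: measurable_funX.
      - by apply: measurable_funTS; exact: measurable_fun_fubini_tonelli_F.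
      - by move=> z _; rewrite F2 lee_fin conv_sq_pointwise.
    apply: ge0_subset_integral => //; first exact: measurable_fun_fubini_tonelli_F.
    by move=> z _; exact: integral_ge0.
  rewrite (fubini_tonelli (m1 := mu) (m2 := mu) F mF F0).
  under eq_integral do rewrite F1.
  rewrite [leRHS]integral_mkcond le_eqVlt; apply/orP; left; apply/eqP.
  by apply: eq_integral => w _; rewrite /G !patchE; case: ifP.
have Lc : scalL2 mu D (convol D k g).
  split => //; apply: le_lt_trans le _; rewrite intble_fin//; exact: ltry.
split => //; have ic := scalL2_sqr Lc.
by rewrite -lee_fin -!intble_fin.
Qed.

(** For a test function of [D] the integral may be taken over the whole space, where the kernel has
    mass exactly 1. What remains is an average of phi z - phi w over |z - w| < d. *)
Lemma kernel_near (kn : nat -> point4 R -> R) (phi : point4 R -> R) z :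
  (forall n, unit_kernel (kn n)) ->
  (forall d : R, 0 < d -> \forall n \near \oo, forall z, d <= `|z| -> kn n z = 0) ->
  test_function D phi -> (fun n => convol D (kn n) phi z) @ \oo --> phi z.
Proof.
move=> uk sk tphi; have [sphi _] := tphi.
have [M M0 phiM] := test_function_bounded tphi.
have cphi := smooth_continuous sphi.
apply/cvgrPdist_le => e e0.
have /cvgrPdist_le/(_ e e0) := cphi z.
move=> /nbhs_ballP[d /= d0 dP].
near=> n.
have kd : forall y, d <= `|y| -> kn n y = 0 by near: n; exact: sk.
have ik := kernel_reflect_intble z (uk n).
have [tk k0 _] := uk n.
have ik1 : \int[mu]_w kn n (z - w) = 1 by rewrite /Rintegral kernel_reflect.
have cE : convol D (kn n) phi z = \int[mu]_w (kn n (z - w) * phi w).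
  rewrite /convol Rintegral_mkcond; apply: eq_Rintegral => w _.
  rewrite patchE; case: ifPn => // /negP Dw; rewrite (test_function_out tphi) ?mulr0// => h.
  by apply: Dw; exact/mem_set.
have mphi : measurable_fun setT phi by exact: continuous4_measurable.
have ikp : mu.-integrable setT (EFin \o (fun w => kn n (z - w) * phi w)).
  apply: (@intble_le _ _ _ mu _ measurableT _ (fun w => M * kn n (z - w))).
  - by apply: measurable_funM => //; exact: intble_measurable ik.
  - by move=> w _; rewrite normrM (ger0_norm (k0 _)) mulrC ler_wpM2r.
  - exact: intbleZ.
have -> : phi z - convol D (kn n) phi z = \int[mu]_w (kn n (z - w) * (phi z - phi w)).
  rewrite cE -[X in X - _]mulr1 -ik1 -RintegralZl// -RintegralB//; last exact: intbleZ.
  by apply: eq_Rintegral => w _; ring.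
have iB : mu.-integrable setT (EFin \o (fun w => kn n (z - w) * (phi z - phi w))).
  have := intbleB measurableT (intbleZ measurableT (phi z) ik) ikp.
  by apply: intble_eq => // w _; ring.
apply: le_trans (le_normr_Rintegral measurableT iB) _.
rewrite -[leRHS]mulr1 -ik1 -RintegralZl//.
apply: le_Rintegral => //.
- exact: integrable_norm.
- exact: intbleZ.
move=> w _; rewrite normrM (ger0_norm (k0 _)) mulrC.
have [zw|zw] := leP d `|z - w|; first by rewrite kd// !mulr0.
by rewrite ler_wpM2r//; apply: dP; rewrite -ball_normE.
Unshelve. all: by end_near. Qed.

Lemma abs_int_le f h (e : R) : scalL2 mu D f -> scalL2 mu D h -> 0 <= e ->
  sq f * sq h <= e ^+ 2 -> `|\int[mu]_(x in D) (f x * h x)| <= e.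
Proof.
move=> Lf Lh e0 le.
rewrite -(ler_pXn2r (n := 2)) ?nnegrE// real_normK ?num_real//.
exact: le_trans (cauchy_schwarz mD Lf Lh) le.
Qed.

Lemma quarter_bounds (a b c d e : R) : 0 <= e -> `|b - c| <= e / 4 ->
  `|a - b| <= e / 4 -> `|d - c| <= e / 4 -> `|a - d| <= e.
Proof.
rewrite !ler_norml => e0 /andP[? ?] /andP[? ?] /andP[? ?].
by apply/andP; split; lra.
Qed.

(** The pairings only call for weak convergence. It holds on test functions by dominated convergence
    and extends to [g] by density, since convolution does not increase the L2 norm. *)
Lemma conv_cvg (kn : nat -> point4 R -> R) f g :
  (forall n, unit_kernel (kn n)) ->
  (forall d : R, 0 < d -> \forall n \near \oo, forall z, d <= `|z| -> kn n z = 0) ->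
  scalL2 mu D f -> scalL2 mu D g ->
  \int[mu]_(z in D) (f z * convol D (kn n) g z) @[n --> \oo] -->
    \int[mu]_(z in D) (f z * g z).
Proof.
move=> uk sk Lf Lg; apply/cvgrPdist_le => /= e e0.
have f0 : 0 < sq f + 1 by rewrite ltr_wpDl// sq_ge0.
(* Chosen so that a function of squared norm at most [d] has a pairing with [f] of at most e / 4;
   the summand 1 guards against f = 0. *)
pose d := (e / 4) ^+ 2 / (sq f + 1).
have d0 : 0 < d by rewrite divr_gt0// exprn_gt0// divr_gt0.
have [phi [tphi Lphi] gphi] := dense4 oD Doo Lg d0.
have Lgp := scalL2B mD Lg Lphi.
have le h : sq h <= d -> sq f * sq h <= (e / 4) ^+ 2.
  move=> hd; apply: le_trans (ler_wpM2l (sq_ge0 _ _ _) hd) _.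
  rewrite /d mulrCA ler_piMr ?sqr_ge0// ler_pdivrMr// mul1r lerDl//.
have e4 : 0 <= e / 4 by rewrite divr_ge0// ltW.
have iphi := scalL2_int mD Doo Lphi.
have ig := scalL2_int mD Doo Lg.
have cvphi : \int[mu]_(z in D) (f z * convol D (kn n) phi z) @[n --> \oo] -->
    \int[mu]_(z in D) (f z * phi z).
  have [M M0 phiM] := test_function_bounded tphi.
  apply: (@dominated_Rintegral _ _ _ mu D mD _ _ (fun w => `|M * f w|)).
  - move=> n; apply: measurable_funM; first by case: Lf.
    by have [[]] := conv_sq (uk n) Lphi.
  - by apply: measurable_funM; [case: Lf|case: Lphi].
  - by move=> z Dz; apply: cvgM; [exact: cvg_cst|exact: kernel_near].
  - by apply: integrable_norm; apply: intbleZ => //; exact: scalL2_int.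
  - move=> z n Dz; rewrite !normrM mulrC ler_wpM2r// (ger0_norm M0).
    have [tk k0 _] := uk n.
    have ik : intble (fun w => kn n (z - w)).
      exact: integrableS (kernel_reflect_intble z (uk n)).
    apply: le_trans (le_normr_Rintegral mD (conv_intble oD z tk iphi)) _.
    apply: (@le_trans _ _ (\int[mu]_(w in D) (M * kn n (z - w)))).
      apply: le_Rintegral => //.
      + by apply: integrable_norm; exact: conv_intble.
      + exact: intbleZ.
      + by move=> w _; rewrite normrM (ger0_norm (k0 _)) mulrC ler_wpM2r.
    by rewrite RintegralZl// ler_piMr// kernel_mass_le1.
near=> n.
have [tk k0 _] := uk n.
have [Lcg _] := conv_sq (uk n) Lg; have [Lcp _] := conv_sq (uk n) Lphi.
have [Lcd cd] := conv_sq (uk n) Lgp.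
have cB z : convol D (kn n) (fun w => g w - phi w) z =
    convol D (kn n) g z - convol D (kn n) phi z.
  rewrite /convol -RintegralB//; [|exact: conv_intble..].
  by apply: eq_Rintegral => w _; ring.
have h1 : `|\int[mu]_(z in D) (f z * phi z) - \int[mu]_(z in D) (f z * convol D (kn n) phi z)|
    <= e / 4.
  by near: n; move/cvgrPdist_le : cvphi; apply; rewrite divr_gt0.
have h2 : `|\int[mu]_(z in D) (f z * (g z - phi z))| <= e / 4.
  by apply: abs_int_le => //; apply: le; exact: ltW.
have h3 : `|\int[mu]_(z in D) (f z * convol D (kn n) (fun w => g w - phi w) z)| <= e / 4.
  by apply: abs_int_le => //; apply: le; apply: le_trans cd (ltW gphi).
have E2 : \int[mu]_(z in D) (f z * (g z - phi z)) =
    \int[mu]_(z in D) (f z * g z) - \int[mu]_(z in D) (f z * phi z).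
  rewrite -RintegralB//; [|exact: scalL2M_int..].
  by apply: eq_Rintegral => z _; ring.
have E3 : \int[mu]_(z in D) (f z * convol D (kn n) (fun w => g w - phi w) z) =
    \int[mu]_(z in D) (f z * convol D (kn n) g z) -
    \int[mu]_(z in D) (f z * convol D (kn n) phi z).
  rewrite -RintegralB//; [|exact: scalL2M_int..].
  by apply: eq_Rintegral => z _; rewrite cB; ring.
rewrite E2 in h2; rewrite E3 in h3.
exact: (quarter_bounds (ltW e0) h1 h2 h3).
Unshelve. all: by end_near. Qed.

End approximate_identity.

(** * Integration by parts for the curl *)

Section derive_direction.
Context {R : realType}.

Lemma derive_oppdir (V : normedModType R) (f : V -> R) x u : derivable f x u ->
  'D_(- u) f x = - 'D_u f x.
Proof.
move=> /derivable1P df; rewrite (derive_line f x (- u)) (derive_line f x u).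
set g := fun t : R => f (t *: u + x).
have -> : (fun t : R => f (t *: - u + x)) = g \o -%R.
  by apply/funext => t; rewrite /g /= scalerN scaleNr.
have h : is_derive (- (0 : R)) 1 g ('D_1 g 0) by rewrite oppr0; exact: derivableP.
have := @is_derive1_comp _ g -%R 0 _ _ h (is_deriveNid (0 : R) (1 : R)).
by rewrite mulrN1 => -[_ ->].
Qed.

Lemma derive_mulr (V : normedModType R) (c : R) (f : V -> R) x u : derivable f x u ->
  'D_u (fun x => c * f x) x = c * 'D_u f x.
Proof. exact: deriveMl. Qed.

Lemma derive_reflect (V : normedModType R) (k : V -> R) z w u : smooth k ->
  'D_u (fun w => k (z - w)) w = - 'D_u k (z - w).
Proof.
move=> sk; rewrite (@derive_affine _ _ _ (fun w => z - w) -%R).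
  by rewrite derive_oppdir//; exact: smooth_derivable.
by move=> x v h; rewrite scalerN opprD addrCA.
Qed.

Lemma smooth_reflect (V : normedModType R) (k : V -> R) z : smooth k ->
  smooth (fun w => k (z - w)).
Proof.
move=> sk; apply: (@smooth_affine _ _ _ (fun w => z - w) -%R) => //.
  by move=> x; apply: cvgB; [exact: cvg_cst|exact: cvg_id].
by move=> x v h; rewrite scalerN opprD addrCA.
Qed.

End derive_direction.

Section three_indices.
Context {R : realType}.

Lemma sum3 (F : 'I_3 -> R) : \sum_(i < 3) F i = F 0 + F 1 + F 2%:R.
Proof.
rewrite !big_ord_recr big_ord0 /= add0r; congr (F _ + F _ + F _); exact: val_inj.
Qed.

Lemma I3E : ((0 + 1 = 1 :> 'I_3)%R * (0 + 2%:R = 2%:R :> 'I_3)%R *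
  (1 + 1 = 2%:R :> 'I_3)%R * (1 + 2%:R = 0 :> 'I_3)%R * (2%:R + 1 = 0 :> 'I_3)%R *
  (2%:R + 2%:R = 1 :> 'I_3)%R)%type.
Proof. by do !split; exact: val_inj. Qed.

Lemma I3eq : (((0 == 1 :> 'I_3)%R = false) * ((0 == 2%:R :> 'I_3)%R = false) *
  ((1 == 0 :> 'I_3)%R = false) * ((1 == 2%:R :> 'I_3)%R = false) *
  ((2%:R == 0 :> 'I_3)%R = false) * ((2%:R == 1 :> 'I_3)%R = false) *
  ((0 == 0 :> 'I_3)%R = true) * ((1 == 1 :> 'I_3)%R = true) *
  ((2%:R == 2%:R :> 'I_3)%R = true))%type.
Proof. by []. Qed.

Lemma I3_cases (i : 'I_3) : i = 0 \/ i = 1 \/ i = 2%:R.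
Proof.
by case: i => -[|[|[|//]]] h; [left|right; left|right; right]; exact: val_inj.
Qed.

Definition cross (a v : 'I_3 -> R) (i : 'I_3) : R :=
  a (i + 1) * v (i + 2%:R) - a (i + 2%:R) * v (i + 1).

Lemma cross_skew (a u v : 'I_3 -> R) :
  \sum_(i < 3) u i * cross a v i = - \sum_(i < 3) cross a u i * v i.
Proof. by rewrite !sum3 /cross !I3E; ring. Qed.

(** The right-hand side is [p] paired with the curl of a field whose only component, the i-th, has
    gradient - a. The minus sign is that of differentiating a reflected kernel k (z - w) in w. *)
Lemma cross_delta (a p : 'I_3 -> R) (i : 'I_3) : cross a p i =
  p 0 * ((2%:R == i)%:R * - a 1 - (1 == i)%:R * - a 2%:R) +
  p 1 * ((0 == i)%:R * - a 2%:R - (2%:R == i)%:R * - a 0) +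
  p 2%:R * ((1 == i)%:R * - a 0 - (0 == i)%:R * - a 1).
Proof.
by rewrite /cross; case: (I3_cases i) => [|[|]] ->;
  rewrite !I3E !I3eq !(mul0r, mul1r); ring.
Qed.

End three_indices.

(** * Fields with zero tangential trace and their mollification *)

Section trace_pairs.
Context {R : realType}.
Variable D : set (point4 R).
Hypotheses (oD : open D) (Doo : (leb4 R D < +oo)%E).
Variable K0 : set (point4 R).
Hypotheses (cK0 : compact K0) (DK0 : D `<=` K0).
Let mD : measurable D := open4_measurable oD.
Let mu := leb4 R.
Implicit Types (k f g : point4 R -> R) (z w : point4 R) (u v c : vfield R (point4 R)).
Local Notation intble f := (mu.-integrable D (EFin \o f)).

Lemma smooth_bounded f : continuous f -> exists2 M : R, 0 <= M & forall z, D z -> `|f z| <= M.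
Proof.
move=> cf.
have cfK : compact (f @` K0).
  by apply: continuous_compact => //; exact: continuous_subspaceT.
have [M [_ Mb]] := compact_bounded cfK.
exists (`|M| + 1); first by rewrite addr_ge0.
by move=> z Dz; apply: Mb; [rewrite (le_lt_trans (ler_norm M))// ltrDl|exists z => //; exact: DK0].
Qed.

Lemma smooth_scalL2 f : smooth f -> scalL2 mu D f.
Proof.
move=> /smooth_continuous cf; have [M M0 fM] := smooth_bounded cf.
by apply: (@scalL2_finite _ _ _ mu D mD Doo _ M) => //; exact: continuous4_measurable.
Qed.

Lemma scalL2_smoothM f g : smooth f -> scalL2 mu D g -> scalL2 mu D (fun z => f z * g z).
Proof.
move=> /smooth_continuous cf Lg; have [M M0 fM] := smooth_bounded cf.
by apply: (@scalL2_bnd _ _ _ mu D mD f M) => //; exact: continuous4_measurable.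
Qed.

Lemma cl_curl_smooth (phi : vfield R (point4 R)) : (forall i, smooth (phi i)) ->
  forall i, smooth (cl_curl e4 phi i).
Proof. by move=> sphi i; apply: smoothB; apply: smooth_derive. Qed.

Lemma smooth_L2 (phi : vfield R (point4 R)) : (forall i, smooth (phi i)) -> L2 mu D phi.
Proof. by move=> sphi i; exact: smooth_scalL2. Qed.

(* A field together with its curl, extended by zero outside of [D]. *)
Definition trace_pair v c := [/\ L2 mu D v, L2 mu D c &
  forall phi : vfield R (point4 R), (forall i, smooth (phi i)) ->
    ip mu D c phi = ip mu D v (cl_curl e4 phi)].

Definition weak_pair v c := [/\ L2 mu D v, L2 mu D c &
  forall phi : vfield R (point4 R), (forall i, test_function D (phi i)) ->
    ip mu D c phi = ip mu D v (cl_curl e4 phi)].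

Definition gradient (chi : point4 R -> R) z (i : 'I_3) : R := 'D_(e4 i) chi z.

(** The product rule curl (chi v) = chi curl v + grad chi x v, with [c] in the role of curl v. *)
Definition mulc chi v c : vfield R (point4 R) :=
  fun i z => chi z * c i z + cross (gradient chi z) (v ^~ z) i.

Lemma cross_L2 chi v : smooth chi -> L2 mu D v ->
  L2 mu D (fun i z => cross (gradient chi z) (v ^~ z) i).
Proof.
move=> schi Lv i; apply: scalL2B => //; apply: scalL2_smoothM => //; exact: smooth_derive.
Qed.

Lemma cl_curlM chi (phi : vfield R (point4 R)) i z : smooth chi -> (forall i, smooth (phi i)) ->
  cl_curl e4 (fun i z => chi z * phi i z) i z =
  chi z * cl_curl e4 phi i z + cross (gradient chi z) (phi ^~ z) i.
Proof.
move=> schi sphi; rewrite /cl_curl /cross /gradient.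
have E (u : point4 R) j : 'D_u (fun z => chi z * phi j z) z = chi z * 'D_u (phi j) z + phi j z * 'D_u chi z.
  by apply: (deriveM (f := chi) (g := phi j)); exact: smooth_derivable.
rewrite (E (e4 (i + 1)) (i + 2%:R)) (E (e4 (i + 2%:R)) (i + 1)).
move: ('D_(e4 (i + 1)) (phi (i + 2%:R)) z) ('D_(e4 (i + 2%:R)) (phi (i + 1)) z)
  ('D_(e4 (i + 1)) chi z) ('D_(e4 (i + 2%:R)) chi z) (chi z)
  (phi (i + 2%:R) z) (phi (i + 1) z) => a b a' b' p q s.
by ring.
Qed.

(** The product rule is applied to the test field instead of [v]; the skew-symmetry of the cross
    product returns the gradient term to [v] with the sign that [mulc] requires. *)
Lemma trace_pair_mul chi v c : smooth chi -> trace_pair v c ->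
  trace_pair (fun i z => chi z * v i z) (mulc chi v c).
Proof.
move=> schi [Lv Lc vc].
have Lcc : L2 mu D (fun i z => chi z * c i z) by move=> i; exact: scalL2_smoothM.
have Lcr := cross_L2 schi Lv.
have Lcv : L2 mu D (fun i z => chi z * v i z) by move=> i; exact: scalL2_smoothM.
split => //; first by move=> i; apply: scalL2D.
move=> phi sphi; have Lphi := smooth_L2 sphi.
have scp i : smooth (fun z => chi z * phi i z) by exact: smoothM.
rewrite /mulc ip_addl//.
have -> : ip mu D (fun i z => chi z * c i z) phi = ip mu D c (fun i z => chi z * phi i z).
  by apply: eq_Rintegral => z _; apply: eq_bigr => i _; ring.
rewrite vc//.
have -> : ip mu D v (cl_curl e4 (fun i z => chi z * phi i z)) =
    ip mu D v (fun i z => chi z * cl_curl e4 phi i z + cross (gradient chi z) (phi ^~ z) i).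
  by apply: eq_Rintegral => z _; apply: eq_bigr => i _; rewrite cl_curlM.
rewrite ip_addr//; last 2 first.
- by move=> i; apply: scalL2_smoothM => //; apply: smooth_scalL2; exact: cl_curl_smooth.
- exact: cross_L2.
have -> : ip mu D v (fun i z => cross (gradient chi z) (phi ^~ z) i) =
    - ip mu D (fun i z => cross (gradient chi z) (v ^~ z) i) phi.
  rewrite -mulN1r /ip -RintegralZl//; last by apply: intble_sum => // j; exact: scalL2M_int.
  by apply: eq_Rintegral => z _; rewrite mulN1r -cross_skew.
rewrite subrK.
by apply: eq_Rintegral => z _; apply: eq_bigr => i _; ring.
Qed.

(** The kernel k (z - w) times a unit vector is smooth in w but in general not supported in [D]. The
    trace condition admits it as a test field, so the formula holds at every [z], up to the boundary
    and beyond. *)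
Lemma convol_curl k v c z i : test_function setT k -> trace_pair v c ->
  cl_curl e4 (fun j => convol D k (v j)) i z = convol D k (c i) z.
Proof.
move=> tk [Lv Lc vc]; have sk : smooth k by case: tk.
have ig j : intble (v j) by exact: scalL2_int.
have ic j : intble (c j) by exact: scalL2_int.
have cD (u : point4 R) j : 'D_u (convol D k (v j)) z = convol D (fun z => 'D_u k z) (v j) z.
  by have [] := conv_derive oD z u tk (ig j).
rewrite /cl_curl (cD (e4 (i + 1)) (i + 2%:R)) (cD (e4 (i + 2%:R)) (i + 1)).
pose psi : vfield R (point4 R) := fun j w => (j == i)%:R * k (z - w).
have spsi j : smooth (psi j) by apply: smoothZ; exact: smooth_reflect.
have := vc psi spsi.
have -> : ip mu D c psi = convol D k (c i) z.
  by rewrite ip_component; apply: eq_Rintegral => w _; rewrite mulrC.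
have dk (u : point4 R) : test_function setT (fun z => 'D_u k z).
  exact: test_function_derive.
have i1 := conv_intble oD z (dk (e4 (i + 1))) (ig (i + 2%:R)).
have i2 := conv_intble oD z (dk (e4 (i + 2%:R))) (ig (i + 1)).
move=> ->; rewrite /convol -(RintegralB mD i1 i2).
apply: eq_Rintegral => w _.
have Dpsi (u : point4 R) j : 'D_u (psi j) w = (j == i)%:R * - 'D_u k (z - w).
  rewrite -(derive_reflect z w u sk).
  apply: (@derive_mulr _ (point4 R) (j == i)%:R (fun w : point4 R => k (z - w))).
  by apply: smooth_derivable; exact: smooth_reflect.
rewrite sum3 /cl_curl !Dpsi !I3E.
exact: (cross_delta (fun j => 'D_(e4 j) k (z - w)) (v ^~ w) i).
Qed.

(** The mollified [v] are admissible in the weak identity of [r], their curls are the mollified [c],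
    and both sides pass to the weak limit. *)
Lemma local_ibp (kn : nat -> point4 R -> R) r cr v c :
  (forall n, unit_kernel (kn n)) ->
  (forall d : R, 0 < d -> \forall n \near \oo, forall z, d <= `|z| -> kn n z = 0) ->
  weak_pair r cr -> trace_pair v c ->
  (forall n i, test_function D (convol D (kn n) (v i))) ->
  ip mu D cr v = ip mu D r c.
Proof.
move=> uk sk [Lr Lcr rc] vcP tc; have [Lv Lc vc] := vcP.
have E n : \sum_(i < 3) \int[mu]_(z in D) (cr i z * convol D (kn n) (v i) z) =
    \sum_(i < 3) \int[mu]_(z in D) (r i z * convol D (kn n) (c i) z).
  have Lcv : L2 mu D (fun i => convol D (kn n) (v i)).
    by move=> i; have [] := conv_sq oD Doo (uk n) (Lv i).
  have Lcc : L2 mu D (fun i => convol D (kn n) (c i)).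
    by move=> i; have [] := conv_sq oD Doo (uk n) (Lc i).
  rewrite -(ipE mD Lcr Lcv) -(ipE mD Lr Lcc) (rc _ (tc n)); apply: eq_Rintegral => z _; apply: eq_bigr => i _.
  by rewrite (@convol_curl (kn n) v c)//; have [] := uk n.
have C (f g : vfield R (point4 R)) : L2 mu D f -> L2 mu D g ->
    \sum_(i < 3) \int[mu]_(z in D) (f i z * convol D (kn n) (g i) z) @[n --> \oo] -->
    \sum_(i < 3) \int[mu]_(z in D) (f i z * g i z).
  move=> Lf Lg; under eq_fun do rewrite sum3; rewrite sum3.
  by apply: cvgD; [apply: cvgD|]; exact: conv_cvg.
rewrite !(ipE mD)//.
have h1 := C _ _ Lcr Lv; have h2 := C _ _ Lr Lc.
rewrite (funext E) in h1.
have e1 := cvg_lim (@Rhausdorff R) h1; have e2 := cvg_lim (@Rhausdorff R) h2.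
by rewrite -e1 -e2.
Qed.

End trace_pairs.

(** * Mollifiers supported near a given point *)

Section kernels.
Context {R : realType}.

Lemma compact_finite_cover (V : normedModType R) (K : set V) (W : V -> set V) :
  compact K -> (forall z, open (W z)) -> (forall z, K z -> W z z) ->
  exists n, exists f : nat -> V, (forall j, (j < n)%N -> K (f j)) /\
    forall z, K z -> exists2 j, (j < n)%N & W (f j) z.
Proof.
rewrite compact_cover => /(_ _ K W) + oW KW.
case=> [z _|z Kz|F FK Fcov]; [exact: oW|by exists z => //; exact: KW|].
exists (size (finmap.enum_fset F)), (nth 0 (finmap.enum_fset F)); split.
  by move=> j jn; apply/set_mem/FK; exact: mem_nth.
move=> z Kz; have [y yF Wz] := Fcov _ Kz.
by exists (index y (finmap.enum_fset F)); [rewrite index_mem|rewrite nth_index].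
Qed.

Lemma base1_pos n : @base1 R n !=set0 -> (0 < leb1 R (base1 n) < +oo)%E.
Proof.
have [a [b ->]] := base1E (R := R) n; move=> [x /=]; rewrite in_itv/= => /andP[ax xb].
have ab : a < b by exact: lt_trans xb.
by rewrite /leb1 /= lebesgue_measure_itv/= lte_fin ab -EFinB lte_fin subr_gt0 ab ltry.
Qed.

Lemma prod_base_pos d1 d2 (X : measurableType d1) (Y : measurableType d2)
    (m1 : {sigma_finite_measure set X -> \bar R})
    (m2 : {sigma_finite_measure set Y -> \bar R}) B C :
  (forall n, measurable (B n)) -> (forall n, measurable (C n)) ->
  (forall n, B n !=set0 -> (0 < m1 (B n) < +oo)%E) ->
  (forall n, C n !=set0 -> (0 < m2 (C n) < +oo)%E) ->
  forall n, prod_base B C n !=set0 -> (0 < prod_measure m1 m2 (prod_base B C n) < +oo)%E.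
Proof.
move=> mB mC hB hC n; rewrite /prod_base.
case: unpickle => [[i j]|[]//] [[x y] /= [Bx Cy]].
have /andP[B0 Boo] : (0 < m1 (B i) < +oo)%E by apply: hB; exists x.
have /andP[C0 Coo] : (0 < m2 (C j) < +oo)%E by apply: hC; exists y.
rewrite /prod_measure product_measure1E// mule_gt0//=.
by rewrite lte_mul_pinfty// ge0_fin_numE.
Qed.

Lemma base4_pos n : @base4 R n !=set0 -> (0 < leb4 R (base4 n) < +oo)%E.
Proof.
have m1 := @base1_measurable R; have p1 := base1_pos.
have m2 := prod_base_measurable m1 m1.
have p2 := prod_base_pos m1 m1 p1 p1.
have m3 := prod_base_measurable m2 m1.
have p3 := prod_base_pos m2 m1 p2 p1.
exact: (prod_base_pos m3 m1 p3 p1).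
Qed.

Lemma base4_cutoff n : cutoff (@base4 R n).
Proof.
have c1 := @base1_cutoff R.
have c2 := prod_base_cutoff c1 c1.
have c3 := prod_base_cutoff c2 c1.
exact: (prod_base_cutoff c3 c1).
Qed.

(** A cutoff of a basic neighbourhood is divided by its integral. The integrals along the cutoff
    sequence tend to the positive measure of the neighbourhood, so one of them is positive. *)
Lemma kernel_exists (U : set (point4 R)) z : open U -> U z ->
  exists k, unit_kernel k /\ forall y, ~ U y -> k y = 0.
Proof.
move=> oU Uz; have [n Bz BU] := base4_nbhs oU Uz.
have /andP[B0 Boo] : (0 < leb4 R (base4 n) < +oo)%E by apply: base4_pos; exists z.
have mB := @base4_measurable R n.
have [chi [tchi chi01 chi1]] := base4_cutoff n.
have mchi m D : measurable_fun D (chi m).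
  by apply: continuous4_measurable; case: (tchi m) => /smooth_continuous.
have i1 : (leb4 R).-integrable (base4 n) (EFin \o (fun=> 1)).
  apply: (@measurable_bounded_integrable _ _ _ _ (fun=> 1)) => //.
  by exists 1; split => // x x1 y _ /=; rewrite normr1 ltW.
have ichi m : (leb4 R).-integrable (base4 n) (EFin \o chi m).
  apply: (@intble_le _ _ _ _ _ mB _ (fun=> 1)); [exact: mchi|move=> x _|exact: i1].
  by have /andP[c0 c1] := chi01 m x; rewrite ger0_norm.
have cv : \int[leb4 R]_(x in base4 n) chi m x @[m --> \oo] --> \int[leb4 R]_(x in base4 n) 1.
  apply: (@dominated_Rintegral _ _ _ _ _ mB chi _ (fun=> 1)); [|by []|exact: chi1|exact: i1|].
    by move=> m; exact: mchi.
  by move=> x m _; have /andP[c0 c1] := chi01 m x; rewrite ger0_norm.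
rewrite Rintegral_cst// mul1r in cv.
have p : 0 < fine (leb4 R (base4 n)) by rewrite fine_gt0// B0 Boo.
have [m pm] : exists m, 0 < \int[leb4 R]_(x in base4 n) chi m x.
  have /cvgrPdist_lt/(_ _ p)[N _ /(_ N (leqnn N))] := cv.
  by rewrite ltr_norml => /andP[_ h]; exists N; move: h; rewrite ltrBlDr ltrDl.
set I := \int[leb4 R]_(x in base4 n) chi m x.
exists (fun y => I^-1 * chi m y); split; last first.
  by move=> y Uy; rewrite (test_function_out (tchi m)) ?mulr0// => /BU.
split.
- by apply: test_functionZ; apply: test_functionS (tchi m).
- by move=> y; have /andP[c0 _] := chi01 m y; rewrite mulr_ge0// invr_ge0 ltW.
- under eq_integral do rewrite EFinM.
  rewrite ge0_integralZl ?lee_fin ?invr_ge0 ?(ltW pm)//; last 2 first.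
  + by apply/measurable_EFinP; exact: mchi.
  + by move=> y _; have /andP[c0 _] := chi01 m y; rewrite lee_fin.
  have -> : (\int[leb4 R]_x (chi m x)%:E = I%:E)%E.
    rewrite /I -intble_fin// [RHS]integral_mkcond; apply: eq_integral => y _.
    rewrite patchE; case: ifPn => // /negP By.
    by rewrite (test_function_out (tchi m))// => h; apply: By; exact/mem_set.
  by rewrite -EFinM mulVf// gt_eqF.
Qed.

End kernels.

(** * Inward shifts and localisation *)

Section integration_by_parts.
Context {R : realType}.
Variable D : set (point4 R).
Hypotheses (oD : open D) (Doo : (leb4 R D < +oo)%E).
Variable K0 : set (point4 R).
Hypotheses (cK0 : compact K0) (DK0 : D `<=` K0).
Let mD : measurable D := open4_measurable oD.
Let mu := leb4 R.
Implicit Types (z w : point4 R) (r cr v c : vfield R (point4 R)).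

(* A small shift of [V `&` D] in the direction [b] moves it inside [D], at a
   distance of the complement comparable to the shift. *)
Definition inward (T : normedModType R) (D V : set T) := exists b : T, exists kap s0 : R,
  [/\ 0 < kap, 0 < s0 & forall (w : T) (s : R) (y : T), V w -> D w -> 0 < s < s0 ->
    `|y - (w + s *: b)| < kap * s -> D y].

(** The kernels are centred at small multiples of [b] instead of 0: convolution with them shifts [v]
    inward and mollifies at a smaller scale, so that the result has compact support in [D]. *)
Lemma inward_ibp V r cr v c : inward D V -> weak_pair D r cr -> trace_pair D v c ->
  (forall i z, D z -> ~ V z -> v i z = 0) -> ip mu D cr v = ip mu D r c.
Proof.
move=> [b [kap [s0 [kap0 s00 inw]]]] rP vP v0.
(* The denominator [n.+2] keeps every shift strictly below [s0], also for n = 0. *)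
pose s (n : nat) : R := s0 / n.+2%:R.
have n2 (n : nat) : (0 : R) < n.+2%:R by rewrite ltr0n.
have sn n : 0 < s n < s0.
  by rewrite divr_gt0//= ltr_pdivrMr// ltr_pMr// ltr1n.
have sgt0 n : 0 < s n by case/andP: (sn n).
(* The radius is half of what [inward] allows; the other half absorbs the passage to the closure of
   the shifted set [S] below. *)
pose U n := [set y : point4 R | `|y - s n *: b| < kap * s n / 2].
have UE n : U n = ball (s n *: b) (kap * s n / 2).
  by apply/seteqP; split => y; rewrite /U -ball_normE /= distrC.
have /choice[kn knP] : forall n, exists k, unit_kernel k /\ forall y, ~ U n y -> k y = 0.
  move=> n; apply: (@kernel_exists _ _ (s n *: b)).
    by rewrite UE; exact: ball_open.
  by rewrite /U /= subrr normr0 divr_gt0// mulr_gt0.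
have Lv i : scalL2 mu D (v i) by have [Lv _ _] := vP.
apply: (@local_ibp R D oD Doo kn r cr v c _ _ rP vP).
- by move=> n; have [] := knP n.
- move=> d d0; near=> n; move=> z dz.
  have [_ kU] := knP n; apply: kU => /= Uz.
  have : `|z| < s n * (`|b| + kap).
    rewrite mulrDr -[z](subrK (s n *: b)) addrC.
    apply: le_lt_trans (ler_normD _ _) _.
    rewrite normrZ (gtr0_norm (sgt0 n)) ltrD2l.
    have {}Uz : `|z - s n *: b| < kap * s n / 2 := Uz.
    apply: lt_le_trans Uz _; rewrite [leRHS]mulrC ler_pdivrMr// ler_peMr ?ler1n//.
    by rewrite mulr_ge0// ltW.
  apply/negP; rewrite -leNgt; apply: le_trans dz.
  rewrite /s mulrAC ler_pdivrMr// -ler_pdivrMl//.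
  near: n; exists (Num.truncn (d^-1 * (s0 * (`|b| + kap)))) => // m /= mb.
  apply: ltW; apply: lt_le_trans (truncnS_gt _) _; rewrite ler_nat.
  exact: leq_trans mb _.
- move=> n i; have [uk kU] := knP n; have [tk k0 _] := uk.
  split; first by apply: conv_smooth => //; exact: scalL2_int.
  pose S := [set z | exists w, [/\ V w, D w & `|z - (w + s n *: b)| < kap * s n / 2]].
  have SD : closure S `<=` D.
    move=> z Sz.
    have e0 : 0 < kap * s n / 2 by rewrite divr_gt0// mulr_gt0.
    have [z' [[w [Vw Dw z'w]] zz']] := Sz _ (nbhsx_ballx z _ e0).
    apply: (inw w (s n)) => //.
    rewrite (_ : z - _ = (z - z') + (z' - (w + s n *: b))); last by rewrite addrA subrK.
    apply: le_lt_trans (ler_normD _ _) _; rewrite [ltRHS]splitr ltrD//.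
    by move: zz'; rewrite -ball_normE.
  exists (closure S); split => //.
    apply: (subclosed_compact _ cK0); first exact: closed_closure.
    exact: subset_trans DK0.
  move=> z Sz; rewrite /convol -[RHS](mul0r (fine (mu D))) -Rintegral_cst//.
  apply: eq_Rintegral => w /set_mem Dw.
  have [Vw|Vw] := pselect (V w); last by rewrite v0// mulr0.
  rewrite kU ?mul0r// => Uzw; apply: Sz; apply: subset_closure; exists w; split => //.
  by rewrite opprD addrA.
Unshelve. all: by end_near. Qed.

(** A cutoff only comes close to 1. Composed with [step] after doubling, it equals 1 on the open set
    where it exceeds 1/2. *)
Lemma plateau V z0 : open V -> V z0 -> exists eta : point4 R -> R, exists W,
  [/\ smooth eta, open W, W z0, forall w, W w -> eta w = 1 & forall w, ~ V w -> eta w = 0].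
Proof.
move=> oV Vz; have [chi [tchi chi01 chi1]] := cutoff_open4 oV.
have h : (0 : R) < 1 / 2 by rewrite divr_gt0.
have /cvgrPdist_lt/(_ _ h)[N _ /(_ N (leqnn N)) hN] := chi1 _ Vz.
have [schi _] := tchi N.
exists (fun w => step (2 * chi N w)), [set w | 1 / 2 < chi N w]; split.
- by apply: smooth_comp; [exact: smooth_step|exact: smoothZ].
- have o : open [set y : R | 1 / 2 < y] by exact: open_gt.
  by have := smooth_continuous schi => /continuousP/(_ _ o).
- by move: hN; rewrite /= ltr_norml => /andP[_]; lra.
- by move=> w /= hw; apply: step_ge1; lra.
- by move=> w Vw; rewrite (test_function_out (tchi N))// mulr0 step_le0.
Qed.

Lemma mulc_split eta v c i z : smooth eta ->
  mulc eta v c i z + mulc (fun z => 1 - eta z) v c i z = c i z.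
Proof.
move=> seta; rewrite /mulc /cross /gradient.
have E (u : point4 R) : 'D_u (fun z => 1 - eta z) z = - 'D_u eta z.
  rewrite (_ : (fun z => 1 - eta z) = cst 1 - eta)//.
  rewrite deriveB ?derive_cst ?sub0r//; exact: smooth_derivable.
rewrite (E (e4 (i + 1))) (E (e4 (i + 2%:R))).
move: ('D_(e4 (i + 1)) eta z) ('D_(e4 (i + 2%:R)) eta z) (eta z) (c i z) (v (i + 2%:R) z)
  (v (i + 1) z) => a a' e p q q'.
by ring.
Qed.

(** The plateau functions are peeled off one after another: [eta j] times the field is treated by
    [inward_ibp], while (1 - eta j) times the field vanishes wherever eta j = 1, so the remaining
    functions still cover the points where it is nonzero. *)
Lemma ibp_cover (I : eqType) (eta : I -> point4 R -> R) (s : seq I) r cr v c :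
  weak_pair D r cr -> trace_pair D v c ->
  (forall j, j \in s -> smooth (eta j) /\
    exists V, inward D V /\ forall w, ~ V w -> eta j w = 0) ->
  (forall z, D z -> (forall i, v i z = 0) \/ exists2 j, j \in s & eta j z = 1) ->
  ip mu D cr v = ip mu D r c.
Proof.
move=> rP; have [Lr Lcr _] := rP; elim: s v c => [|j s ih] v c vP etaP cover.
  have v0 i z : D z -> v i z = 0 by move=> Dz; have [//|[]] := cover _ Dz.
  have [Lv Lc vc] := vP.
  (* An exhausted cover leaves v = 0 on [D]; testing with single-component fields shows that the
     curl [c] then vanishes almost everywhere. *)
  have c0 i : {ae mu, forall z, D z -> c i z = 0}.
    apply: fundamental4 => // phi [sphi _].
    pose psi : vfield R (point4 R) := fun j w => (j == i)%:R * phi w.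
    have spsi j : smooth (psi j) by exact: smoothZ.
    have := vc psi spsi.
    have -> : ip mu D c psi = \int[mu]_(x in D) (c i x * phi x).
      exact: ip_component.
    move=> ->; rewrite /ip -[RHS](mul0r (fine (mu D))) -Rintegral_cst//.
    apply: eq_Rintegral => w /set_mem Dw; rewrite big1// => j _.
    by rewrite v0// mul0r.
  rewrite !(ipE (open4_measurable oD))//.
  rewrite [LHS]big1 ?[RHS]big1// => i _.
    rewrite -[RHS](mul0r (fine (mu D))) -Rintegral_cst//.
    apply: ae_eq_Rintegral => //.
    - by apply: measurable_funM; [case: (Lr i)|case: (Lc i)].
    - by apply: filterS (c0 i) => z h Dz; rewrite h// mulr0.
  rewrite -[RHS](mul0r (fine (mu D))) -Rintegral_cst//.
  by apply: eq_Rintegral => w /set_mem Dw; rewrite v0// mulr0.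
have [seta [V [inV eta0]]] := etaP j (mem_head _ _).
have s1 : smooth (fun z => 1 - eta j z) by apply: smoothB => //; exact: smooth_cst.
have P1 := trace_pair_mul oD Doo cK0 DK0 seta vP.
have P2 := trace_pair_mul oD Doo cK0 DK0 s1 vP.
have [L1 L1c _] := P1; have [L2 L2c _] := P2.
have -> : ip mu D cr v = ip mu D cr (fun i z => eta j z * v i z + (1 - eta j z) * v i z).
  by apply: eq_Rintegral => z _; apply: eq_bigr => i _; ring.
have -> : ip mu D r c =
    ip mu D r (fun i z => mulc (eta j) v c i z + mulc (fun z => 1 - eta j z) v c i z).
  by apply: eq_Rintegral => z _; apply: eq_bigr => i _; rewrite mulc_split.
rewrite (ip_addr (open4_measurable oD) Lcr L1 L2) (ip_addr (open4_measurable oD) Lr L1c L2c); congr (_ + _).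
  by apply: (inward_ibp inV rP P1) => i z Dz Vz; rewrite eta0// mul0r.
apply: ih => //.
- by move=> j' es; apply: etaP; rewrite in_cons es orbT.
- move=> z Dz; have [v0|[j' es e1]] := cover z Dz.
    by left => i; rewrite v0 mulr0.
  move: es; rewrite in_cons => /predU1P[ee|es]; last by right; exists j'.
  by left => i; rewrite -ee e1 subrr mul0r.
Qed.

Theorem ibp r cr v c : (forall z, K0 z -> exists V, [/\ open V, V z & inward D V]) ->
  weak_pair D r cr -> trace_pair D v c -> ip mu D cr v = ip mu D r c.
Proof.
move=> loc rP vP.
have /choice[eW eWP] : forall z, exists eW : (point4 R -> R) * set (point4 R),
    open eW.2 /\ (K0 z -> [/\ eW.2 z, smooth eW.1, forall w, eW.2 w -> eW.1 w = 1 &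
      exists V, inward D V /\ forall w, ~ V w -> eW.1 w = 0]).
  move=> z; have [K0z|K0z] := pselect (K0 z); last first.
    by exists (cst 0, set0); split => //; exact: open0.
  have [V [oV Vz inV]] := loc z K0z.
  have [eta [W [seta oW Wz eta1 eta0]]] := plateau oV Vz.
  by exists (eta, W); split => // _; split => //; exists V.
have [n [f [fK fcov]]] := compact_finite_cover cK0 (fun z => (eWP z).1)
  (fun z Kz => let: And4 h _ _ _ := (eWP z).2 Kz in h).
apply: (@ibp_cover _ (fun j => (eW (f j)).1) (iota 0 n) r cr v c rP vP).
- move=> j; rewrite mem_iota add0n => /andP[_ jn]; have [_ h] := eWP (f j).
  by have [|_ h1 _ h2] := h; [exact: fK|split].
- move=> z Dz; right; have [j jn Wz] := fcov _ (DK0 Dz).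
  exists j; first by rewrite mem_iota.
  by have [_ h] := eWP (f j); have [|_ _ h1 _] := h; [exact: fK|exact: h1].
Qed.

End integration_by_parts.

(** * Inward directions at the boundary of a Lipschitz cylinder *)

Section domain_geometry.
Context {R : realType}.

Lemma normr_pair_le (U V : normedModType R) (x : U * V) :
  `|x.1| <= `|x| /\ `|x.2| <= `|x|.
Proof. by rewrite prod_normE !le_max !lexx orbT. Qed.

Lemma normr_pair_lt (U V : normedModType R) (x : U * V) (e : R) :
  `|x.1| <= e -> `|x.2| <= e -> `|x| <= e.
Proof. by rewrite prod_normE ge_max => -> ->. Qed.

(** The norm of a product is the maximum of the two norms, so the smaller constant serves both
    factors. *)
Lemma inward_setX (U V : normedModType R) (D A : set U) (E B : set V) :
  inward D A -> inward E B -> inward (D `*` E) (A `*` B).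
Proof.
move=> [b [k [s [k0 s0 h]]]] [b' [k' [s' [k'0 s'0 h']]]].
exists (b, b'), (Num.min k k'), (Num.min s s'); split.
- by rewrite lt_min k0.
- by rewrite lt_min s0.
- move=> [w w'] t [y y'] [/= Aw Bw'] [/= Dw Ew'] /andP[t0].
  rewrite lt_min => /andP[ts ts'] yw.
  have [/= n1 n2] := normr_pair_le ((y, y') - ((w, w') + t *: (b, b'))).
  split => /=.
    apply: (h w t) => //; first by rewrite t0.
    apply: (le_lt_trans n1); apply: lt_le_trans yw _.
    by rewrite ler_wpM2r ?ge_min ?lexx// ltW.
  apply: (h' w' t) => //; first by rewrite t0.
  apply: (le_lt_trans n2); apply: lt_le_trans yw _.
  by rewrite ler_wpM2r ?ge_min ?lexx ?orbT// ltW.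
Qed.

Lemma inward_open (U : normedModType R) (D : set U) x0 : open D -> D x0 ->
  exists V, [/\ open V, V x0 & inward D V].
Proof.
move=> oD Dx; have : nbhs x0 D by exact: open_nbhs_nbhs.
move=> /nbhs_ballP[r /= r0 rD].
exists (ball x0 (r / 2)); split; [exact: ball_open|by apply: ballxx; rewrite divr_gt0|].
exists 0, 1, (r / 2); split => //; first by rewrite divr_gt0.
move=> w s y xw _ /andP[s0 sr]; rewrite scaler0 addr0 mul1r => yw.
apply: rD; rewrite -ball_normE /= -(subrK w x0) -addrA.
apply: le_lt_trans (ler_normD _ _) _; rewrite [ltRHS]splitr ltrD//.
  by move: xw; rewrite -ball_normE.
by rewrite distrC; exact: lt_trans sr.
Qed.

(** Before the final time the shift goes forward, at the final time backward; the neighbourhood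
    stays clear of the end towards which it is shifted. *)
Lemma inward_itv (T t0 : R) : 0 < T -> 0 <= t0 <= T ->
  exists V, [/\ open V, V t0 & inward (`]0, T[%classic : set R) V].
Proof.
move=> T0 /andP[t00 tT]; have [tT'|tT'] := ltP t0 T.
- exists [set t | t < (t0 + T) / 2]; split; [exact: open_lt|by rewrite /=; lra|].
  exists 1, 1, ((T - t0) / 4); split; [by []|lra|].
  move=> w s y /= wV; rewrite !in_itv/= => /andP[w0 wT] /andP[s0 sT].
  by rewrite mul1r [s *: _]mulr1 ltr_norml => /andP[h1 h2]; apply/andP; split; lra.
- exists [set t | T / 2 < t]; split; [exact: open_gt|by rewrite /=; lra|].
  exists (- 1), 1, (T / 4); split; [by []|lra|].
  move=> w s y /= wV; rewrite !in_itv/= => /andP[w0 wT] /andP[s0 sT].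
  by rewrite mul1r [s *: _]mulrN1 ltr_norml => /andP[h1 h2]; apply/andP; split; lra.
Qed.

Lemma dot3D (a x y : point3 R) : dot3 a (x + y) = dot3 a x + dot3 a y.
Proof. by rewrite /dot3 /=; ring. Qed.

Lemma dot3Z (a x : point3 R) s : dot3 a (s *: x) = s * dot3 a x.
Proof. by rewrite /dot3 /= /GRing.scale /=; ring. Qed.

Lemma unit_coord_le1 (a : point3 R) : dot3 a a = 1 ->
  [/\ `|a.1.1| <= 1, `|a.1.2| <= 1 & `|a.2| <= 1].
Proof.
case: a => [[a b] c]; rewrite /dot3 /= -!expr2 => h.
have ha := sqr_ge0 a; have hb := sqr_ge0 b; have hc := sqr_ge0 c.
have le1 (x : R) : x ^+ 2 <= 1 -> `|x| <= 1.
  by move=> h1; rewrite -(ler_pXn2r (n := 2)) ?nnegrE// expr1n real_normK ?num_real.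
by split; apply: le1; lra.
Qed.

Lemma dot3_le (a x : point3 R) : dot3 a a = 1 -> `|dot3 a x| <= 3 * `|x|.
Proof.
move=> /unit_coord_le1[h1 h2 h3].
have [n12 n3] := normr_pair_le x; have [n1 n2] := normr_pair_le x.1.
rewrite /dot3 (_ : 3 * `|x| = `|x| + `|x| + `|x|); last by ring.
have L (p q : R) : `|p| <= 1 -> `|q| <= `|x| -> `|p * q| <= `|x|.
  by move=> hp hq; rewrite normrM (le_trans _ hq)// ler_piMl.
apply: le_trans (ler_normD _ _) _; apply: lerD; last by apply: L.
apply: le_trans (ler_normD _ _) _; apply: lerD; apply: L => //.
  exact: le_trans n12.
exact: le_trans n12.
Qed.

(** The third axis of the local frame is the inward direction: a shift along it raises the height
    above the graph, and a perturbation small compared with the shift cannot undo this. *)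
Lemma inward_lipschitz (Omega : set (point3 R)) x0 : open Omega ->
  lipschitz_boundary Omega -> closure Omega x0 ->
  exists V, [/\ open V, V x0 & inward Omega V].
Proof.
move=> oO lip cx; have [Ox|Ox] := pselect (Omega x0); first exact: inward_open.
have [a [gamma [U [orth [L lipg] nU UP]]]] := lip x0 (conj cx Ox).
move: nU => /nbhs_ballP[r /= r0 rU].
have aa i : dot3 (a i) (a i) = 1 by rewrite orth eqxx.
have a20 : dot3 (a 0) (a 2%:R) = 0 by rewrite orth.
have a21 : dot3 (a 1) (a 2%:R) = 0 by rewrite orth.
have b1 : `|a 2%:R| <= 1.
  have [h1 h2 h3] := unit_coord_le1 (aa 2%:R).
  by apply: normr_pair_lt => //; exact: normr_pair_lt.
(* The dot product with a unit vector is at most 3 times the maximum norm. A perturbation of size k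
   s thus costs at most 3 k s in height and 3 k s |L| in the graph, together at most s, the height
   gained; [w] itself lies strictly above the graph. *)
pose k := (3 * (`|L| + 1))^-1.
have kpos : 0 < 3 * (`|L| + 1) by rewrite mulr_gt0// ltr_wpDl.
have k0 : 0 < k by rewrite invr_gt0.
have kL : 3 * k * (`|L| + 1) = 1 by rewrite mulrAC mulfV// gt_eqF.
have kL0 : 0 <= k * `|L| by rewrite mulr_ge0// ltW.
have k1 : 3 * k <= 1 by move: kL; rewrite mulrDr mulr1; lra.
(* Shift and perturbation together move [w] by less than r / 2, so [y] stays in the ball of radius
   [r] in which the graph describes the domain. *)
exists (ball x0 (r / 2)); split; [exact: ball_open|by apply: ballxx; rewrite divr_gt0|].
exists (a 2%:R), k, (r / 4); split => //; first by rewrite divr_gt0.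
move=> w s y xw Ow /andP[s0 sr]; set e := y - (w + s *: a 2%:R) => es.
have yE : y = w + s *: a 2%:R + e by rewrite addrC subrK.
have xw2 : `|x0 - w| < r / 2 by move: xw; rewrite -ball_normE.
have sb : `|s *: a 2%:R| <= s by rewrite normrZ (gtr0_norm s0) ler_piMr// ltW.
have ks : k * s <= s by rewrite ler_piMl// ?ltW//; lra.
have Uw : U w.
  by apply: rU; rewrite -ball_normE /=; apply: (lt_trans xw2); rewrite ltr_pdivrMr// ltr_pMr// ltr1n.
have Uy : U y.
  apply: rU; rewrite -ball_normE /=.
  have -> : x0 - y = (x0 - w) - (s *: a 2%:R + e).
    by rewrite yE !opprD !addrA.
  apply: le_lt_trans (ler_normB _ _) _.
  apply: (@lt_le_trans _ _ (r / 2 + (s + k * s))); last by lra.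
  rewrite ltr_leD//; apply: le_trans (ler_normD _ _) _.
  by rewrite lerD// ltW.
apply/(UP _ Uy).
have e3 i : `|dot3 (a i) e| <= 3 * (k * s).
  by apply: le_trans (dot3_le _ (aa i)) _; rewrite ler_pM2l// ltW.
have d0 : dot3 (a 0) y = dot3 (a 0) w + dot3 (a 0) e.
  by rewrite yE !dot3D dot3Z a20 mulr0 addr0.
have d1 : dot3 (a 1) y = dot3 (a 1) w + dot3 (a 1) e.
  by rewrite yE !dot3D dot3Z a21 mulr0 addr0.
have d2 : dot3 (a 2%:R) y = dot3 (a 2%:R) w + s + dot3 (a 2%:R) e.
  by rewrite yE !dot3D dot3Z aa mulr1.
pose xi (z : point3 R) : (R * R)%type := (dot3 (a 0) z, dot3 (a 1) z).
have lg : `|gamma (xi y) - gamma (xi w)| <= `|L| * (3 * (k * s)).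
  have := lipg (xi y, xi w) (conj I I) => /= h.
  apply: le_trans h _; apply: (@le_trans _ _ (`|L| * `|xi y - xi w|)).
    by rewrite ler_wpM2r// ler_norm.
  rewrite ler_wpM2l//; apply: normr_pair_lt => /=.
    by rewrite d0 addrAC subrr add0r.
  by rewrite d1 addrAC subrr add0r.
have Gw : gamma (xi w) < dot3 (a 2%:R) w by apply/(UP _ Uw).
rewrite -/(xi y) d2.
have := e3 2%:R; move: lg; rewrite !ler_norml => /andP[_ g2] /andP[g3 _].
have : 3 * k * (`|L| + 1) * s = s by rewrite kL mul1r.
move: g2 g3 Gw; move: (gamma (xi y)) (gamma (xi w)) (dot3 (a 2%:R) w) (dot3 (a 2%:R) e) (`|L|).
by move=> p q d f l; nra.
Qed.

Lemma bounded_box (Omega : set (point3 R)) : bounded_set Omega ->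
  exists M : R, closure Omega `<=` `[-M, M]%classic `*` `[-M, M]%classic `*` `[-M, M]%classic.
Proof.
move=> [M [_ Mb]]; exists (`|M| + 1).
have cl : closed (`[-(`|M| + 1), `|M| + 1]%classic `*` `[-(`|M| + 1), `|M| + 1]%classic `*`
    `[-(`|M| + 1), `|M| + 1]%classic : set (point3 R)).
  apply: compact_closed; first exact: norm_hausdorff.
  by do 2 ?apply: compact_setX; exact: segment_compact.
rewrite [X in _ `<=` X](closure_id _).1//; apply: closure_subset => x Ox.
have h : `|x| <= `|M| + 1.
  by apply: Mb => //; rewrite (le_lt_trans (ler_norm M))// ltrDl.
have [n12 n3] := normr_pair_le x; have [n1 n2] := normr_pair_le x.1.
by split; [split|]; rewrite /= in_itv/= -ler_norml ?(le_trans n3)// (le_trans _ (le_trans n12 h)).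
Qed.

Lemma box_compact (M : R) : compact (`[-M, M]%classic `*` `[-M, M]%classic `*`
  `[-M, M]%classic : set (point3 R)).
Proof. by do 2 ?apply: compact_setX; exact: segment_compact. Qed.

Lemma closure_compact (Omega : set (point3 R)) : bounded_set Omega -> compact (closure Omega).
Proof.
move=> /bounded_box[M h]; have cb := @box_compact M.
by move: h; apply: subclosed_compact cb; exact: closed_closure.
Qed.

Lemma bounded_leb3 (Omega : set (point3 R)) : open Omega -> bounded_set Omega ->
  (leb3 R Omega < +oo)%E.
Proof.
move=> oO /bounded_box[M h]; have mO := open3_measurable oO.
have mI : measurable (`[-M, M]%classic : set (point1 R)) by exact: measurable_itv.
pose I : set (point1 R) := `[-M, M]%classic.
have Ioo : (leb1 R I < +oo)%E.
  rewrite /I /leb1 /= lebesgue_measure_itv/=; case: ifPn => // _; exact: ltry.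
have m2 := measurableX mI mI; have m3 := measurableX m2 mI.
apply: (@le_lt_trans _ _ (leb3 R (`[-M, M]%classic `*` `[-M, M]%classic `*` `[-M, M]%classic))).
  by apply: le_measure; rewrite ?inE//; apply: subset_trans h; exact: subset_closure.
rewrite /leb3 /= /prod_measure product_measure1E//.
have fin2 : ((leb1 R \x leb1 R)%E (I `*` I) < +oo)%E.
  by rewrite product_measure1E// lte_mul_pinfty// ge0_fin_numE.
by rewrite lte_mul_pinfty// ge0_fin_numE.
Qed.

End domain_geometry.

Section cylinder.
Context {R : realType}.
Variables (Omega : set (point3 R)) (T : R).
Hypotheses (hO : bounded_lipschitz_domain Omega) (T0 : 0 < T).
Let mu := leb4 R.
Local Notation Q := (Q Omega T).

Lemma openO : open Omega. Proof. by case: hO. Qed.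

Lemma Omega_measurable : measurable Omega. Proof. exact: open3_measurable openO. Qed.

Lemma Omega_finite : (leb3 R Omega < +oo)%E.
Proof. by apply: bounded_leb3; [exact: openO|case: hO]. Qed.

Lemma openQ : open Q.
Proof.
rewrite /Defs.Q (_ : _ `*` _ = (fst @^-1` Omega) `&` (snd @^-1` `]0, T[%classic))//.
apply: openI; first by apply: open_fst; exact: openO.
by apply: open_snd; have o : open (`]0, T[%classic : set R) by exact: interval_open.
Qed.

Lemma Q_measurable : measurable Q. Proof. exact: open4_measurable openQ. Qed.

Lemma Q_finite : (leb4 R Q < +oo)%E.
Proof.
have mI : measurable (`]0, T[%classic : set (point1 R)) by exact: measurable_itv.
rewrite /leb4 /= /prod_measure product_measure1E//; last exact: Omega_measurable.
rewrite lte_mul_pinfty// ?ge0_fin_numE//; first exact: Omega_finite.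
by rewrite /= lebesgue_measure_itv/=; case: ifPn => // _; exact: ltry.
Qed.

Definition Qbar : set (point4 R) := closure Omega `*` `[0, T]%classic.

Lemma Qbar_compact : compact Qbar.
Proof.
apply: compact_setX; last exact: segment_compact.
by apply: closure_compact; case: hO.
Qed.

Lemma Q_Qbar : Q `<=` Qbar.
Proof.
move=> [x t] [/= Ox]; rewrite /= in_itv/= => /andP[t0 tT]; split => /=.
  exact: subset_closure.
by rewrite in_itv/= !ltW.
Qed.

Lemma Qbar_inward z : Qbar z -> exists V, [/\ open V, V z & inward Q V].
Proof.
move=> [cz tz].
have [|V [oV Vz iV]] := inward_lipschitz openO _ cz; first by case: hO.
have tz' : 0 <= z.2 <= T by move: tz; rewrite /= in_itv.
have [W [oW Wz iW]] := inward_itv T0 tz'.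
exists (V `*` W); split; last exact: inward_setX.
  rewrite (_ : V `*` W = (fst @^-1` V) `&` (snd @^-1` W))//.
  by apply: openI; [exact: open_fst|exact: open_snd].
by split.
Qed.

Lemma is_curl_weak_pair v w : L2 mu Q v -> is_curl Omega T v w -> weak_pair Q v w.
Proof. by move=> Lv [Lw vw]; split. Qed.

Lemma Hcurl0_curl v : Hcurl0 Omega T v -> is_curl Omega T v (curl Omega T v).
Proof. by move=> [_ [w vw]]; exact: (xgetPex _ (ex_intro _ w vw)). Qed.

Lemma Hcurl0_weak_pair v : Hcurl0 Omega T v -> weak_pair Q v (curl Omega T v).
Proof. by move=> hv; apply: is_curl_weak_pair; [case: hv|exact: Hcurl0_curl]. Qed.

Lemma Hcurl0_trace_pair v : Hcurl0 Omega T v -> tangential_trace_zero Omega T v ->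
  trace_pair Q v (curl Omega T v).
Proof. by move=> hv tv; have [L1 L2 _] := Hcurl0_weak_pair hv; split. Qed.

Lemma curl_ibp rho v : Hcurl0 Omega T rho -> Hcurl0 Omega T v ->
  tangential_trace_zero Omega T v ->
  ip mu Q (curl Omega T rho) v = ip mu Q rho (curl Omega T v).
Proof.
move=> hr hv tv.
exact: (ibp openQ Q_finite Qbar_compact Q_Qbar Qbar_inward (Hcurl0_weak_pair hr)
  (Hcurl0_trace_pair hv tv)).
Qed.

Lemma L2_test_unique (u v : vfield R (point4 R)) : L2 mu Q u -> L2 mu Q v ->
  (forall phi : vfield R (point4 R), (forall i, test_function Q (phi i)) ->
    ip mu Q u phi = ip mu Q v phi) ->
  forall i, {ae mu, forall z, Q z -> u i z = v i z}.
Proof.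
move=> Lu Lv uv i.
have Li := scalL2B Q_measurable (Lu i) (Lv i).
suff : {ae mu, forall z, Q z -> u i z - v i z = 0}.
  by apply: filterS => z h Qz; apply/eqP; rewrite -subr_eq0; apply/eqP; exact: h.
apply: (fundamental4 openQ Q_finite Li) => phi tphi.
have Lphi : scalL2 mu Q phi.
  by apply: (smooth_scalL2 openQ Q_finite Qbar_compact Q_Qbar); case: tphi.
have := uv _ (fun j => test_functionZ (j == i)%:R tphi); rewrite !ip_component => uv'.
under eq_Rintegral do rewrite mulrBl.
rewrite RintegralB//; last 3 first.
- exact: Q_measurable.
- exact: (scalL2M_int Q_measurable (Lu i) Lphi).
- exact: (scalL2M_int Q_measurable (Lv i) Lphi).
by rewrite uv' subrr.
Qed.

End cylinder.

(** * Fourier expansions in time *)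

Section iterated_integrals.
Context d1 d2 (X : measurableType d1) (Y : measurableType d2) {R : realType}.
Variables (m1 : {sigma_finite_measure set X -> \bar R}).
Variables (m2 : {sigma_finite_measure set Y -> \bar R}).
Variables (A : set X) (B : set Y).
Hypotheses (mA : measurable A) (mB : measurable B).
Let mu : {measure set (X * Y) -> \bar R} := prod_measure m1 m2.
Let mAB : measurable (A `*` B). Proof. exact: measurableX. Qed.
Implicit Types f : X * Y -> R.

Lemma measurable_section1 f x : measurable_fun (A `*` B) f -> A x ->
  measurable_fun B (fun y => f (x, y)).
Proof.
move=> mf Ax; have m' : measurable_fun setT (f \_ (A `*` B)).
  by apply/(measurable_restrictT _ mAB).
have : measurable_fun B (fun y => (f \_ (A `*` B)) (x, y)).
  by apply: (measurableT_comp m'); exact: measurable_funTS (measurable_pair1 x).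
by apply: eq_measurable_fun => y /set_mem By; rewrite patchE mem_set.
Qed.

Lemma measurable_section2 f y : measurable_fun (A `*` B) f -> B y ->
  measurable_fun A (fun x => f (x, y)).
Proof.
move=> mf By; have m' : measurable_fun setT (f \_ (A `*` B)).
  by apply/(measurable_restrictT _ mAB).
have : measurable_fun A (fun x => (f \_ (A `*` B)) (x, y)).
  by apply: (measurableT_comp m'); exact: measurable_funTS (measurable_pair2 y).
by apply: eq_measurable_fun => x /set_mem Ax; rewrite patchE mem_set.
Qed.

Section integrable_function.
Variable f : X * Y -> R.
Hypothesis intf : mu.-integrable (A `*` B) (EFin \o f).
Let g : X * Y -> \bar R := (EFin \o f) \_ (A `*` B).
Let intg : (m1 \x m2)%E.-integrable setT g.
Proof. by apply/(integrable_mkcond _ mAB). Qed.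

Let g1 x : A x -> (fun y => g (x, y)) = (EFin \o (fun y => f (x, y))) \_ B.
Proof.
move=> Ax; apply/funext => y; rewrite /g !patchE.
have -> : ((x, y) \in A `*` B) = (y \in B) by apply/idP/idP; rewrite !inE => // -[].
by [].
Qed.

Let g2 y : B y -> (fun x => g (x, y)) = (EFin \o (fun x => f (x, y))) \_ A.
Proof.
move=> By; apply/funext => x; rewrite /g !patchE.
have -> : ((x, y) \in A `*` B) = (x \in A) by apply/idP/idP; rewrite !inE => // -[].
by [].
Qed.

Let F1 x : A x -> fubini_F m2 g x = (\int[m2]_(y in B) (f (x, y))%:E)%E.
Proof. by move=> Ax; rewrite /fubini_F (g1 Ax) -integral_mkcond. Qed.

Let G2 y : B y -> fubini_G m1 g y = (\int[m1]_(x in A) (f (x, y))%:E)%E.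
Proof. by move=> By; rewrite /fubini_G (g2 By) -integral_mkcond. Qed.

Let F1n x : ~ A x -> fubini_F m2 g x = 0%E.
Proof.
move=> Ax; rewrite /fubini_F integral0_eq// => y _; rewrite /g patchE memNset//.
by case.
Qed.

Let G2n y : ~ B y -> fubini_G m1 g y = 0%E.
Proof.
move=> By; rewrite /fubini_G integral0_eq// => x _; rewrite /g patchE memNset//.
by case.
Qed.

Lemma integrable_section1 :
  {ae m1, forall x, A x -> m2.-integrable B (EFin \o (fun y => f (x, y)))}.
Proof.
have := ae_integrable1 intg; apply: filterS => x h Ax.
by apply/(integrable_mkcond _ mB); rewrite -(g1 Ax).
Qed.

Lemma integrable_section2 :
  {ae m2, forall y, B y -> m1.-integrable A (EFin \o (fun x => f (x, y)))}.
Proof.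
have := ae_integrable2 intg; apply: filterS => y h By.
by apply/(integrable_mkcond _ mA); rewrite -(g2 By).
Qed.

(** The real inner integral is [fine] of the extended one, with value 0 where that is infinite.
    Since [fine] does not increase absolute values, integrability carries over from Fubini's partial
    integral. *)
Lemma integrable_partial1 :
  m1.-integrable A (EFin \o (fun x => \int[m2]_(y in B) f (x, y))).
Proof.
have iF : m1.-integrable A (fubini_F m2 g).
  by apply: integrableS (integrable_fubini_F intg).
have mF := measurable_int _ iF.
apply: (le_integrable mA _ _ iF) => /=.
  apply/measurable_EFinP.
  apply: (eq_measurable_fun (fun x => fine (fubini_F m2 g x))).
    by move=> x /set_mem Ax; rewrite (F1 Ax).
  exact: measurableT_comp.
by move=> x Ax; rewrite (F1 Ax) /Rintegral; case: integral => //= *; rewrite leey.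
Qed.

Let integrable_G : m2.-integrable setT (fubini_G m1 g).
Proof.
have mg := measurable_int _ intg.
have mag : measurable_fun setT (abse \o g) by exact: measurableT_comp.
apply/integrableP; split; first exact: measurable_fubini_G intg.
have h := (integrable21ltyP m1 m2 mg).1 intg; apply: le_lt_trans h.
apply: ge0_le_integral => //.
- by apply: measurableT_comp => //; exact: measurable_fubini_G intg.
- by apply: (measurable_fun_fubini_tonelli_G (abse \o g)) => //= z; exact: abse_ge0.
- move=> y _; apply: le_abse_integral => //.
  exact: measurableT_comp mg (measurable_pair2 y).
Qed.

Lemma integrable_partial2 :
  m2.-integrable B (EFin \o (fun y => \int[m1]_(x in A) f (x, y))).
Proof.
have iF : m2.-integrable B (fubini_G m1 g).
  by apply: integrableS integrable_G.
have mF := measurable_int _ iF.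
apply: (le_integrable mB _ _ iF) => /=.
  apply/measurable_EFinP.
  apply: (eq_measurable_fun (fun x => fine (fubini_G m1 g x))).
    by move=> x /set_mem Ax; rewrite (G2 Ax).
  exact: measurableT_comp.
by move=> x Ax; rewrite (G2 Ax) /Rintegral; case: integral => //= *; rewrite leey.
Qed.

Lemma Rfubini1 :
  \int[m1]_(x in A) (\int[m2]_(y in B) f (x, y)) = \int[mu]_(z in A `*` B) f z.
Proof.
rewrite [RHS]/Rintegral integral_mkcond -/g.
have <- : (\int[m1]_(x in A) fubini_F m2 g x = \int[mu]_z g z)%E.
  rewrite -(integral12_prod_meas1 intg) integral_mkcond; apply: eq_integral => x _.
  by rewrite patchE; case: ifPn => //; rewrite notin_setE => Ax; rewrite F1n.
have iF : m1.-integrable A (fubini_F m2 g).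
  by apply: integrableS (integrable_fubini_F intg).
congr fine; apply: ae_eq_integral => //.
- exact: measurable_int integrable_partial1.
- exact: measurable_int iF.
- have := integrable_section1; apply: filterS => x h Ax.
  by rewrite (F1 Ax) intble_fin//; exact: h.
Qed.

Lemma Rfubini2 :
  \int[m2]_(y in B) (\int[m1]_(x in A) f (x, y)) = \int[mu]_(z in A `*` B) f z.
Proof.
rewrite [RHS]/Rintegral integral_mkcond -/g.
have <- : (\int[m2]_(y in B) fubini_G m1 g y = \int[mu]_z g z)%E.
  rewrite -(integral21_prod_meas1 intg) integral_mkcond; apply: eq_integral => x _.
  by rewrite patchE; case: ifPn => //; rewrite notin_setE => Ax; rewrite G2n.
have iF : m2.-integrable B (fubini_G m1 g).
  by apply: integrableS integrable_G.
congr fine; apply: ae_eq_integral => //.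
- exact: measurable_int integrable_partial2.
- exact: measurable_int iF.
- have := integrable_section2; apply: filterS => x h Ax.
  by rewrite (G2 Ax) intble_fin//; exact: h.
Qed.

End integrable_function.

(** A null set of the product has null slices for almost every [y], because the two orders of
    integration define the same product measure. This carries the agreement of a field with its
    continuous representative over to almost every time. *)
Lemma ae_section2 (P : X * Y -> Prop) : {ae mu, forall z, P z} ->
  {ae m2, forall y, {ae m1, forall x, P (x, y)}}.
Proof.
move=> [N [mN N0 PN]].
have mG := measurable_fun_ysection m1 mN.
have : (\int[m2]_y `|(m1 \o ysection N) y| = 0)%E.
  rewrite (eq_integral (m1 \o ysection N)); last first.
    by move=> y _; rewrite gee0_abs/=.
  transitivity ((m1 \x^ m2)%E N) => //.
  have <- := product_measure_unique (m1 := m1) (m2 := m2) (m' := (m1 \x^ m2)%E) _ mN => //.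
  by move=> C D mC mD /=; rewrite product_measure2E.
move=> /(ae_eq_integral_abs m2 measurableT mG); apply: filterS => y /(_ I) /= h.
exists (ysection N y); split => //; first exact: measurable_ysection.
move=> x /= nP; rewrite /ysection/= inE; exact: PN.
Qed.

Hypotheses (Aoo : (m1 A < +oo)%E) (Boo : (m2 B < +oo)%E).

Lemma box_finite : (mu (A `*` B) < +oo)%E.
Proof. by rewrite /mu /= /prod_measure product_measure1E// lte_mul_pinfty// ge0_fin_numE. Qed.

Lemma scalL2_section1 f : scalL2 mu (A `*` B) f ->
  {ae m1, forall x, A x -> scalL2 m2 B (fun y => f (x, y))}.
Proof.
move=> Lf; have := integrable_section1 (scalL2_sqr Lf).
apply: filterS => x h Ax; apply: scalL2P => //; last exact: h.
by apply: measurable_section1 => //; case: Lf.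
Qed.

Lemma scalL2_tensor (a : X -> R) (b : Y -> R) (M : R) : scalL2 m1 A a ->
  measurable_fun B b -> (forall y, B y -> `|b y| <= M) ->
  scalL2 mu (A `*` B) (fun z => a z.1 * b z.2).
Proof.
move=> La mb bM.
have mfst : measurable_fun (A `*` B) (fun z => a z.1).
  apply: (measurable_comp mA) => //; first by move=> _ [z [Az _] <-].
    by case: La.
  exact: measurable_funTS measurable_fst.
have msnd : measurable_fun (A `*` B) (fun z => b z.2).
  apply: (measurable_comp mB) => //; first by move=> _ [z [_ Bz] <-].
  exact: measurable_funTS measurable_snd.
have L : scalL2 mu (A `*` B) (fun z => a z.1).
  split => //.
  have mg : measurable_fun setT ((fun z : X * Y => (a z.1 ^+ 2)%:E) \_ (A `*` B)).
    by apply/(measurable_restrictT _ mAB)/measurable_EFinP; exact: measurable_funX.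
  rewrite integral_mkcond (fubini_tonelli1 _ mg); last first.
    by move=> z; rewrite patchE; case: ifP => // _; rewrite lee_fin sqr_ge0.
  rewrite (eq_integral ((fun x => (m2 B) * (a x ^+ 2)%:E)%E \_ A)).
    rewrite -integral_mkcond ge0_integralZl//.
    - by apply: lte_mul_pinfty => //; [rewrite ge0_fin_numE|case: La].
    - by apply/measurable_EFinP; apply: measurable_funX; case: La.
    - by move=> x _; rewrite lee_fin sqr_ge0.
  move=> x _; rewrite /fubini_F patchE; case: ifPn => [/set_mem Ax|].
    rewrite (_ : (fun y => _) = (cst (a x ^+ 2)%:E) \_ B).
      by rewrite -integral_mkcond integral_cst// muleC.
    apply/funext => y; rewrite !patchE.
    by have -> : ((x, y) \in A `*` B) = (y \in B) by apply/idP/idP; rewrite !inE => // -[].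
  rewrite notin_setE => Ax; rewrite integral0_eq// => y _; rewrite patchE memNset//.
  by case.
have := scalL2_bnd mAB msnd (M := M) _ L; rewrite (_ : (fun x => _) = (fun z => a z.1 * b z.2)).
  by apply => z [_ Bz]; exact: bM.
by apply/funext => z; rewrite mulrC.
Qed.

Definition partial (b : Y -> R) (f : X * Y -> R) (x : X) : R :=
  \int[m2]_(y in B) (f (x, y) * b y).

Section bounded_weight.
Variables (b : Y -> R) (M : R).
Hypotheses (mb : measurable_fun B b) (bM : forall y, B y -> `|b y| <= M).

Lemma weight_scalL2 : scalL2 m2 B b.
Proof. exact: (@scalL2_finite _ _ _ m2 B mB Boo _ M). Qed.

Lemma weight_mul f : scalL2 mu (A `*` B) f -> scalL2 mu (A `*` B) (fun z => f z * b z.2).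
Proof.
move=> Lf.
have msnd : measurable_fun (A `*` B) (fun z => b z.2).
  apply: (measurable_comp mB) => //; first by move=> _ [z [_ Bz] <-].
  exact: measurable_funTS measurable_snd.
have := scalL2_bnd mAB msnd (M := M) _ Lf; rewrite (_ : (fun x => _) = (fun z => f z * b z.2)).
  by apply => z [_ Bz]; exact: bM.
by apply/funext => z; rewrite mulrC.
Qed.

(** Cauchy-Schwarz on almost every slice bounds the square of the partial integral by K times the
    integral of f^2 over the slice, which is integrable in x. *)
Lemma partial_scalL2 f : scalL2 mu (A `*` B) f -> scalL2 m1 A (partial b f).
Proof.
move=> Lf; have Lfb := weight_mul Lf.
have iP := integrable_partial1 (scalL2_int mAB box_finite Lfb).
have mP : measurable_fun A (partial b f) by exact: intble_measurable iP.
split => //.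
have i2 := integrable_partial1 (scalL2_sqr Lf).
set K := \int[m2]_(y in B) (b y ^+ 2).
have iK := intbleZ mA K i2.
apply: (@le_lt_trans _ _ (\int[m1]_(x in A) `|(K * \int[m2]_(y in B) (f (x, y) ^+ 2))%:E|)%E).
  apply: ae_ge0_le_integral => //.
  - by move=> x _; rewrite lee_fin sqr_ge0.
  - by apply/measurable_EFinP; exact: measurable_funX.
  - by apply/measurable_EFinP; apply: measurableT_comp => //; exact: intble_measurable iK.
  - have := scalL2_section1 Lf; apply: filterS => x h Ax.
    rewrite lee_fin (le_trans _ (ler_norm _))// mulrC.
    by apply: cauchy_schwarz => //; [exact: h|exact: weight_scalL2].
by case/integrableP: iK.
Qed.

Lemma partial_pairing f (a : X -> R) : scalL2 mu (A `*` B) f -> scalL2 m1 A a ->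
  \int[mu]_(z in A `*` B) (f z * (a z.1 * b z.2)) = \int[m1]_(x in A) (partial b f x * a x).
Proof.
move=> Lf La; have Lab := scalL2_tensor La mb bM.
have Lfb := weight_mul Lf.
rewrite -Rfubini1; last exact: scalL2M_int.
have L1 : scalL2 mu (A `*` B) (fun z => a z.1 * 1).
  by apply: (@scalL2_tensor a (fun=> 1) 1) => // y _; rewrite normr1.
apply: ae_eq_Rintegral => //.
- exact: intble_measurable (integrable_partial1 (scalL2M_int mAB Lf Lab)).
- by apply: measurable_funM; [case: (partial_scalL2 Lf)|case: La].
- have := integrable_section1 (scalL2_int mAB box_finite Lfb); apply: filterS => x h Ax.
  rewrite /= /partial -RintegralZr//; last exact: h.
  by apply: eq_Rintegral => y _; ring.
Qed.

End bounded_weight.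
End iterated_integrals.

(** * Parseval's identity with function-valued coefficients *)

Section orthogonal_expansion.
Context d1 d2 (X : measurableType d1) (Y : measurableType d2) {R : realType}.
Variables (m1 : {sigma_finite_measure set X -> \bar R}).
Variables (m2 : {sigma_finite_measure set Y -> \bar R}).
Variables (A : set X) (B : set Y).
Hypotheses (mA : measurable A) (mB : measurable B).
Hypotheses (Aoo : (m1 A < +oo)%E) (Boo : (m2 B < +oo)%E).
Let mu : {measure set (X * Y) -> \bar R} := prod_measure m1 m2.
Let mAB : measurable (A `*` B). Proof. exact: measurableX. Qed.
Variables (e : nat -> Y -> R) (M : R) (nu : nat -> R).
Hypotheses (me : forall j, measurable_fun B (e j))
  (eM : forall j y, B y -> `|e j y| <= M) (nu0 : forall j, 0 < nu j)
  (orth : forall i j, \int[m2]_(y in B) (e i y * e j y) = if i == j then nu i else 0).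
Implicit Types f g : X * Y -> R.
Local Notation sq f := (\int[mu]_(z in A `*` B) (f z ^+ 2)).
Local Notation sqA a := (\int[m1]_(x in A) (a x ^+ 2)).
Local Notation scalL2Q := (scalL2 mu (A `*` B)).

(** The coefficients are functions on [A]: for each x, they are those of f(x, .) in the orthogonal
    system [e]. *)
Definition fcoef f j x : R := (nu j)^-1 * partial m2 B (e j) f x.

Definition synthesis m (a : nat -> X -> R) (z : X * Y) : R := \sum_(j < m) a j z.1 * e j z.2.

Lemma fcoef_scalL2 f j : scalL2Q f -> scalL2 m1 A (fcoef f j).
Proof. move=> Lf; apply: (scalL2Z mA).
by apply: (partial_scalL2 mA mB Aoo Boo (M := M)) => // y; exact: eM. Qed.

Lemma synthesis_scalL2 m a : (forall j, scalL2 m1 A (a j)) -> scalL2Q (synthesis m a).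
Proof.
move=> La; apply: (scalL2_sum mAB) => j.
by apply: (scalL2_tensor mA mB Boo (M := M)) => // y; exact: eM.
Qed.

Lemma synthesis_pairing f m a : scalL2Q f -> (forall j, scalL2 m1 A (a j)) ->
  \int[mu]_(z in A `*` B) (f z * synthesis m a z) =
  \sum_(j < m) nu j * \int[m1]_(x in A) (fcoef f j x * a j x).
Proof.
move=> Lf La.
have L j : scalL2Q (fun z => a j z.1 * e j z.2).
  by apply: (scalL2_tensor mA mB Boo (M := M)) => // y; exact: eM.
under eq_Rintegral do rewrite mulr_sumr.
rewrite Rintegral_sum//; last by move=> j; exact: scalL2M_int.
apply: eq_bigr => j _; rewrite (partial_pairing mA mB Aoo Boo (M := M))//; last by move=> y; exact: eM.
have Lp : scalL2 m1 A (partial m2 B (e j) f).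
  by apply: (partial_scalL2 mA mB Aoo Boo (M := M)) => // y; exact: eM.
rewrite -RintegralZl//; last by apply: scalL2M_int => //; exact: fcoef_scalL2.
apply: eq_Rintegral => x _; rewrite /fcoef mulrA; congr (_ * _).
by rewrite mulrA divff ?mul1r// gt_eqF.
Qed.

Lemma fcoef_synthesis m a j x : (j < m)%N -> A x ->
  fcoef (synthesis m a) j x = a j x.
Proof.
move=> jm Ax.
have Le i : scalL2 m2 B (e i) by apply: (@scalL2_finite _ _ _ m2 B mB Boo _ M) => // y; exact: eM.
rewrite /fcoef /partial /synthesis /=; under eq_Rintegral do rewrite mulr_suml.
have i_int i : m2.-integrable B (EFin \o (fun y => e i y * e j y)) by exact: scalL2M_int.
rewrite (eq_Rintegral _ (g := fun y => \sum_(i < m) a i x * (e i y * e j y))); last first.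
  by move=> y _; apply: eq_bigr => i _; rewrite mulrA.
rewrite Rintegral_sum//; last by move=> i; apply: intbleZ.
rewrite (bigD1 (Ordinal jm))//= RintegralZl// orth eqxx big1 ?addr0.
  by rewrite mulrCA mulVf ?mulr1// gt_eqF.
move=> i ij; rewrite RintegralZl// orth ifF ?mulr0//.
by apply: contraNF ij => /eqP ij; apply/eqP/val_inj.
Qed.

Lemma sq_synthesis m a : (forall j, scalL2 m1 A (a j)) ->
  sq (synthesis m a) = \sum_(j < m) nu j * sqA (a j).
Proof.
move=> La; have LS := synthesis_scalL2 m La.
under eq_Rintegral do rewrite expr2.
rewrite synthesis_pairing//; apply: eq_bigr => j _; congr (_ * _).
by apply: eq_Rintegral => x /set_mem Ax; rewrite fcoef_synthesis.
Qed.

Definition energy m f : R := \sum_(j < m) nu j * sqA (fcoef f j).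

(** The square is completed in each coefficient. Since the last sum is nonnegative, the Fourier
    coefficients give the best approximation with m terms. *)
Lemma sq_sub_synthesis f m a : scalL2Q f -> (forall j, scalL2 m1 A (a j)) ->
  sq (fun z => f z - synthesis m a z) =
  sq f - energy m f + \sum_(j < m) nu j * sqA (fun x => fcoef f j x - a j x).
Proof.
move=> Lf La; have LS := synthesis_scalL2 m La.
have sub d (Z : measurableType d) (rho : {measure set Z -> \bar R}) (D : set Z) (g h : Z -> R) :
    measurable D -> scalL2 rho D g -> scalL2 rho D h ->
  \int[rho]_(z in D) ((g z - h z) ^+ 2) =
  \int[rho]_(z in D) (g z ^+ 2) + \int[rho]_(z in D) (h z ^+ 2) -
  2 * \int[rho]_(z in D) (g z * h z).
  move=> mD Lg Lh; have Lh' := scalL2Z mD (-1) Lh.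
  rewrite (eq_Rintegral _ (g := fun z => (g z + -1 * h z) ^+ 2)); last by move=> z _; rewrite mulN1r.
  rewrite sqD// sqZ// sqrrN expr1n mul1r; congr (_ + _).
  rewrite (eq_Rintegral _ (g := fun z => -1 * (g z * h z))); last by move=> z _; rewrite mulrCA.
  rewrite RintegralZl//; last exact: scalL2M_int.
  by ring.
rewrite sub// sq_synthesis// synthesis_pairing// -addrA -addrA; congr (_ + _).
rewrite mulr_sumr /energy -!sumrN -!big_split/=; apply: eq_bigr => j _.
rewrite sub//; last exact: fcoef_scalL2.
by ring.
Qed.

Lemma energy_remainder m f : scalL2Q f ->
  sq (fun z => f z - synthesis m (fcoef f) z) = sq f - energy m f.
Proof.
move=> Lf; rewrite sq_sub_synthesis//; last by move=> j; exact: fcoef_scalL2.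
rewrite big1 ?addr0// => j _; rewrite (eq_Rintegral _ (g := fun=> 0)).
  by rewrite Rintegral_cst// mul0r mulr0.
by move=> x _; rewrite subrr expr0n.
Qed.

Lemma bessel m f : scalL2Q f -> energy m f <= sq f.
Proof. by move=> Lf; rewrite -subr_ge0 -energy_remainder// sq_ge0. Qed.

Lemma energy_nondecreasing f : nondecreasing_seq (energy ^~ f).
Proof.
apply/nondecreasing_seqP => m; rewrite /energy big_ord_recr/= lerDl.
by rewrite mulr_ge0 ?sq_ge0// ltW.
Qed.

Definition complete_system := forall f, scalL2Q f -> forall eps, 0 < eps ->
  exists m (a : nat -> X -> R), (forall j, scalL2 m1 A (a j)) /\
    sq (fun z => f z - synthesis m a z) < eps.

Hypothesis complete : complete_system.

(** Completeness supplies some combination close to [f]; the Fourier coefficients do at least as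
    well with the same number of terms, and further terms only decrease the remainder. *)
Lemma parseval_sq f : scalL2Q f -> energy m f @[m --> \oo] --> sq f.
Proof.
move=> Lf; apply/cvgrPdist_lt => eps /= eps0.
have [m [a [La h]]] := complete Lf eps0.
exists m => // n /= mn; rewrite ger0_norm ?subr_ge0 ?bessel//.
apply: le_lt_trans h; rewrite sq_sub_synthesis//.
apply: (@le_trans _ _ (sq f - energy m f)); first by rewrite lerB// energy_nondecreasing.
by rewrite lerDl sumr_ge0// => j _; rewrite mulr_ge0 ?sq_ge0// ltW.
Qed.

(** The distance from the limit is the pairing of [f] with the remainder of [g], which tends to 0 in
    L2 by [parseval_sq]. *)
Lemma parseval f g : scalL2Q f -> scalL2Q g ->
  \sum_(j < m) nu j * \int[m1]_(x in A) (fcoef f j x * fcoef g j x) @[m --> \oo] -->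
  \int[mu]_(z in A `*` B) (f z * g z).
Proof.
move=> Lf Lg.
have Lc j : scalL2 m1 A (fcoef g j) by exact: fcoef_scalL2.
pose r m := \int[mu]_(z in A `*` B) (f z * (g z - synthesis m (fcoef g) z)).
have rE m : r m = \int[mu]_(z in A `*` B) (f z * g z) -
    \sum_(j < m) nu j * \int[m1]_(x in A) (fcoef f j x * fcoef g j x).
  rewrite -synthesis_pairing// -RintegralB//.
  - by apply: eq_Rintegral => z _; rewrite mulrBr.
  - exact: scalL2M_int.
  - by apply: scalL2M_int => //; exact: synthesis_scalL2.
have r2 m : r m ^+ 2 <= sq f * (sq g - energy m g).
  rewrite -energy_remainder//; apply: cauchy_schwarz => //.
  by apply: scalL2B => //; exact: synthesis_scalL2.
have r20 : r m ^+ 2 @[m --> \oo] --> (0 : R).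
  apply: (@squeeze_cvgr _ _ _ _ (fun=> 0) (fun m => sq f * (sq g - energy m g))).
  - by apply: nearW => m; rewrite sqr_ge0 r2.
  - exact: cvg_cst.
  - rewrite -(mulr0 (sq f)) -(subrr (sq g)); apply: cvgM; first exact: cvg_cst.
    by apply: cvgB; [exact: cvg_cst|exact: parseval_sq].
have r0 : r m @[m --> \oo] --> (0 : R).
  apply/cvgrPdist_lt => eps /= eps0.
  have e2 : 0 < eps ^+ 2 by rewrite exprn_gt0.
  have /cvgrPdist_lt/(_ _ e2) := r20; apply: filterS => m /=.
  rewrite !sub0r !normrN => h; rewrite -(ltr_pXn2r (n := 2)) ?nnegrE ?normr_ge0 ?(ltW eps0)//.
  by rewrite -normrX.
rewrite -[\int[mu]_(z in _) _]subr0.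
rewrite (_ : (fun m => _) = fun m => \int[mu]_(z in A `*` B) (f z * g z) - r m).
  by apply: cvgB => //; exact: cvg_cst.
by apply/funext => m; rewrite rE opprB addrC subrK.
Qed.

End orthogonal_expansion.

(** * Orthogonality of the trigonometric system *)

Section trigonometric_system.
Context {R : realType}.
Variable T : R.
Hypothesis T0 : 0 < T.
Let I : set (point1 R) := `]0, T[%classic.
Let w : R := omega T.

Lemma I_measurable : measurable (`]0, T[%classic : set (point1 R)).
Proof. exact: measurable_itv. Qed.

Lemma I_finite : (leb1 R I < +oo)%E.
Proof. rewrite /I; by rewrite /leb1 /= lebesgue_measure_itv/=; case: ifPn => // _; exact: ltry. Qed.

Lemma I_length : fine (leb1 R I) = T.
Proof. rewrite /I; by rewrite /leb1 /= lebesgue_measure_itv/= lte_fin T0 sube0. Qed.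

Lemma smooth_measurable1 (f : R -> R) (D : set (point1 R)) : smooth f -> measurable D ->
  measurable_fun D (f : point1 R -> R).
Proof.
move=> sf mD; apply: measurable_funTS.
by apply: continuous_measurable_fun => x; exact: smooth_continuous.
Qed.

Lemma smooth_bounded1 (f : R -> R) : smooth f ->
  exists2 M : R, 0 <= M & forall t, 0 <= t <= T -> `|f t| <= M.
Proof.
move=> sf.
have cf : {within `[0, T], continuous f}.
  by apply: continuous_subspaceT => x; exact: smooth_continuous.
have [a _ ha] := EVT_max (ltW T0) cf; have [b _ hb] := EVT_min (ltW T0) cf.
exists (`|f a| + `|f b|); first by rewrite addr_ge0.
move=> t tT; have tI : t \in `[0, T] by rewrite in_itv.
have := ha t tI; have := hb t tI; have := ler_norm (f a); have := ler_norm (- f b).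
rewrite normrN ler_norml => *; have := normr_ge0 (f a); have := normr_ge0 (f b) => *.
by apply/andP; split; lra.
Qed.

Lemma smooth_intble1 (f : R -> R) : smooth f -> (leb1 R).-integrable I (EFin \o f).
Proof.
move=> sf; have [M M0 fM] := smooth_bounded1 sf.
have mI := I_measurable.
apply: (scalL2_int mI I_finite); apply: (@scalL2_finite _ _ _ _ _ mI I_finite _ M).
  exact: smooth_measurable1.
by move=> t; rewrite /I /= in_itv/= => /andP[t0 tT]; apply: fM; rewrite !ltW.
Qed.

Lemma int_derive (F : R -> R) : smooth F -> \int[leb1 R]_(t in I) 'D_1 F t = F T - F 0.
Proof.
move=> sF; have sD := smooth_derive (1 : R) sF.
have cD : {within `[0, T], continuous (fun t => 'D_1 F t)}.
  by apply: continuous_subspaceT => x; exact: smooth_continuous.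
have iD : (@lebesgue_measure R).-integrable `[0, T] (EFin \o (fun t => 'D_1 F t)).
  exact: continuous_compact_integrable (@segment_compact _ _ _) cD.
have iO : (@lebesgue_measure R).-integrable `]0, T] (EFin \o (fun t => 'D_1 F t)).
  by apply: integrableS iD => //; apply: subset_itvr; rewrite bnd_simp.
rewrite /I /leb1 Rintegral_itv_bndo_bndc; last first.
  by apply: integrableS iO => //; apply: subset_itvl; rewrite bnd_simp.
rewrite Rintegral_itv_obnd_cbnd//.
rewrite /Rintegral (continuous_FTC2 T0 cD (F := F))//.
- split; [by move=> x _; exact: smooth_derivable| |].
  + by apply: cvg_at_right_filter; exact: smooth_continuous.
  + by apply: cvg_at_left_filter; exact: smooth_continuous.
- by move=> x _; rewrite derive1E.
Qed.

Lemma smooth_line c (f : R -> R) : smooth f -> smooth (fun t : R => f (c * t)).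
Proof.
move=> sf; have := smooth_comp sf (smoothZ c (@smooth_id R)).
by [].
Qed.

Lemma cos_turn n : cos (n%:R * (2 * pi)) = 1 :> R.
Proof.
elim: n => [|n ih]; first by rewrite mul0r cos0.
by rewrite -natr1 mulrDl mul1r (mulr_natl pi 2) cosD2pi -(mulr_natl pi 2) ih.
Qed.

Lemma sin_turn n : sin (n%:R * (2 * pi)) = 0 :> R.
Proof.
elim: n => [|n ih]; first by rewrite mul0r sin0.
by rewrite -natr1 mulrDl mul1r (mulr_natl pi 2) sinD2pi -(mulr_natl pi 2) ih.
Qed.

Lemma omegaT : w * T = 2 * pi.
Proof. by rewrite /w /omega divfK// gt_eqF. Qed.

Lemma omega_gt0 : 0 < w.
Proof. by rewrite /w /omega divr_gt0// mulr_gt0// pi_gt0. Qed.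

Lemma derive_sin_line c t : 'D_1 (fun s : R => sin (c * s)) t = c * cos (c * t).
Proof.
have h : is_derive t 1 (fun s : R => sin (c * s)) (c * cos (c * t)).
  by apply: is_derive_eq; rewrite /GRing.scale/=; ring.
by rewrite derive_val.
Qed.

Lemma derive_cos_line c t : 'D_1 (fun s : R => cos (c * s)) t = - (c * sin (c * t)).
Proof.
have h : is_derive t 1 (fun s : R => cos (c * s)) (- (c * sin (c * t))).
  by apply: is_derive_eq; rewrite /GRing.scale/=; ring.
by rewrite derive_val.
Qed.

Lemma int_cos_nat n : \int[leb1 R]_(t in I) cos (n%:R * w * t) = if n == 0%N then T else 0.
Proof.
case: eqP => [->|/eqP n0].
  under eq_Rintegral do rewrite !mul0r cos0.
  by rewrite Rintegral_cst ?mul1r ?I_length//; exact: I_measurable.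
have c0 : n%:R * w != 0 by rewrite mulf_neq0 ?pnatr_eq0// gt_eqF// omega_gt0.
have := int_derive (smooth_line (n%:R * w) (@smooth_sin R)).
rewrite mulr0 sin0 -mulrA omegaT sin_turn subr0 => h.
under eq_Rintegral do rewrite -[X in cos X]/(_ * _) -[cos _](mulKf c0) -derive_sin_line.
rewrite RintegralZl ?h ?mulr0//; first exact: I_measurable.
apply: smooth_intble1; apply: smooth_derive; apply: smooth_line; exact: smooth_sin.
Qed.

Lemma int_sin_nat n : \int[leb1 R]_(t in I) sin (n%:R * w * t) = 0.
Proof.
have [->|n0] := eqVneq n 0%N.
  under eq_Rintegral do rewrite !mul0r sin0.
  by rewrite Rintegral_cst ?mul0r//; exact: I_measurable.
have c0 : - (n%:R * w) != 0 by rewrite oppr_eq0 mulf_neq0 ?pnatr_eq0// gt_eqF// omega_gt0.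
have := int_derive (smooth_line (n%:R * w) (@smooth_cos R)).
rewrite mulr0 cos0 -mulrA omegaT cos_turn subrr => h.
under eq_Rintegral do rewrite -[sin _](mulKf c0) mulNr -derive_cos_line.
rewrite RintegralZl ?h ?mulr0//; first exact: I_measurable.
apply: smooth_intble1; apply: smooth_derive; apply: smooth_line; exact: smooth_cos.
Qed.

(** Integer frequencies appear because the product formulas produce differences, which may be
    negative. *)
Lemma int_cos (z : int) : \int[leb1 R]_(t in I) cos (z%:~R * w * t) = if z == 0 then T else 0.
Proof.
case: (intP z) => [|n|n].
- by rewrite -[RHS](int_cos_nat 0).
- by rewrite -pmulrn int_cos_nat.
- under eq_Rintegral do rewrite mulrNz !mulNr cosN.
  by rewrite -pmulrn int_cos_nat oppr_eq0.
Qed.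

Lemma int_sin (z : int) : \int[leb1 R]_(t in I) sin (z%:~R * w * t) = 0.
Proof.
case: (intP z) => [|n|n].
- exact: int_sin_nat 0%N.
- by rewrite -pmulrn int_sin_nat.
- under eq_Rintegral do rewrite mulrNz !mulNr sinN -mulN1r.
  rewrite RintegralZl; [by rewrite -pmulrn int_sin_nat mulr0|exact: I_measurable|].
  by apply: smooth_intble1; apply: smooth_line; exact: smooth_sin.
Qed.

(* The enumeration 1, sin wt, cos wt, sin 2wt, cos 2wt and so on. *)
Definition trig (j : nat) (t : R) : R :=
  if odd j then sin (j./2.+1%:R * w * t) else cos (j./2%:R * w * t).

Definition trig_norm (j : nat) : R := if j == 0%N then T else T / 2.

Lemma trig_norm_gt0 j : 0 < trig_norm j.
Proof. by rewrite /trig_norm; case: ifP => _ //; rewrite divr_gt0. Qed.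

Lemma smooth_trig j : smooth (trig j).
Proof.
rewrite /trig; case: odd; apply: smooth_line; [exact: smooth_sin|exact: smooth_cos].
Qed.

Lemma trig_le1 j t : `|trig j t| <= 1.
Proof.
rewrite /trig; case: odd; rewrite ler_norml.
  by rewrite sin_geN1 sin_le1.
by rewrite cos_geN1 cos_le1.
Qed.

Let int2 (f g : R -> R) (a b : R) : smooth f -> smooth g ->
  \int[leb1 R]_(t in I) (a * f t + b * g t) =
  a * \int[leb1 R]_(t in I) f t + b * \int[leb1 R]_(t in I) g t.
Proof.
move=> sf sg; have mI := I_measurable.
have if_ := smooth_intble1 sf; have ig := smooth_intble1 sg.
by rewrite RintegralD//; [rewrite !RintegralZl//|exact: intbleZ|exact: intbleZ].
Qed.

Let sc c : smooth (fun t : R => cos (c * t)). Proof. by apply: smooth_line; exact: smooth_cos. Qed.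
Let ss c : smooth (fun t : R => sin (c * t)). Proof. by apply: smooth_line; exact: smooth_sin. Qed.

Lemma int_coscos p q : \int[leb1 R]_(t in I) (cos (p%:R * w * t) * cos (q%:R * w * t)) =
  if p == q then (if p == 0%N then T else T / 2) else 0.
Proof.
transitivity (\int[leb1 R]_(t in I) (2^-1 * cos ((p%:Z - q%:Z)%:~R * w * t) +
    2^-1 * cos ((p%:Z + q%:Z)%:~R * w * t))).
  apply: eq_Rintegral => t _; rewrite !intrD intrN -!pmulrn !mulrDl !mulNr cosB cosD.
  by field.
rewrite int2// !int_cos subr_eq0 eqz_nat.
have -> : (p%:Z + q%:Z == 0) = ((p == 0%N) && (q == 0%N)).
  by rewrite -PoszD eqz_nat addn_eq0.
case: eqP => [->|/eqP pq]; first by rewrite andbb; case: eqP => _; field.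
by rewrite ifF ?mulr0 ?addr0//; apply: contraNF pq => /andP[/eqP -> /eqP ->].
Qed.

Lemma int_sinsin p q : \int[leb1 R]_(t in I) (sin (p.+1%:R * w * t) * sin (q.+1%:R * w * t)) =
  if p == q then T / 2 else 0.
Proof.
transitivity (\int[leb1 R]_(t in I) (2^-1 * cos ((p.+1%:Z - q.+1%:Z)%:~R * w * t) +
    (- 2^-1) * cos ((p.+1%:Z + q.+1%:Z)%:~R * w * t))).
  apply: eq_Rintegral => t _; rewrite !intrD intrN -!pmulrn !mulrDl !mulNr cosB cosD.
  by field.
rewrite int2// !int_cos subr_eq0 eqz_nat eqSS mulr0 addr0.
by case: eqP => _; rewrite ?mulr0// mulrC.
Qed.

Lemma int_sincos p q : \int[leb1 R]_(t in I) (sin (p%:R * w * t) * cos (q%:R * w * t)) = 0.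
Proof.
transitivity (\int[leb1 R]_(t in I) (2^-1 * sin ((p%:Z - q%:Z)%:~R * w * t) +
    2^-1 * sin ((p%:Z + q%:Z)%:~R * w * t))).
  apply: eq_Rintegral => t _; rewrite !intrD intrN -!pmulrn !mulrDl !mulNr sinB sinD.
  by field.
by rewrite int2// !int_sin !mulr0 addr0.
Qed.

Lemma trig_orthogonal i j :
  \int[leb1 R]_(t in I) (trig i t * trig j t) = if i == j then trig_norm i else 0.
Proof.
have hi := odd_double_half i; have hj := odd_double_half j.
rewrite /trig /trig_norm; case oi : (odd i) hi => /= hi; case oj : (odd j) hj => /= hj.
- have -> : (i == j) = (i./2 == j./2) by rewrite -{1}hi -{1}hj eqn_add2l (can_eq doubleK).
  by rewrite int_sinsin -{3}hi.
- rewrite int_sincos ifF//; apply/negbTE; apply: contraFneq oj => <-; exact: oi.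
- under eq_Rintegral do rewrite mulrC.
  rewrite int_sincos ifF//; apply/negbTE; apply: contraFneq oi => ->; exact: oj.
- have -> : (i == j) = (i./2 == j./2) by rewrite -{1}hi -{1}hj eqn_add2l (can_eq doubleK).
  have -> : (i == 0%N) = (i./2 == 0%N) by rewrite -{1}hi add0n double_eq0.
  exact: int_coscos.
Qed.

End trigonometric_system.

(** * Averaging kernels and completeness in time *)

Section periodic_kernel.
Context {R : realType}.
Variable T : R.
Hypothesis T0 : 0 < T.
Let I : set (point1 R) := `]0, T[%classic.
Let w : R := omega T.
Let mI : measurable I := I_measurable T.

Lemma cos_power_expansion n : exists s : seq (R * nat), forall x : R,
  (1 + cos x) ^+ n = \sum_(p <- s) p.1 * cos (p.2%:R * x).
Proof.
elim: n => [|n [s ih]].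
  by exists [:: (1, 0%N)] => x; rewrite big_seq1 /= mul0r cos0 mulr1.
(* The product of cos x and cos (k x) is half the sum of the cosines of (k + 1) x and (k - 1) x. For
   k = 0 the second frequency is -1, replaced by 1 since the cosine is even. *)
exists (s ++ ([seq (p.1 / 2, p.2.+1) | p <- s] ++
  [seq (p.1 / 2, if p.2 is k.+1 then k else 1%N) | p <- s])) => x.
rewrite exprS ih mulrDl mul1r !big_cat/= !big_map/= mulr_sumr; congr (_ + _).
rewrite -big_split/=; apply: eq_bigr => -[a [|k]] _ /=.
  by rewrite !mul1r mul0r cos0; field.
have -> : k.+2%:R * x = k.+1%:R * x + x by rewrite -(natr1 k.+1) mulrDl mul1r.
have -> : k%:R * x = k.+1%:R * x - x by rewrite -(natr1 k) mulrDl mul1r addrK.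
by rewrite cosD cosB; field.
Qed.

(** Up to normalisation, the de la Vallee Poussin kernel: a nonnegative trigonometric polynomial
    that concentrates at s = t modulo the period. *)
Definition kernel n (t s : R) : R := (1 + cos (w * (t - s))) ^+ n.

Lemma kernel_ge0 n t s : 0 <= kernel n t s.
Proof. by apply: exprn_ge0; have := cos_geN1 (w * (t - s)); lra. Qed.

Lemma smooth_shift (f : R -> R) t : smooth f -> smooth (fun s : R => f (w * (t - s))).
Proof.
move=> sf; apply: (smooth_comp sf).
exact: (smoothZ w (smoothB (@smooth_cst _ R t) (@smooth_id R))).
Qed.

Lemma smooth_pow (f : R -> R) n : smooth f -> smooth (fun s : R => f s ^+ n).
Proof.
move=> sf; elim: n => [|n ih]; first exact: smooth_cst.
by under eq_fun do rewrite exprS; exact: smoothM.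
Qed.

Lemma smooth_kernel n t : smooth (kernel n t).
Proof.
apply: smooth_pow; apply: (smoothD (@smooth_cst _ R 1)); apply: smooth_shift.
exact: smooth_cos.
Qed.

Lemma smooth_cos_kernel n t : smooth (fun s : R => cos (w * (t - s)) * kernel n t s).
Proof.
apply: smoothM; last exact: smooth_kernel.
by apply: smooth_shift; exact: smooth_cos.
Qed.

Definition mass n : R := \int[leb1 R]_(s in I) kernel n 0 s.

Lemma int_cos_shift k t :
  \int[leb1 R]_(s in I) cos (k%:R * (w * (t - s))) = if k == 0%N then T else 0.
Proof.
transitivity (\int[leb1 R]_(s in I) (cos (k%:R * w * t) * cos (k%:R * w * s) +
    sin (k%:R * w * t) * sin (k%:R * w * s))).
  by apply: eq_Rintegral => s _; rewrite -cosB; congr cos; ring.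
have ic := smooth_intble1 T0 (smooth_line (k%:R * w) (@smooth_cos R)).
have is_ := smooth_intble1 T0 (smooth_line (k%:R * w) (@smooth_sin R)).
rewrite RintegralD//; [|exact: intbleZ|exact: intbleZ].
rewrite !RintegralZl// int_cos_nat// int_sin_nat// mulr0 addr0.
by case: eqP => [->|_]; rewrite ?mulr0// !mul0r cos0 mul1r.
Qed.

(** Only the terms of frequency 0 in the cosine expansion have a nonzero integral, and they do not
    involve [t]. *)
Lemma mass_shift n t : \int[leb1 R]_(s in I) kernel n t s = mass n.
Proof.
have [l lE] := cos_power_expansion n.
suff E u : \int[leb1 R]_(s in I) kernel n u s = \sum_(p <- l) p.1 * (if p.2 == 0%N then T else 0).
  by rewrite /mass !E.
rewrite /kernel; under eq_Rintegral do rewrite lE.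
have ic k : (leb1 R).-integrable I (EFin \o (fun s => cos (k%:R * (w * (u - s))))).
  apply: smooth_intble1 => //; apply: (smooth_shift (f := fun x => cos (k%:R * x))).
  by apply: smooth_line; exact: smooth_cos.
rewrite Rintegral_sum//; last by move=> i; exact: intbleZ.
by apply: eq_bigr => p _; rewrite RintegralZl// int_cos_shift.
Qed.

Lemma mass_cos n t :
  \int[leb1 R]_(s in I) (cos (w * (t - s)) * kernel n t s) = mass n.+1 - mass n.
Proof.
rewrite -(mass_shift n.+1 t) -(mass_shift n t) -RintegralB//.
- by apply: eq_Rintegral => s _; rewrite /kernel exprS; ring.
- by apply: smooth_intble1 => //; exact: smooth_kernel.
- by apply: smooth_intble1 => //; exact: smooth_kernel.
Qed.

Lemma pow_is_derive n (s : R) : is_derive s 1 (fun s : R => (1 + cos (w * s)) ^+ n)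
  (- (n%:R * w * sin (w * s) * (1 + cos (w * s)) ^+ n.-1)).
Proof.
elim: n => [|n ih].
  under eq_fun do rewrite expr0.
  by apply: is_derive_eq; rewrite !mul0r oppr0.
have d0 : is_derive s 1 (fun s : R => 1 + cos (w * s)) (- (w * sin (w * s))).
  by apply: is_derive_eq; rewrite /GRing.scale/=; ring.
under eq_fun do rewrite exprS.
have dm := is_deriveM d0 ih; apply: (is_derive_eq dm); rewrite /GRing.scale/= -(natr1 n).
case: n {ih dm} => [|n] /=; first by rewrite !expr0; ring.
by rewrite exprS; move: ((1 + _) ^+ n) => P; ring.
Qed.

(* [sin (1 + cos)^n] is periodic, with derivative proportional to
   [cos (1 + cos)^n - n (1 - cos) (1 + cos)^n]. *)
Lemma mass_defect n : mass n - (mass n.+1 - mass n) = mass n / n.+1%:R.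
Proof.
pose F (s : R) := sin (w * s) * (1 + cos (w * s)) ^+ n.
have sF : smooth F.
  apply: smoothM; first by apply: smooth_line; exact: smooth_sin.
  apply: smooth_pow; apply: (smoothD (@smooth_cst _ R 1)).
  by apply: smooth_line; exact: smooth_cos.
have E s : cos (w * (0 - s)) = cos (w * s) by rewrite sub0r mulrN cosN.
have dF s : 'D_(1 : R) F s = w * (n.+1%:R * (cos (w * (0 - s)) * kernel n 0 s) -
    n%:R * kernel n 0 s).
  have h : is_derive s 1 F (w * (n.+1%:R * (cos (w * (0 - s)) * kernel n 0 s) -
      n%:R * kernel n 0 s)).
    have d1 : is_derive s 1 (fun s : R => sin (w * s)) (w * cos (w * s)).
      by apply: is_derive_eq; rewrite /GRing.scale/=; ring.
    have dp := pow_is_derive n s.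
    rewrite /kernel E; have dm := is_deriveM d1 dp; apply: (is_derive_eq dm).
    rewrite /GRing.scale/= -(natr1 n).
    have := cos2Dsin2 (w * s); move: (cos (w * s)) (sin (w * s)) => c d cd.
    have d2 : d * d = (1 - c) * (1 + c) by rewrite -expr2 -subr_sqr expr1n -cd; ring.
    case: n {sF F E dp dm} => [|m] /=.
      by rewrite !expr0; ring.
    rewrite exprS; move: ((1 + c) ^+ m) => P.
    transitivity (w * c * ((1 + c) * P) - m.+1%:R * w * P * (d * d)); first by ring.
    by rewrite d2; ring.
  by rewrite derive_val.
have := int_derive T0 sF.
have -> : F T = 0 by rewrite /F omegaT//; have := sin_turn (R := R) 1; rewrite mul1r => ->; rewrite mul0r.
have -> : F 0 = 0 by rewrite /F mulr0 sin0 mul0r.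
rewrite subrr; under eq_Rintegral do rewrite dF.
have i1 := smooth_intble1 T0 (smooth_cos_kernel n 0).
have i2 := smooth_intble1 T0 (smooth_kernel n 0).
have i1' := intbleZ mI n.+1%:R i1; have i2' := intbleZ mI n%:R i2.
rewrite RintegralZl//; last exact: intbleB.
rewrite RintegralB// !RintegralZl// mass_cos -/(mass n).
move=> /eqP; rewrite mulf_eq0 gt_eqF ?omega_gt0//= => /eqP.
have n1 : n.+1%:R != 0 :> R by rewrite pnatr_eq0.
move=> h; apply: (mulIf n1); rewrite divfK//.
move: h; rewrite -natr1; move: (mass n) (mass n.+1) n%:R => a b k h.
by rewrite -[RHS]subr0 -h; ring.
Qed.

(** By [mass_defect], mass n.+1 - mass n = mass n (1 - 1 / n.+1) >= 0, so the masses stay above mass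
    0 = T. *)
Lemma mass_gt0 n : 0 < mass n.
Proof.
elim: n => [|n ih].
  rewrite /mass /kernel; under eq_Rintegral do rewrite expr0.
  by rewrite Rintegral_cst// mul1r I_length.
have := mass_defect n.
have n1 : 1 <= n.+1%:R :> R by rewrite ler1n.
have h : mass n / n.+1%:R <= mass n by rewrite ler_pdivrMr ?(lt_le_trans ltr01)// ler_peMr// ltW.
by move: ih h; move: (mass n / _) => d ih h; lra.
Qed.

Definition average n (h : R -> R) t : R :=
  (mass n)^-1 * \int[leb1 R]_(s in I) (h s * kernel n t s).

Section average.
Variables (h : R -> R) (M : R).
Hypotheses (ch : continuous h) (hM : forall s, `|h s| <= M).

Let int_hk n t : (leb1 R).-integrable I (EFin \o (fun s => h s * kernel n t s)).
Proof.
have mh : measurable_fun I (h : point1 R -> R).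
  by apply: measurable_funTS; exact: continuous_measurable_fun.
have ik := smooth_intble1 T0 (smooth_kernel n t).
have := intbleZ mI M ik; apply: intble_le => //.
- by apply: measurable_funM => //; exact: intble_measurable ik.
- move=> s _; rewrite normrM (ger0_norm (kernel_ge0 _ _ _)).
  by rewrite ler_wpM2r// kernel_ge0.
Qed.

Lemma average_bounded n t : `|average n h t| <= M.
Proof.
have ik := smooth_intble1 T0 (smooth_kernel n t).
rewrite /average normrM gtr0_norm ?invr_gt0 ?mass_gt0// mulrC ler_pdivrMr ?mass_gt0//.
apply: le_trans (le_normr_Rintegral _ (int_hk n t)) _ => //.
rewrite -(mass_shift n t) -RintegralZl//; apply: le_Rintegral => //.
- exact: integrable_norm (int_hk n t).
- exact: intbleZ.
- move=> s _; rewrite normrM (ger0_norm (kernel_ge0 _ _ _)).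
  by rewrite ler_wpM2r// kernel_ge0.
Qed.

Lemma cos_lt1 (t s : R) : 0 < t < T -> 0 <= s <= T -> s != t -> cos (w * (t - s)) < 1.
Proof.
move=> /andP[t0 tT] /andP[s0 sT] st.
have -> : w * (t - s) = pi * ((t - s) / T) *+ 2 by rewrite /w /omega; field; rewrite gt_eqF.
rewrite cos_mulr2n -subr_gt0.
have -> : 1 - (cos (pi * ((t - s) / T)) ^+ 2 *+ 2 - 1) = 2 * sin (pi * ((t - s) / T)) ^+ 2.
  by rewrite sin2cos2; ring.
rewrite mulr_gt0// exprn_even_gt0//=.
have pp : (0 : R) < pi := pi_gt0 R.
have [ts|ts] := ltP s t.
- apply: lt0r_neq0; apply: sin_gt0_pi; apply/andP; split.
    by rewrite mulr_gt0// divr_gt0// subr_gt0.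
  by rewrite gtr_pMr// ltr_pdivrMr// mul1r; lra.
- rewrite -oppr_eq0 -sinN -mulrN -mulNr opprB; apply: lt0r_neq0.
  have ts' : t < s by rewrite lt_neqAle eq_sym st.
  apply: sin_gt0_pi; apply/andP; split.
    by rewrite mulr_gt0// divr_gt0// subr_gt0.
  by rewrite gtr_pMr// ltr_pdivrMr// mul1r; lra.
Qed.

(** A Korovkin argument: on the interval, |h s - h t| <= eps + C (1 - cos (w (t - s))), and by
    [mass_defect] the average of 1 - cos is 1 / n.+1. As [h] may be non-periodic, [t] has to be
    interior: at an end the kernel concentrates at the other end as well. *)
Lemma average_cvg t : 0 < t < T -> average n h t @[n --> \oo] --> h t.
Proof.
move=> tT; have M0 : 0 <= M := le_trans (normr_ge0 _) (hM 0).
have key eps : 0 < eps -> exists2 C : R, 0 <= C & forall s, 0 <= s <= T ->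
    `|h s - h t| <= eps + C * (1 - cos (w * (t - s))).
  move=> e0; have cht : h s @[s --> t] --> h t by exact: ch.
  have /cvgrPdist_lt/(_ _ e0)/nbhs_ballP[d /= d0 hd] := cht.
  (* The second bracket is twice the positive part of d - |t - s|: it makes [g] positive at s = t
     and is zero once |t - s| >= d. The minimum of [g] on [0, T] thus bounds 1 - cos from below away
     from [t]. *)
  pose g (s : R) := 1 - cos (w * (t - s)) + (`|d - `|t - s| | + (d - `|t - s|)).
  have cg : continuous g.
    move=> s; have c1 : {for s, continuous (fun u : R => cos (w * (t - u)))}.
      by apply: smooth_continuous; apply: smooth_shift; exact: smooth_cos.
    have c2 : {for s, continuous (fun u : R => d - `|t - u|)}.
      apply: cvgB; first exact: cvg_cst.
      by apply: cvg_norm; apply: cvgB; [exact: cvg_cst|exact: cvg_id].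
    apply: cvgD; first by apply: cvgB; [exact: cvg_cst|exact: c1].
    by apply: cvgD; [apply: cvg_norm; exact: c2|exact: c2].
  have [c cI gc] := EVT_min (ltW T0) (continuous_subspaceT cg).
  have gp s : 0 <= s <= T -> 0 < g s.
    move=> sT; have [->|st] := eqVneq s t.
      by rewrite /g subrr mulr0 cos0 subrr add0r normr0 subr0 gtr0_norm// addr_gt0.
    rewrite /g ltr_pwDl// ?subr_gt0 ?cos_lt1//.
    by rewrite -lerBlDr sub0r ler_normr lexx orbT.
  have gc0 : 0 < g c by apply: gp; move: cI; rewrite in_itv.
  exists (2 * M / g c); first by rewrite divr_ge0 ?mulr_ge0// ltW.
  move=> s sT; have le1 : 0 <= 1 - cos (w * (t - s)) by rewrite subr_ge0 cos_le1.
  have [sd|sd] := ltP `|t - s| d.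
    have := hd s; rewrite -ball_normE/= => /(_ sd); rewrite distrC => /ltW h1.
    apply: (le_trans h1); rewrite lerDl mulr_ge0//; apply: divr_ge0; last exact: ltW.
    by rewrite mulr_ge0.
  have gs : g s = 1 - cos (w * (t - s)).
    by rewrite /g ler0_norm ?addNr ?addr0// subr_le0.
  have := gc s; rewrite in_itv/= gs => /(_ sT) h2.
  apply: (@le_trans _ _ (2 * M)).
    by apply: le_trans (ler_normB _ _) _; rewrite mulr_natl mulr2n lerD.
  apply: (@le_trans _ _ (2 * M / g c * (1 - cos (w * (t - s))))); last by rewrite lerDr ltW.
  by rewrite mulrAC -mulrA ler_peMr ?mulr_ge0// ler_pdivlMr// mul1r.
have bound eps C : 0 < eps -> 0 <= C -> (forall s, 0 <= s <= T ->
    `|h s - h t| <= eps + C * (1 - cos (w * (t - s)))) ->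
    forall n, `|average n h t - h t| <= eps + C / n.+1%:R.
  move=> e0 C0 hC n.
  have ik := smooth_intble1 T0 (smooth_kernel n t).
  have ick := smooth_intble1 T0 (smooth_cos_kernel n t).
  have mn := mass_gt0 n.
  have -> : average n h t - h t =
      (mass n)^-1 * \int[leb1 R]_(s in I) (h s * kernel n t s - h t * kernel n t s).
    rewrite RintegralB//; last exact: intbleZ.
    rewrite RintegralZl// mass_shift mulrBr; congr (_ - _).
    by rewrite mulrCA mulVf ?mulr1// gt_eqF.
  have ib : (leb1 R).-integrable I (EFin \o (fun s => h s * kernel n t s - h t * kernel n t s)).
    by apply: intbleB => //; exact: intbleZ.
  rewrite normrM gtr0_norm ?invr_gt0// mulrC ler_pdivrMr//.
  apply: le_trans (le_normr_Rintegral _ ib) _ => //.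
  have i1 := intbleZ mI eps ik.
  have i2 := intbleZ mI C (intbleB mI ik ick).
  apply: (@le_trans _ _ (\int[leb1 R]_(s in I) (eps * kernel n t s +
      C * (kernel n t s - cos (w * (t - s)) * kernel n t s)))).
    apply: le_Rintegral => //.
    - exact: integrable_norm ib.
    - exact: intbleD.
    - move=> s; rewrite /I/= in_itv/= => /andP[s0 sT].
      rewrite -mulrBl normrM (ger0_norm (kernel_ge0 _ _ _)).
      have s0T : 0 <= s <= T by rewrite (ltW s0) (ltW sT).
      have hs := hC s s0T.
      apply: le_trans (ler_wpM2r (kernel_ge0 n t s) hs) _.
      by rewrite le_eqVlt; apply/orP; left; apply/eqP; ring.
  rewrite RintegralD// RintegralZl// RintegralZl//; last exact: intbleB.
  rewrite RintegralB// mass_shift mass_cos mass_defect.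
  by rewrite mulrDl -[C / _ * _]mulrA [_^-1 * _]mulrC.
apply/cvgrPdist_lt => e /= e0.
have e2 : 0 < e / 2 by rewrite divr_gt0.
have [C C0 hC] := key _ e2.
have h0 : C / n.+1%:R @[n --> \oo] --> (0 : R).
  by rewrite -(mulr0 C); apply: cvgM; [exact: cvg_cst|exact: cvg_harmonic].
have /cvgrPdist_lt/(_ _ e2) := h0; apply: filterS => n /=.
rewrite sub0r normrN ger0_norm ?divr_ge0// => hn.
rewrite distrC; apply: le_lt_trans (bound _ _ e2 C0 hC n) _.
by rewrite [ltRHS]splitr ltrD2l.
Qed.

End average.

(** A kernel that is diagonal in the trigonometric system: integrating a function of [s] against it
    gives a trigonometric polynomial in [t] whose coefficients are multiples of Fourier
    coefficients. *)
Definition separable (F : R -> R -> R) := exists m (c : nat -> R), forall t s,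
  F t s = \sum_(j < m) c j * (trig T j s * trig T j t).

Lemma separable_ext F G : (forall t s, F t s = G t s) -> separable F -> separable G.
Proof. by move=> FG [m [c h]]; exists m, c => t s; rewrite -FG. Qed.

Lemma separableD F G : separable F -> separable G -> separable (fun t s => F t s + G t s).
Proof.
move=> [m [c hc]] [m' [c' hc']].
exists (maxn m m'), (fun j => c j * (j < m)%:R + c' j * (j < m')%:R) => t s.
have pad k (b : nat -> R) : (k <= maxn m m')%N ->
  \sum_(j < k) b j * (trig T j s * trig T j t) =
  \sum_(j < maxn m m') b j * (j < k)%:R * (trig T j s * trig T j t).
  move=> kM; rewrite (big_ord_widen _ (fun j => b j * (trig T j s * trig T j t)) kM).
  rewrite big_mkcond; apply: eq_bigr => j _.
  by case: ifP => _; rewrite ?mulr1// mulr0 mul0r.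
rewrite hc hc' (pad m c) ?leq_maxl// (pad m' c') ?leq_maxr// -big_split/=.
by apply: eq_bigr => j _; rewrite [RHS]mulrDl.
Qed.

Lemma separableZ a F : separable F -> separable (fun t s => a * F t s).
Proof.
move=> [m [c hc]]; exists m, (fun j => a * c j) => t s.
by rewrite hc mulr_sumr; apply: eq_bigr => j _; rewrite mulrA.
Qed.

Lemma separable_trig j : separable (fun t s => trig T j s * trig T j t).
Proof.
exists j.+1, (fun i => (i == j)%:R) => t s.
rewrite big_ord_recr/= eqxx mul1r big1 ?add0r// => i _.
by rewrite ltn_eqF// mul0r.
Qed.

Lemma separable_cos k : separable (fun t s => cos (k%:R * (w * (t - s)))).
Proof.
have E t s : cos (k%:R * (w * (t - s))) =
    trig T k.*2 s * trig T k.*2 t + sin (k%:R * w * s) * sin (k%:R * w * t).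
  rewrite /trig odd_double/= doubleK -/w -cosB.
  rewrite -[LHS]cosN; congr cos; ring.
case: k E => [|k] E.
  apply: separable_ext (separable_trig 0) => t s.
  by rewrite E !mul0r sin0 mul0r addr0.
apply: separable_ext (separableD (separable_trig k.+1.*2) (separable_trig k.*2.+1)) => t s.
by rewrite E; congr (_ + _); rewrite /trig /= odd_double/= uphalf_double.
Qed.

Lemma separable_kernel n : separable (kernel n).
Proof.
have [l lE] := cos_power_expansion n.
have -> : kernel n = fun t s => \sum_(p <- l) p.1 * cos (p.2%:R * (w * (t - s))).
  by apply/funext => t; apply/funext => s; rewrite /kernel lE.
elim: l {lE} => [|p l ih].
  by exists 0%N, (fun=> 0) => t s; rewrite big_nil big_ord0.
apply: separable_ext (separableD (separableZ p.1 (separable_cos p.2)) ih) => t s.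
by rewrite big_cons.
Qed.

End periodic_kernel.

Lemma section_continuous (U V W : topologicalType) (f : U * V -> W) (x : U) :
  continuous f -> continuous (fun s => f (x, s)).
Proof.
move=> cf s; apply: (@continuous_comp _ _ _ (fun s => (x, s)) f); last exact: cf.
by apply: cvg_pair; [exact: cvg_cst|exact: cvg_id].
Qed.

Section trigonometric_completeness.
Context {R : realType}.
Variables (Omega : set (point3 R)) (T : R).
Hypotheses (hO : bounded_lipschitz_domain Omega) (T0 : 0 < T).
Let I : set (point1 R) := `]0, T[%classic.
Let mI : measurable I := I_measurable T.
Let mO : measurable Omega := Omega_measurable hO.
Let Ooo : (leb3 R Omega < +oo)%E := Omega_finite hO.
Let Ioo : (leb1 R I < +oo)%E := I_finite T.
Let mQ : measurable (Q Omega T) := Q_measurable T hO.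
Let mu := leb4 R.
Local Notation Q := (Q Omega T).

Lemma trig_measurable j : measurable_fun I (trig T j : point1 R -> R).
Proof. by apply: smooth_measurable1 => //; exact: smooth_trig. Qed.

(** A test function close to [f] is averaged in time for each x. The averages are trigonometric
    polynomials in t with square-integrable coefficients; they converge pointwise and are bounded by
    [M], so dominated convergence gives the limit in L2. *)
Lemma trig_complete : complete_system (leb3 R) (leb1 R) Omega I (trig T).
Proof.
move=> f Lf eps eps0.
have e4 : 0 < eps / 4 by rewrite divr_gt0.
have [phi [tphi Lphi] hphi] := dense4 (openQ hO) (Q_finite T hO) Lf e4.
have [M M0 hM] := test_function_bounded tphi.
have cphi x : continuous (fun s : R => phi (x, s)).
  have c : continuous (phi : (R * R * R) * R -> R) by exact: smooth_continuous tphi.1.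
  exact: (@section_continuous (R * R * R)%type R R phi x c).
have [m hm] := choice (@separable_kernel R T).
have [c kE] := choice hm.
pose a n j x : R := (mass T n)^-1 * (c n j * partial (leb1 R) I (trig T j) phi x).
have La n j : scalL2 (leb3 R) Omega (a n j).
  apply: (scalL2Z mO); apply: (scalL2Z mO).
  apply: (partial_scalL2 mO mI Ooo Ioo (M := 1)) => //.
  - exact: trig_measurable.
  - by move=> t _; exact: trig_le1.
have aE n x t : Omega x -> synthesis (trig T) (m n) (a n) (x, t) =
    average T n (fun s => phi (x, s)) t.
  move=> Ox; rewrite /average /synthesis/=.
  have ij j : (leb1 R).-integrable I (EFin \o (fun s => phi (x, s) * trig T j s)).
    apply: (scalL2M_int mI).
      apply: (@scalL2_finite _ _ _ (leb1 R) I mI Ioo _ M) => //.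
      by apply: measurable_funTS; exact: continuous_measurable_fun.
    apply: (@scalL2_finite _ _ _ (leb1 R) I mI Ioo _ 1) => //.
      exact: trig_measurable.
    by move=> s _; exact: trig_le1.
  transitivity ((mass T n)^-1 * \int[leb1 R]_(s in I)
      (\sum_(j < m n) (c n j * trig T j t) * (phi (x, s) * trig T j s))).
    rewrite Rintegral_sum//; last by move=> j; exact: intbleZ.
    rewrite mulr_sumr; apply: eq_bigr => j _.
    by rewrite RintegralZl// /a /partial; move: (\int[leb1 R]_(_ in _) _) => J; ring.
  congr (_ * _); apply: eq_Rintegral => s _; rewrite kE mulr_sumr.
  by apply: eq_bigr => j _; ring.
have LS n : scalL2 mu Q (synthesis (trig T) (m n) (a n)).
  apply: (synthesis_scalL2 mO mI Ioo (M := 1)) => //.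
  - exact: trig_measurable.
  - by move=> j t _; exact: trig_le1.
have LM : scalL2 mu Q (fun=> `|M|).
  by apply: (@scalL2_finite _ _ _ mu Q mQ (Q_finite T hO) _ `|M|) => // z _; rewrite normr_id.
have cv : \int[mu]_(z in Q) ((synthesis (trig T) (m n) (a n) z - phi z) ^+ 2)
    @[n --> \oo] --> (0 : R).
  apply: (sq_cvg mQ _ _ _ LM).
  - by move=> n; case: (LS n).
  - by case: Lphi.
  - move=> [x t] [/= Ox]; rewrite /= in_itv/= => tT.
    under eq_fun do rewrite aE//.
    by apply: (average_cvg T0 (cphi x) (M := M)).
  - move=> [x t] n [/= Ox _]; rewrite aE//.
    apply: le_trans (ler_norm M); exact: (average_bounded T0 (cphi x)).
have /cvgrPdist_lt/(_ _ e4)[n _ /(_ n (leqnn n))] /= := cv.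
rewrite sub0r normrN ger0_norm ?sq_ge0// => hn.
exists (m n), (a n); split; first exact: La.
have L1 := scalL2B mQ Lf Lphi; have L2 := scalL2B mQ Lphi (LS n).
have := sqD_le mQ L1 L2.
rewrite (eq_Rintegral _ (g := fun z => (f z - synthesis (trig T) (m n) (a n) z) ^+ 2)); last first.
  by move=> z _; congr (_ ^+ 2); rewrite addrA subrK.
move=> h; apply: le_lt_trans h _.
have -> : \int[mu]_(z in Q) ((phi z - synthesis (trig T) (m n) (a n) z) ^+ 2) =
  \int[mu]_(z in Q) ((synthesis (trig T) (m n) (a n) z - phi z) ^+ 2).
  by apply: eq_Rintegral => z _; rewrite -sqrrN opprB.
by move: hphi hn; rewrite -/mu; move: (\int[mu]_(x in _) _) (\int[mu]_(x in _) _) => p q; lra.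
Qed.

End trigonometric_completeness.

(** * Time derivatives of periodic fields *)

Section step_derivative.
Context {R : realType}.

Lemma flat_nondecreasing (x y : R) : x <= y -> flat 0 x <= flat 0 y.
Proof.
move=> xy; have [x0|x0] := leP x 0; first by rewrite flat_le0 ?flat_ge0.
rewrite /flat x0 (lt_le_trans x0 xy) !expr0 !invr1 !mul1r ler_expR lerN2.
by rewrite lef_pV2 ?posrE// (lt_le_trans x0 xy).
Qed.

Lemma step_nondecreasing (x y : R) : x <= y -> step x <= step y.
Proof.
move=> xy; rewrite /step ler_pdivrMr ?step_den_gt0// mulrAC ler_pdivlMr ?step_den_gt0//.
rewrite !mulrDr [flat 0 y * flat 0 x]mulrC lerD2l.
by rewrite ler_pM ?flat_ge0// flat_nondecreasing// lerB.
Qed.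

(** The result [incr_derive1_ge0] concerns strictly increasing functions, so [e * x] is added and e
    tends to 0. *)
Lemma nondecreasing_derive_ge0 (f : R -> R) t : smooth f ->
  (forall x y, x <= y -> f x <= f y) -> 0 <= 'D_1 f t.
Proof.
move=> sf nf; apply/ler_addgt0Pr => e e0.
have sg : smooth (fun x : R => f x + e * x) by apply: smoothD => //; apply: smoothZ; exact: smooth_id.
have -> : 'D_1 f t + e = 'D_1 (fun x : R => f x + e * x) t.
  have h1 : is_derive t 1 (fun x : R => e * x) e.
    by apply: is_derive_eq; rewrite /GRing.scale/= mulr1.
  rewrite deriveD//; first by rewrite [X in _ = _ + X]derive_val.
  exact: smooth_derivable.
rewrite -derive1E; apply: (@incr_derive1_ge0 _ _ setT).
- by move=> x _; exact: smooth_derivable.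
- move=> x y _ _ xy; rewrite ler_ltD ?nf ?(ltW xy)//.
  by rewrite ltr_pM2l.
- by rewrite interiorT.
Qed.

Definition dstep (t : R) := 'D_1 (@step R) t.

Lemma dstep_ge0 t : 0 <= dstep t.
Proof. exact: nondecreasing_derive_ge0 (@smooth_step R) step_nondecreasing. Qed.

Lemma dstep_gt1 t : 1 < t -> dstep t = 0.
Proof.
move=> t1; transitivity ('D_1 (cst 1 : R -> R) t); last exact: derive_cst.
apply: near_eq_derive; near=> s; apply: step_ge1.
by apply: ltW; near: s; exact: lt_nbhsr.
Unshelve. all: by end_near. Qed.

End step_derivative.

(** * Cutoffs in time near the end points *)

Section end_cutoffs.
Context {R : realType}.
Variable T : R.
Hypothesis T0 : 0 < T.
Let I : set (point1 R) := `]0, T[%classic.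
Let mI : measurable I := I_measurable T.
Implicit Types (n : nat) (t : R).

(** It vanishes up to time 1 / n.+1 and equals 1 from 2 / n.+1 on. The offset -1 makes it vanish on
    a neighbourhood of 0, as a test function of the open interval must. *)
Definition rise n t : R := step (n.+1%:R * t - 1).
Definition fall n t : R := step (n.+1%:R * (T - t) - 1).
Definition ramp n t : R := rise n t * fall n t.
Definition drise n t : R := n.+1%:R * dstep (n.+1%:R * t - 1).
Definition dfall n t : R := n.+1%:R * dstep (n.+1%:R * (T - t) - 1).
Definition dramp n t : R := drise n t * fall n t - rise n t * dfall n t.

Lemma smooth_rise n : smooth (rise n).
Proof. exact: (smooth_comp (@smooth_step R) (smooth_aff n.+1%:R (-1))). Qed.

Lemma smooth_fall n : smooth (fall n).
Proof.
apply: (smooth_comp (@smooth_step R)).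
apply: (smoothB (smoothZ n.+1%:R _) (@smooth_cst _ R 1)).
exact: (smoothB (@smooth_cst _ R T) (@smooth_id R)).
Qed.

Lemma smooth_ramp n : smooth (ramp n).
Proof. by apply: smoothM; [exact: smooth_rise|exact: smooth_fall]. Qed.

Lemma is_derive_rise n t : is_derive t 1 (rise n) (drise n t).
Proof.
have h : is_derive t 1 (fun t : R => n.+1%:R * t - 1) n.+1%:R.
  by apply: is_derive_eq; rewrite /GRing.scale/= ?mulr1 ?subr0.
have ds : derivable (@step R) (n.+1%:R * t - 1) 1 by exact: smooth_derivable (@smooth_step R).
have dh : derivable (fun t : R => n.+1%:R * t - 1) t 1 by [].
have h2 := is_derive_comp dh ds; apply: (is_derive_eq h2).
by rewrite derive_val /drise mulrC.
Qed.

Lemma is_derive_fall n t : is_derive t 1 (fall n) (- dfall n t).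
Proof.
have h : is_derive t 1 (fun t : R => n.+1%:R * (T - t) - 1) (- n.+1%:R).
  by apply: is_derive_eq; rewrite /GRing.scale/=; ring.
have ds : derivable (@step R) (n.+1%:R * (T - t) - 1) 1 by exact: smooth_derivable (@smooth_step R).
have dh : derivable (fun t : R => n.+1%:R * (T - t) - 1) t 1 by [].
have h2 := is_derive_comp dh ds; apply: (is_derive_eq h2).
by rewrite derive_val /dfall mulrN mulrC.
Qed.

Lemma derive_ramp n t : 'D_1 (ramp n) t = dramp n t.
Proof.
have hr := is_derive_rise n t; have hf := is_derive_fall n t.
have := is_deriveM hr hf => h; rewrite derive_val /dramp /GRing.scale/=.
by rewrite mulrN addrC [fall n t * _]mulrC.
Qed.

Lemma drise_ge0 n t : 0 <= drise n t.
Proof. by rewrite mulr_ge0// dstep_ge0. Qed.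

Lemma dfall_ge0 n t : 0 <= dfall n t.
Proof. by rewrite mulr_ge0// dstep_ge0. Qed.

Lemma ramp01 n t : 0 <= ramp n t <= 1.
Proof. by rewrite /ramp /rise /fall mulr_ge0 ?step_ge0//= mulr_ile1 ?step_ge0 ?step_le1. Qed.

Lemma dramp_le n t : `|dramp n t| <= drise n t + dfall n t.
Proof.
apply: le_trans (ler_normB _ _) _.
rewrite (normrM (drise n t)) (normrM (rise n t)) (ger0_norm (drise_ge0 n t)).
rewrite (ger0_norm (dfall_ge0 n t)) /rise /fall !(ger0_norm (step_ge0 _)) lerD//.
  by rewrite ler_piMr ?drise_ge0 ?step_le1.
by rewrite ler_piMl ?dfall_ge0 ?step_le1.
Qed.

Lemma dramp_mid n t : 2 < n.+1%:R * t -> 2 < n.+1%:R * (T - t) -> dramp n t = 0.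
Proof.
move=> h1 h2; rewrite /dramp /drise /dfall !dstep_gt1; first by rewrite !mulr0 mul0r subrr.
- lra.
- lra.
Qed.

Lemma ramp_cvg t : 0 < t < T -> ramp n t @[n --> \oo] --> (1 : R).
Proof.
move=> /andP[t0 tT]; apply: cvg_near_cst.
have [m1 h1] : exists m, forall n, (m <= n)%N -> 2 <= n.+1%:R * t.
  exists (Num.bound (2 / t)) => n mn; rewrite -ler_pdivrMr//.
  have /archi_boundP h : 0 <= 2 / t by rewrite divr_ge0// ltW.
  by apply: (le_trans (ltW h)); rewrite ler_nat (leq_trans mn).
have [m2 h2] : exists m, forall n, (m <= n)%N -> 2 <= n.+1%:R * (T - t).
  have Tt : 0 < T - t by rewrite subr_gt0.
  exists (Num.bound (2 / (T - t))) => n mn; rewrite -ler_pdivrMr//.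
  have /archi_boundP h : 0 <= 2 / (T - t) by rewrite divr_ge0// ltW.
  by apply: (le_trans (ltW h)); rewrite ler_nat (leq_trans mn).
exists (maxn m1 m2) => // n /=; rewrite geq_max => /andP[/h1 a /h2 b].
by rewrite /ramp /rise /fall !step_ge1 ?mul1r//; lra.
Qed.

Lemma ramp_test n : test_function (`]0, T[%classic : set R) (ramp n).
Proof.
split; first exact: smooth_ramp.
have n0 : 0 < n.+1%:R :> R by [].
exists `[n.+1%:R^-1, T - n.+1%:R^-1]%classic; split.
- exact: segment_compact.
- move=> t /=; rewrite !in_itv/= => /andP[a b]; apply/andP; split.
    by apply: lt_le_trans a; rewrite invr_gt0.
  by apply: (le_lt_trans b); rewrite ltrBlDr ltrDl invr_gt0.
- move=> t /=; rewrite in_itv/= => /negP; rewrite negb_and -!ltNge => /orP[h|h].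
    rewrite /ramp /rise step_le0 ?mul0r// subr_le0.
    by rewrite mulrC -ler_pdivlMr// mul1r ltW.
  rewrite /ramp /fall [step (_ * (T - t) - 1)]step_le0 ?mulr0// subr_le0.
  by rewrite mulrC -ler_pdivlMr// mul1r lerBlDr -lerBlDl ltW.
Qed.

Lemma ramp0 n : ramp n 0 = 0.
Proof. by rewrite /ramp /rise step_le0 ?mul0r// mulr0 sub0r lerN10. Qed.

Lemma rampT n : ramp n T = 0.
Proof. by rewrite /ramp /fall [X in _ * X]step_le0 ?mulr0// subrr mulr0 sub0r lerN10. Qed.

Let smooth_drise n : smooth (drise n).
Proof.
have := smooth_derive (1 : R) (smooth_rise n); rewrite (_ : (fun x => _) = drise n)//.
by apply/funext => t; have h := is_derive_rise n t; rewrite derive_val.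
Qed.

Let smooth_dfall n : smooth (dfall n).
Proof.
have := smoothN (smooth_derive (1 : R) (smooth_fall n)); rewrite (_ : (fun x => _) = dfall n)//.
by apply/funext => t; have h := is_derive_fall n t; rewrite derive_val opprK.
Qed.

Lemma smooth_dramp n : smooth (dramp n).
Proof.
have := smooth_derive (1 : R) (smooth_ramp n); rewrite (_ : (fun x => _) = dramp n)//.
by apply/funext => t; rewrite derive_ramp.
Qed.

Lemma int_dramp n : \int[leb1 R]_(t in I) dramp n t = 0.
Proof.
have := int_derive T0 (smooth_ramp n); rewrite ramp0 rampT subrr => <-.
by apply: eq_Rintegral => t _; rewrite derive_ramp.
Qed.

(** Each of the two integrals is the total increment of a function with values in [0, 1]. *)
Lemma int_dramp_bound n : \int[leb1 R]_(t in I) (drise n t + dfall n t) <= 2.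
Proof.
rewrite RintegralD//; [|exact: smooth_intble1|exact: smooth_intble1].
have -> : \int[leb1 R]_(t in I) drise n t = rise n T - rise n 0.
  rewrite -(int_derive T0 (smooth_rise n)); apply: eq_Rintegral => t _.
  by have h := is_derive_rise n t; rewrite derive_val.
have -> : \int[leb1 R]_(t in I) dfall n t = fall n 0 - fall n T.
  transitivity (\int[leb1 R]_(t in I) (-1 * 'D_1 (fall n) t)).
    apply: eq_Rintegral => t _.
    by have h := is_derive_fall n t; rewrite derive_val mulN1r opprK.
  rewrite RintegralZl//; last first.
    by apply: smooth_intble1 => //; apply: smooth_derive; exact: smooth_fall.
  by rewrite int_derive ?mulN1r ?opprB//; exact: smooth_fall.
have := step_le1 (n.+1%:R * T - 1); have := step_ge0 (n.+1%:R * 0 - 1 : R).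
have := step_le1 (n.+1%:R * (T - 0) - 1); have := step_ge0 (n.+1%:R * (T - T) - 1).
by rewrite -/(rise n T) -/(rise n 0) -/(fall n 0) -/(fall n T); lra.
Qed.

Lemma int_dramp_bound_intble n :
  (leb1 R).-integrable I (EFin \o (fun t => drise n t + dfall n t)).
Proof. by apply: intbleD => //; exact: smooth_intble1. Qed.

Lemma ae_le_Rintegral d (X : measurableType d) (mu : {measure set X -> \bar R})
    (D : set X) (f g : X -> R) : measurable D ->
  mu.-integrable D (EFin \o f) -> mu.-integrable D (EFin \o g) ->
  {ae mu, forall x, D x -> f x <= g x} ->
  \int[mu]_(x in D) f x <= \int[mu]_(x in D) g x.
Proof.
move=> mD if_ ig fg; rewrite -subr_ge0 -RintegralB//.
have id := intbleB mD ig if_; have md := intble_measurable id.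
rewrite (@ae_eq_Rintegral _ _ _ mu D mD _ (fun x => `|g x - f x|))//.
- by apply: Rintegral_ge0 => x _.
- exact: measurableT_comp.
- by apply: filterS fg => x h Dx; rewrite ger0_norm// subr_ge0 h.
Qed.

(* The integral of [dramp n] vanishes and its mass is at most 2, concentrated
   near the endpoints, where [g] takes nearly equal values. *)
Lemma dramp_pairing_cvg (g gt : R -> R) : g 0 = g T ->
  (forall e, 0 < e -> exists2 d : R, 0 < d & forall t, 0 <= t <= T ->
     t < d \/ T - d < t -> `|g t - g 0| <= e) ->
  (leb1 R).-integrable I (EFin \o gt) ->
  {ae leb1 R, forall t, I t -> gt t = g t} ->
  \int[leb1 R]_(t in I) (gt t * dramp n t) @[n --> \oo] --> (0 : R).
Proof.
move=> g0T gnear ig gE; apply/cvgrPdist_le => e /= e0.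
have e2 : 0 < e / 2 by rewrite divr_gt0.
have [d d0 hd] := gnear _ e2.
exists (Num.bound (2 / d)) => // n /= mn; rewrite sub0r normrN.
have hn : 2 < n.+1%:R * d.
  rewrite -ltr_pdivrMr//.
  have /archi_boundP h : 0 <= 2 / d by rewrite divr_ge0// ltW.
  by apply: (lt_le_trans h); rewrite ler_nat (leq_trans mn).
have idr := smooth_intble1 T0 (smooth_dramp n).
have [M M0 hM] := smooth_bounded1 T0 (smooth_dramp n).
have igd : (leb1 R).-integrable I (EFin \o (fun t => gt t * dramp n t)).
  have iM := intbleZ mI M (integrable_norm ig).
  apply: (intble_le mI _ _ iM).
    by apply: measurable_funM; [exact: intble_measurable ig|exact: intble_measurable idr].
  move=> t; rewrite /I/= in_itv/= => /andP[t0 tT].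
  by rewrite normrM mulrC ler_wpM2r// hM// !ltW.
have i1 : (leb1 R).-integrable I (EFin \o (fun t => (gt t - g 0) * dramp n t)).
  have := intbleB mI igd (intbleZ mI (g 0) idr).
  by apply: intble_eq => // t _; rewrite mulrBl.
have -> : \int[leb1 R]_(t in I) (gt t * dramp n t) =
    \int[leb1 R]_(t in I) ((gt t - g 0) * dramp n t).
  under [RHS]eq_Rintegral do rewrite mulrBl.
  by rewrite RintegralB ?RintegralZl ?int_dramp ?mulr0 ?subr0//; exact: intbleZ.
apply: le_trans (le_normr_Rintegral _ i1) _ => //.
have ib := intbleZ mI (e / 2) (int_dramp_bound_intble n).
apply: (@le_trans _ _ (\int[leb1 R]_(t in I) (e / 2 * (drise n t + dfall n t)))).
  apply: ae_le_Rintegral => //; first exact: integrable_norm i1.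
  apply: ae_mono gE => t h It; rewrite h// normrM.
  have := It; rewrite /I/= in_itv/= => /andP[t0 tT].
  have [near|far] := pselect (t < d \/ T - d < t).
    by apply: ler_pM => //; [apply: hd => //; rewrite !ltW|exact: dramp_le].
  have dt : d <= t by rewrite leNgt; apply/negP => ?; apply: far; left.
  have dt' : d <= T - t by rewrite leNgt; apply/negP => ?; apply: far; right; lra.
  rewrite dramp_mid ?normr0 ?mulr0.
  - by rewrite mulr_ge0 ?addr_ge0 ?drise_ge0 ?dfall_ge0// ltW.
  - by apply: (lt_le_trans hn); rewrite ler_pM2l.
  - by apply: (lt_le_trans hn); rewrite ler_pM2l.
rewrite RintegralZl//; last exact: int_dramp_bound_intble.
apply: (@le_trans _ _ (e / 2 * 2)); last by rewrite divfK.
by rewrite ler_wpM2l ?int_dramp_bound// ltW.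
Qed.

End end_cutoffs.

(** * Integration by parts in time for periodic functions *)

Section time_derivative.
Context {R : realType}.
Variables (Omega : set (point3 R)) (T : R).
Hypotheses (hO : bounded_lipschitz_domain Omega) (T0 : 0 < T).
Let I : set (point1 R) := `]0, T[%classic.
Let mI : measurable I := I_measurable T.
Let mO : measurable Omega := Omega_measurable hO.
Let Ooo : (leb3 R Omega < +oo)%E := Omega_finite hO.
Let Ioo : (leb1 R I < +oo)%E := I_finite T.
Let mQ : measurable (Q Omega T) := Q_measurable T hO.
Let mu : {measure set (point4 R) -> \bar R} := leb4 R.
Local Notation Q := (Q Omega T).

Lemma derive_tensor (psi : point3 R -> R) (tau : R -> R) z : smooth tau ->
  'D_et (fun z : point4 R => psi z.1 * tau z.2) z = psi z.1 * 'D_(1 : R) tau z.2.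
Proof.
move=> st; rewrite derive_line.
rewrite (_ : (fun _ => _) = fun t : R => psi z.1 * tau (t + z.2)); last first.
  apply/funext => t; congr (psi _ * tau _); last by rewrite /= [_ *: _]mulr1.
  by rewrite /= scaler0 add0r.
have stz : smooth (fun t : R => tau (t + z.2)).
  exact: (smooth_comp st (smoothD (@smooth_id R) (@smooth_cst _ R z.2))).
rewrite derive_mulr; last exact: smooth_derivable.
congr (_ * _); rewrite [RHS]derive_line; congr ('D_(1 : R) _ 0).
by apply/funext => t; rewrite [_ *: _]mulr1.
Qed.

Lemma test_scalL2 psi : test_function Omega psi -> scalL2 (leb3 R) Omega psi.
Proof.
move=> tp; have [M _ hM] := test_function_bounded tp.
apply: (@scalL2_finite _ _ _ (leb3 R) Omega mO Ooo _ M) => //.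
by apply: continuous3_measurable; exact: smooth_continuous tp.1.
Qed.

Lemma smooth_weight (theta : R -> R) : smooth theta ->
  exists2 M : R, measurable_fun I (theta : point1 R -> R) & forall t, I t -> `|theta t| <= M.
Proof.
move=> st; have [M _ hM] := smooth_bounded1 T0 st.
exists M; first exact: smooth_measurable1.
by move=> t; rewrite /I/= in_itv/= => /andP[a b]; rewrite hM// !ltW.
Qed.

Lemma tensor_scalL2 psi theta : scalL2 (leb3 R) Omega psi -> smooth theta ->
  scalL2 mu Q (fun z => psi z.1 * theta z.2).
Proof. by move=> Lp /smooth_weight[M mt tM]; exact: (scalL2_tensor mO mI Ioo Lp mt tM). Qed.

Lemma ramp_limit h : mu.-integrable Q (EFin \o h) ->
  \int[mu]_(z in Q) (h z * ramp T n z.2) @[n --> \oo] --> \int[mu]_(z in Q) h z.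
Proof.
move=> ih; have mh := intble_measurable ih.
apply: (dominated_Rintegral mQ _ mh _ (integrable_norm ih)).
- move=> n; apply: measurable_funM => //.
  apply: (measurable_comp mI); first by move=> _ [z [_ It] <-].
    by apply: smooth_measurable1 => //; exact: smooth_ramp.
  exact: measurable_funTS measurable_snd.
- move=> [x t] [/= _]; rewrite in_itv/= => tT.
  by rewrite -[X in _ --> X]mulr1; apply: cvgM; [exact: cvg_cst|exact: ramp_cvg].
- move=> z n _; have /andP[r0 r1] := ramp01 T n z.2.
  by rewrite normrM (ger0_norm r0) ler_piMr.
Qed.

Lemma sq_pairing_le (f g psi : point3 R -> R) : scalL2 (leb3 R) Omega f ->
  scalL2 (leb3 R) Omega g -> scalL2 (leb3 R) Omega psi ->
  (\int[leb3 R]_(x in Omega) (f x * psi x) - \int[leb3 R]_(x in Omega) (g x * psi x)) ^+ 2 <=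
  \int[leb3 R]_(x in Omega) ((f x - g x) ^+ 2) * \int[leb3 R]_(x in Omega) (psi x ^+ 2).
Proof.
move=> Lf Lg Lp; rewrite -RintegralB//; [|exact: scalL2M_int|exact: scalL2M_int].
under eq_Rintegral do rewrite -mulrBl.
by apply: cauchy_schwarz => //; exact: scalL2B.
Qed.

Section component.
Variables f w u : point4 R -> R.
Hypotheses (Lf : scalL2 mu Q f) (Lw : scalL2 mu Q w).
Hypothesis dtf : forall phi, test_function Q phi ->
  \int[mu]_(z in Q) (w z * phi z) = - \int[mu]_(z in Q) (f z * 'D_et phi z).
Hypothesis uf : {ae mu, forall z, Q z -> u z = f z}.
Hypothesis Lu : forall t : R, 0 <= t <= T -> scalL2 (leb3 R) Omega (fun x => u (x, t)).
Hypothesis cu : forall t : R, 0 <= t <= T -> forall eps, 0 < eps -> exists2 d : R, 0 < d &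
  forall s : R, 0 <= s <= T -> `|s - t| < d ->
    \int[leb3 R]_(x in Omega) ((u (x, s) - u (x, t)) ^+ 2) < eps.
Hypothesis pu : {ae leb3 R, forall x, Omega x -> u (x, 0) = u (x, T)}.

(** Formed with the continuous representative [u], so that the values at 0 and T are meaningful; the
    same pairing with [f] agrees with it at almost every time. *)
Let G psi t : R := \int[leb3 R]_(x in Omega) (u (x, t) * psi x).

Lemma G_near psi t : scalL2 (leb3 R) Omega psi -> 0 <= t <= T -> forall e, 0 < e ->
  exists2 d : R, 0 < d & forall s, 0 <= s <= T -> `|s - t| < d -> `|G psi s - G psi t| < e.
Proof.
move=> Lp tT e e0; set P := \int[leb3 R]_(x in Omega) (psi x ^+ 2).
have P0 : 0 <= P by exact: sq_ge0.
have e'0 : 0 < e ^+ 2 / (P + 1) by rewrite divr_gt0 ?exprn_gt0// ltr_wpDl.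
have [d d0 hd] := cu tT e'0; exists d => // s sT sd.
have h := hd s sT sd.
rewrite -(ltr_pXn2r (n := 2)) ?nnegrE ?normr_ge0 ?(ltW e0)// real_normK ?num_real//.
apply: le_lt_trans (sq_pairing_le (Lu sT) (Lu tT) Lp) _; rewrite -/P.
have : e ^+ 2 / (P + 1) * (P + 1) = e ^+ 2 by rewrite divfK// gt_eqF// ltr_wpDl.
have := sq_ge0 (leb3 R) Omega (fun x => u (x, s) - u (x, t)).
move: h e'0; move: (\int[leb3 R]_(x in Omega) _) (e ^+ 2 / (P + 1)) => a k h k0 a0 <-.
rewrite mulrDr mulr1; apply: (@le_lt_trans _ _ (k * P)); last by rewrite ltrDl.
by rewrite ler_wpM2r// ltW.
Qed.

Lemma G_periodic psi : scalL2 (leb3 R) Omega psi -> G psi 0 = G psi T.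
Proof.
move=> Lp; have [L0 LT] : scalL2 (leb3 R) Omega (fun x => u (x, 0)) /\
    scalL2 (leb3 R) Omega (fun x => u (x, T)).
  by split; apply: Lu; rewrite ?lexx (ltW T0).
apply: ae_eq_Rintegral => //.
- by apply: measurable_funM; [case: L0|case: Lp].
- by apply: measurable_funM; [case: LT|case: Lp].
- by apply: ae_mono pu => x h Ox; rewrite h.
Qed.

Lemma G_ae psi : scalL2 (leb3 R) Omega psi ->
  {ae leb1 R, forall t, I t -> \int[leb3 R]_(x in Omega) (f (x, t) * psi x) = G psi t}.
Proof.
move=> Lp; have := ae_section2 uf; apply: ae_mono => t h It.
have tT : 0 <= t <= T by move: It; rewrite /I/= in_itv/= => /andP[a b]; rewrite !ltW.
apply: ae_eq_Rintegral => //.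
- apply: measurable_funM; last by case: Lp.
  by apply: (measurable_section2 mO mI _ It); case: Lf.
- by apply: measurable_funM; [case: (Lu tT)|case: Lp].
- by apply: ae_mono h => x h Ox; rewrite h.
Qed.

Lemma slice_pairing psi (tau : R -> R) : scalL2 (leb3 R) Omega psi -> smooth tau ->
  \int[mu]_(z in Q) (f z * (psi z.1 * tau z.2)) =
  \int[leb1 R]_(t in I) (\int[leb3 R]_(x in Omega) (f (x, t) * psi x) * tau t).
Proof.
move=> Lp st; have Lpt := tensor_scalL2 Lp st.
have Lp1 := tensor_scalL2 Lp (@smooth_cst _ R 1).
have i1 := scalL2M_int mQ Lf Lp1.
rewrite -(Rfubini2 mO mI (scalL2M_int mQ Lf Lpt)).
apply: ae_eq_Rintegral => //.
- exact: intble_measurable (integrable_partial2 mO mI (scalL2M_int mQ Lf Lpt)).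
- apply: measurable_funM; last exact: smooth_measurable1.
  have := intble_measurable (integrable_partial2 mO mI i1).
  by apply: eq_measurable_fun => t _; apply: eq_Rintegral => x _; rewrite /= mulr1.
- have := integrable_section2 mO mI i1; apply: ae_mono => t h It.
  rewrite -RintegralZr//.
    by apply: eq_Rintegral => x _; rewrite mulrA.
  by have := h It; apply: intble_eq => // x _; rewrite /= mulr1.
Qed.

(** The weak derivative admits only test functions of the open cylinder, so [theta] is multiplied by
    the cutoff [ramp T n] and n tends to infinity. The derivative of the cutoff leaves a boundary
    term, and this is where the periodicity of [u] enters. *)
Lemma periodic_ibp psi theta : test_function Omega psi -> smooth theta ->
  theta 0 = theta T ->
  \int[mu]_(z in Q) (w z * (psi z.1 * theta z.2)) =
  - \int[mu]_(z in Q) (f z * (psi z.1 * 'D_(1 : R) theta z.2)).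
Proof.
move=> tp st th; have Lp := test_scalL2 tp.
have sdt := smooth_derive (1 : R) st.
have Lpt := tensor_scalL2 Lp st; have Lpd := tensor_scalL2 Lp sdt.
have ia := scalL2M_int mQ Lw Lpt; have ib := scalL2M_int mQ Lf Lpd.
have sr n : smooth (fun t : R => theta t * ramp T n t).
  by apply: smoothM => //; exact: smooth_ramp.
have sd n : smooth (fun t : R => theta t * dramp T n t).
  by apply: smoothM => //; exact: smooth_dramp.
have Lpr n := tensor_scalL2 Lp (smoothM sdt (smooth_ramp T n)).
have ibr n := scalL2M_int mQ Lf (Lpr n).
have Lps n := tensor_scalL2 Lp (sd n).
have ibs n := scalL2M_int mQ Lf (Lps n).
have E n : \int[mu]_(z in Q) ((w z * (psi z.1 * theta z.2)) * ramp T n z.2) =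
    - (\int[mu]_(z in Q) ((f z * (psi z.1 * 'D_(1 : R) theta z.2)) * ramp T n z.2) +
       \int[leb1 R]_(t in I)
         (\int[leb3 R]_(x in Omega) (f (x, t) * psi x) * theta t * dramp T n t)).
  have tphi : test_function Q (fun z : point4 R => psi z.1 * (theta z.2 * ramp T n z.2)).
    apply: (test_function_setX (g := fun t : R => theta t * ramp T n t) tp).
    rewrite (_ : (fun t : R => _) = fun t : R => ramp T n t * theta t).
      by apply: test_functionM => //; exact: ramp_test.
    by apply/funext => t; rewrite mulrC.
  transitivity (\int[mu]_(z in Q) (w z * (psi z.1 * (theta z.2 * ramp T n z.2)))).
    by apply: eq_Rintegral => z _; rewrite !mulrA.
  rewrite dtf//; congr (- _).
  have dE z : 'D_et (fun z : point4 R => psi z.1 * (theta z.2 * ramp T n z.2)) z =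
      psi z.1 * ('D_(1 : R) theta z.2 * ramp T n z.2) + psi z.1 * (theta z.2 * dramp T n z.2).
    rewrite (derive_tensor psi z (sr n)) -mulrDr; congr (_ * _).
    rewrite deriveM; [|exact: smooth_derivable|exact: smooth_derivable (smooth_ramp T n)].
    by rewrite derive_ramp /GRing.scale/= addrC [ramp _ _ _ * _]mulrC.
  under eq_Rintegral do rewrite dE mulrDr.
  rewrite RintegralD//; congr (_ + _).
    by apply: eq_Rintegral => z _; rewrite !mulrA.
  rewrite (slice_pairing Lp (sd n)); apply: eq_Rintegral => t _.
  by rewrite mulrA.
have L1 := ramp_limit ia; have L2 := ramp_limit ib.
(* The term in which the derivative falls on the cutoff. It tends to 0 since the product of [G psi]
   and [theta] takes the same value at both ends. *)
have L3 : \int[leb1 R]_(t in I)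
    (\int[leb3 R]_(x in Omega) (f (x, t) * psi x) * theta t * dramp T n t)
    @[n --> \oo] --> (0 : R).
  apply: (dramp_pairing_cvg T0 (g := fun t => G psi t * theta t)).
  - by rewrite (G_periodic Lp) th.
  - move=> e e0; have [M M0 hM] := smooth_bounded1 T0 st.
    have zT : (0 : R) <= 0 <= T by rewrite lexx ltW.
    have TT : 0 <= T <= T by rewrite lexx andbT ltW.
    pose K := `|G psi 0| + 1; have K0 : 0 < K by rewrite ltr_wpDl.
    (* Both ends at once: at t0 = 0 and at t0 = T the factors take their values at 0, so continuity
       of each factor at [t0] suffices. The summands 1 in M + 1 and in [K] keep the divisors
       positive. *)
    have ct t0 : 0 <= t0 <= T -> G psi t0 = G psi 0 -> theta t0 = theta 0 ->
      exists2 d : R, 0 < d & forall t, 0 <= t <= T -> `|t - t0| < d ->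
        `|G psi t * theta t - G psi 0 * theta 0| <= e.
      move=> t0T G0 th0.
      have e1 : 0 < e / 2 / (M + 1) by rewrite !divr_gt0// ltr_wpDl.
      have e2 : 0 < e / 2 / K by rewrite !divr_gt0.
      have [d1 d10 h1] := G_near Lp t0T e1.
      have := @smooth_continuous R _ theta st t0.
      move=> /cvgrPdist_lt/(_ _ e2)/nbhs_ballP[d2 /= d20 h2].
      exists (Num.min d1 d2); first by rewrite lt_min d10.
      move=> t tT; rewrite lt_min => /andP[td1 td2].
      have a1 := h1 t tT td1.
      have := h2 t; rewrite -ball_normE/= distrC => /(_ td2) a2.
      rewrite -G0 -th0.
      have -> : G psi t * theta t - G psi t0 * theta t0 =
        (G psi t - G psi t0) * theta t - G psi t0 * (theta t0 - theta t) by ring.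
      apply: le_trans (ler_normB _ _) _; rewrite !normrM [leRHS]splitr; apply: lerD.
        apply: (@le_trans _ _ (e / 2 / (M + 1) * (M + 1))).
          by apply: ler_pM => //; [exact: ltW|apply: (le_trans (hM t tT)); rewrite lerDl].
        by rewrite divfK// gt_eqF// ltr_wpDl.
      apply: (@le_trans _ _ (K * (e / 2 / K))); last by rewrite mulrC divfK// gt_eqF.
      by apply: ler_pM => //; [rewrite G0 /K lerDl|exact: ltW].
    have [d d0 hd] := ct 0 zT erefl erefl.
    have [d' d'0 hd'] := ct T TT (esym (G_periodic Lp)) (esym th).
    exists (Num.min d d'); first by rewrite lt_min d0.
    move=> t tT [|]; rewrite ?lt_min.
      by move=> /andP[h _]; apply: hd => //; case/andP: tT => t0 _; rewrite subr0 ger0_norm.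
    move=> h; apply: hd' => //; case/andP: tT => t0 tT'.
    rewrite distrC ger0_norm ?subr_ge0// ltrBlDr addrC -ltrBlDr.
    by apply: le_lt_trans h; rewrite lerB// ge_min lexx orbT.
  - have Lp1 := tensor_scalL2 Lp st.
    have := integrable_partial2 mO mI (scalL2M_int mQ Lf Lpt).
    have i0 := integrable_partial2 mO mI
      (scalL2M_int mQ Lf (tensor_scalL2 Lp (@smooth_cst _ R 1))).
    have [M mt tM] := smooth_weight st.
    move=> _; apply: (intble_le mI _ _ (intbleZ mI M (integrable_norm i0))).
      apply: measurable_funM => //.
      have := intble_measurable i0; apply: eq_measurable_fun => t _.
      by apply: eq_Rintegral => x _; rewrite /= mulr1.
    move=> t It; rewrite normrM mulrC; apply: ler_pM => //; first exact: tM.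
    rewrite le_eqVlt; apply/orP; left; apply/eqP; congr (`|_|).
    by apply: eq_Rintegral => x _; rewrite /= mulr1.
  - by apply: ae_mono (G_ae Lp) => t h It; rewrite h.
have L4 := cvgN (cvgD L2 L3).
rewrite addr0 in L4.
have L1' : \int[mu]_(z in Q) ((w z * (psi z.1 * theta z.2)) * ramp T n z.2) @[n --> \oo] -->
   - \int[mu]_(z in Q) (f z * (psi z.1 * 'D_(1 : R) theta z.2)).
  by under eq_fun do rewrite E; exact: L4.
exact: (cvg_unique _ L1 L1').
Qed.

(** With [psi] arbitrary in [periodic_ibp], the fundamental lemma in the space variable turns the
    integrated identity into one for almost every x. *)
Lemma periodic_partial theta : smooth theta -> theta 0 = theta T ->
  {ae leb3 R, forall x, Omega x ->
    partial (leb1 R) I theta w x = - partial (leb1 R) I (fun t : R => 'D_(1 : R) theta t) f x}.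
Proof.
move=> st th; have sdt := smooth_derive (1 : R) st.
have [M mt tM] := smooth_weight st; have [M' mt' tM'] := smooth_weight sdt.
have L1 := partial_scalL2 mO mI Ooo Ioo mt tM Lw.
have L2 := partial_scalL2 mO mI Ooo Ioo mt' tM' Lf.
have := fundamental3 (openO hO) Ooo (scalL2D mO L1 L2) => h.
have {h} : {ae leb3 R, forall x, Omega x -> partial (leb1 R) I theta w x +
    partial (leb1 R) I (fun t : R => 'D_(1 : R) theta t) f x = 0}.
  apply: h => psi tp; have Lp := test_scalL2 tp.
  under eq_Rintegral do rewrite mulrDl.
  rewrite RintegralD//; [|exact: scalL2M_int|exact: scalL2M_int].
  rewrite -(partial_pairing mO mI Ooo Ioo mt tM)//.
  rewrite -(partial_pairing mO mI Ooo Ioo mt' tM')//.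
  by apply/eqP; rewrite addr_eq0; apply/eqP; exact: (periodic_ibp tp st th).
by apply: ae_mono => x h Ox; apply/eqP; rewrite -addr_eq0; apply/eqP; exact: h.
Qed.

End component.
End time_derivative.

(** * Fourier coefficients of fields *)

Section fourier_fields.
Context {R : realType}.
Variables (Omega : set (point3 R)) (T : R).
Hypotheses (hO : bounded_lipschitz_domain Omega) (T0 : 0 < T).
Let I : set (point1 R) := `]0, T[%classic.
Let mI : measurable I := I_measurable T.
Let mO : measurable Omega := Omega_measurable hO.
Let Ooo : (leb3 R Omega < +oo)%E := Omega_finite hO.
Let Ioo : (leb1 R I < +oo)%E := I_finite T.
Let mQ : measurable (Q Omega T) := Q_measurable T hO.
Let mu : {measure set (point4 R) -> \bar R} := leb4 R.
Let mu3 : {measure set (point3 R) -> \bar R} := leb3 R.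
Local Notation Q := (Q Omega T).
Local Notation fc f j := (fcoef (leb1 R) I (trig T) (trig_norm T) f j).
Implicit Types u v : vfield R (point4 R).

Lemma coef0E v i : Defs.coef0 T v i = fc (v i) 0.
Proof.
apply/funext => x; rewrite /Defs.coef0 /fcoef /trig_norm eqxx /partial; congr (_ * _).
by apply: eq_Rintegral => t _; rewrite /trig /= !mul0r cos0 mulr1.
Qed.

(** At frequency [k.+1] the factor 2 / T is the inverse of [trig_norm]. At frequency 0 it would be
    twice the inverse, which is why the mean value is kept apart as [coef0]. *)
Lemma coefcE v k i : coefc T v k.+1 i = fc (v i) k.+1.*2.
Proof.
apply/funext => x; rewrite /coefc /fcoef /trig_norm /= invf_div; congr (_ * _).
by apply: eq_Rintegral => t _; rewrite /trig odd_double/= doubleK.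
Qed.

Lemma coefsE v k i : coefs T v k.+1 i = fc (v i) k.*2.+1.
Proof.
apply/funext => x; rewrite /coefs /fcoef /trig_norm /= invf_div; congr (_ * _).
by apply: eq_Rintegral => t _; rewrite /trig /= odd_double/= uphalf_double.
Qed.

Lemma trig_bound j (t : point1 R) : I t -> `|trig T j t| <= 1.
Proof. by move=> _; exact: trig_le1. Qed.

Lemma fc_scalL2 f j : scalL2 mu Q f -> scalL2 mu3 Omega (fc f j).
Proof.
apply: (fcoef_scalL2 mO mI Ooo Ioo (M := 1)); first by move=> k; exact: trig_measurable.
exact: trig_bound.
Qed.

Lemma coef0_L2 v : L2 mu Q v -> L2 mu3 Omega (Defs.coef0 T v).
Proof. by move=> Lv i; rewrite coef0E; exact: fc_scalL2. Qed.

Lemma coefc_L2 v k : L2 mu Q v -> L2 mu3 Omega (coefc T v k.+1).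
Proof. by move=> Lv i; rewrite coefcE; exact: fc_scalL2. Qed.

Lemma coefs_L2 v k : L2 mu Q v -> L2 mu3 Omega (coefs T v k.+1).
Proof. by move=> Lv i; rewrite coefsE; exact: fc_scalL2. Qed.

(** Index 2k carries the cosine and index 2k - 1, written [k.-1.*2.+1], the sine of frequency k;
    index 0 is the constant. *)
Lemma sum_pairs (F : nat -> R) n :
  \sum_(j < n.*2.+1) F j = F 0%N + \sum_(1 <= k < n.+1) (F k.*2 + F k.-1.*2.+1).
Proof.
elim: n => [|n ih]; first by rewrite big_ord1 big_geq ?addr0.
rewrite doubleS 2!big_ord_recr/= ih [in RHS]big_nat_recr//= -!addrA.
by congr (_ + (_ + _)); rewrite addrC.
Qed.

Definition fourier_form n u v : R := T * ip mu3 Omega (Defs.coef0 T u) (Defs.coef0 T v) +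
  T / 2 * \sum_(1 <= k < n) pip mu3 Omega (coef T u k) (coef T v k).

Lemma fourier_formE n u v : L2 mu Q u -> L2 mu Q v ->
  fourier_form n.+1 u v = \sum_(i < 3) \sum_(j < n.*2.+1)
    trig_norm T j * \int[mu3]_(x in Omega) (fc (u i) j x * fc (v i) j x).
Proof.
move=> Lu Lv.
pose F i j := trig_norm T j * \int[mu3]_(x in Omega) (fc (u i) j x * fc (v i) j x).
rewrite -[RHS]/(\sum_(i < 3) \sum_(j < n.*2.+1) F i j).
under [RHS]eq_bigr do rewrite sum_pairs.
rewrite big_split/= /fourier_form; congr (_ + _).
  rewrite ipE//; [|exact: coef0_L2|exact: coef0_L2].
  by rewrite mulr_sumr; apply: eq_bigr => i _; rewrite !coef0E.
rewrite exchange_big/= mulr_sumr; apply: eq_big_nat => -[//|k] _.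
rewrite /pip /coef/= (ipE mO (coefc_L2 k Lu) (coefc_L2 k Lv)).
rewrite (ipE mO (coefs_L2 k Lu) (coefs_L2 k Lv)) mulrDr !mulr_sumr -big_split/=; apply: eq_bigr => i _.
by rewrite !coefcE !coefsE.
Qed.

Lemma fourier_parseval u v : L2 mu Q u -> L2 mu Q v ->
  fourier_form n u v @[n --> \oo] --> ip mu Q u v.
Proof.
move=> Lu Lv.
suff h : (fun n => fourier_form n.+1 u v) @ \oo --> ip mu Q u v.
  by rewrite -(cvg_shiftS (fun n => fourier_form n u v)); exact: h.
have lim i : \sum_(j < n.*2.+1) trig_norm T j *
    \int[mu3]_(x in Omega) (fc (u i) j x * fc (v i) j x) @[n --> \oo] -->
    \int[mu]_(z in Q) (u i z * v i z).
  have h := parseval mO mI Ooo Ioo (M := 1) (@trig_measurable R T)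
    (fun j t It => trig_bound j It) (trig_norm_gt0 T0) (trig_orthogonal T0)
    (trig_complete hO T0) (Lu i) (Lv i).
  (* Sine and cosine of a common frequency enter together, so only partial sums of odd length occur,
     a subsequence of those in [parseval]. *)
  have d : (fun n : nat => n.*2.+1) @ \oo --> \oo.
    apply/cvgnyPge => A; exists A => // n /= An; apply: leq_trans An _.
    by rewrite -addnn -addnS leq_addr.
  exact: (cvg_comp _ _ d h).
rewrite (_ : (fun n => _) = fun n => \sum_(i < 3) \sum_(j < n.*2.+1)
    trig_norm T j * \int[mu3]_(x in Omega) (fc (u i) j x * fc (v i) j x)); last first.
  by apply/funext => n; rewrite fourier_formE.
under eq_fun do rewrite sum3.
by rewrite (ipE mQ Lu Lv) sum3; apply: cvgD; [apply: cvgD|].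
Qed.

Lemma fourier_form_le n v : L2 mu Q v -> fourier_form n v v <= nrm2 mu Q v.
Proof.
move=> Lv; have h := fourier_parseval Lv Lv.
rewrite /nrm2 -(cvg_lim _ h)//; apply: nondecreasing_cvgn_le; last by apply/cvg_ex; exists (ip mu Q v v).
apply/nondecreasing_seqP => -[|m].
  by rewrite /fourier_form !big_geq.
rewrite /fourier_form [in leRHS]big_nat_recr//= lerD2l ler_wpM2l ?divr_ge0 ?(ltW T0)// lerDl.
by apply: addr_ge0; exact: nrm2_ge0.
Qed.

End fourier_fields.

Section nonnegative_series.
Context {R : realType}.
Implicit Types a b h : nat -> R.

Lemma ereal_series_bound a : (forall k, 0 <= a k) ->
  (\sum_(1 <= k <oo) (a k)%:E < +oo)%E ->
  forall n, \sum_(1 <= k < n) a k <= fine (\sum_(1 <= k <oo) (a k)%:E)%E.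
Proof.
move=> a0 aoo n; have a0' k : (0 <= (a k)%:E)%E by rewrite lee_fin.
have s0 : (0 <= \sum_(1 <= k <oo) (a k)%:E)%E by apply: nneseries_ge0.
rewrite -lee_fin fineK ?ge0_fin_numE// -sumEFin.
by apply: nneseries_lim_ge => k _ _.
Qed.

Lemma ereal_series_le a C : (forall k, 0 <= a k) ->
  (forall n, \sum_(1 <= k < n) a k <= C) -> (\sum_(1 <= k <oo) (a k)%:E <= C%:E)%E.
Proof.
move=> a0 aC; apply: lime_le.
  by apply: is_cvg_nneseries => k _ _; rewrite lee_fin.
by apply: nearW => n; rewrite sumEFin lee_fin.
Qed.

Lemma ge0_series_cvg a C : (forall k, 0 <= a k) -> (forall n, \sum_(1 <= k < n) a k <= C) ->
  cvgn (fun n => \sum_(1 <= k < n) a k).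
Proof.
move=> a0 aC; apply: nondecreasing_is_cvgn; last first.
  by exists C => _ [n _ <-].
apply/nondecreasing_seqP => -[|n]; first by rewrite !big_geq.
by rewrite [leRHS]big_nat_recr//= lerDl.
Qed.

(** Both [h + a] and [a] have nonnegative terms and bounded partial sums, and [h] is their
    difference. *)
Lemma dominated_series_cvg h a C : (forall k, `|h k| <= a k) ->
  (forall n, \sum_(1 <= k < n) a k <= C) -> cvgn (fun n => \sum_(1 <= k < n) h k).
Proof.
move=> ha aC; have a0 k : 0 <= a k := le_trans (normr_ge0 _) (ha k).
have c1 := ge0_series_cvg a0 aC.
have ha' k : - a k <= h k <= a k by rewrite -ler_norml.
have ha0 k : 0 <= h k + a k by have /andP[h1 _] := ha' k; rewrite -lerBlDr sub0r.
have c2 : cvgn (fun n => \sum_(1 <= k < n) (h k + a k)).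
  apply: (@ge0_series_cvg _ (C + C)) => // n.
  apply: (@le_trans _ _ (\sum_(1 <= k < n) (a k + a k))).
    by apply: ler_sum => k _; rewrite lerD2r; case/andP: (ha' k).
  by rewrite big_split/= lerD.
have -> : (fun n => \sum_(1 <= k < n) h k) =
    fun n => \sum_(1 <= k < n) (h k + a k) - \sum_(1 <= k < n) a k.
  by apply/funext => n; rewrite -sumrB; apply: eq_bigr => k _; rewrite addrK.
exact: is_cvgB.
Qed.

Lemma zero_weight_le (S b c d e : R) :
  `|0%:R * b * c| <= 2^-1 * (S * (0%:R * b * d) + 0%:R * b * e).
Proof. by rewrite !mul0r mulr0 addr0 mulr0 normr0. Qed.

Lemma mean_le (S a b c d e f : R) : f <= S * e -> d <= S * b ->
  2^-1 * (d + a) + 2^-1 * (f + c) <= 2^-1 * (S * (e + b) + (a + c)).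
Proof. by move=> h1 h2; lra. Qed.

Lemma sum_le_combination a b h C C' n :
  (forall k, h k.+1 <= 2 * a k.+1 + 2 * b k.+1) ->
  \sum_(1 <= k < n) a k <= C -> \sum_(1 <= k < n) b k <= C' ->
  \sum_(1 <= k < n) h k <= 2 * C + 2 * C'.
Proof.
move=> hab aC bC; apply: (@le_trans _ _ (\sum_(1 <= k < n) (2 * a k + 2 * b k))).
  by rewrite big_nat [leRHS]big_nat; apply: ler_sum => -[//|k] _.
by rewrite big_split/= -!mulr_sumr lerD// ler_pM2l.
Qed.

Lemma weighted_le (a b c d e f g : R) : 0 <= a -> b <= 2 * c + 2 * d -> e <= 2 * f + 2 * g ->
  a * (b + e) <= 2 * (a * (c + f)) + 2 * (a * (d + g)).
Proof.
move=> a0 h1 h2; rewrite !(mulrCA 2 a) -mulrDr ler_wpM2l//.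
by apply: le_trans (lerD h1 h2) _; rewrite !mulrDr addrACA.
Qed.

End nonnegative_series.

(** * Convergence and additivity of the half-order form *)

Section half_order_form.
Context {R : realType}.
Variables (Omega : set (point3 R)) (T : R).
Hypotheses (hO : bounded_lipschitz_domain Omega) (T0 : 0 < T).
Let I : set (point1 R) := `]0, T[%classic.
Let mI : measurable I := I_measurable T.
Let mO : measurable Omega := Omega_measurable hO.
Let Ooo : (leb3 R Omega < +oo)%E := Omega_finite hO.
Let Ioo : (leb1 R I < +oo)%E := I_finite T.
Let mQ : measurable (Q Omega T) := Q_measurable T hO.
Let mu : {measure set (point4 R) -> \bar R} := leb4 R.
Let mu3 : {measure set (point3 R) -> \bar R} := leb3 R.
Local Notation Q := (Q Omega T).
Local Notation fc f j := (fcoef (leb1 R) I (trig T) (trig_norm T) f j).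
Local Notation w := (omega T).
Implicit Types u v y eta : vfield R (point4 R).

Lemma slice_weight_intble (f : point4 R -> R) (b : R -> R) : scalL2 mu Q f -> smooth b ->
  {ae mu3, forall x, Omega x -> (leb1 R).-integrable I (EFin \o (fun t => f (x, t) * b t))}.
Proof.
move=> Lf sb; have [M mb bM] := smooth_weight T0 sb.
have L := weight_mul mO mI mb bM Lf.
exact: (integrable_section1 mO mI (scalL2_int mQ (Q_finite T hO) L)).
Qed.

Lemma coefc_sub u v k i : L2 mu Q u -> L2 mu Q v -> {ae mu3, forall x, Omega x ->
  coefc T (fun i z => u i z - v i z) k.+1 i x = coefc T u k.+1 i x - coefc T v k.+1 i x}.
Proof.
move=> Lu Lv; have sc := smooth_line (k.+1%:R * w) (@smooth_cos R).
have := slice_weight_intble (Lv i) sc; have := slice_weight_intble (Lu i) sc.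
apply: filterS2 => x hu hv Ox; rewrite /coefc -mulrBr; congr (_ * _).
rewrite -RintegralB//; [|exact: hu|exact: hv].
by apply: eq_Rintegral => t _; rewrite mulrBl.
Qed.

Lemma coefs_sub u v k i : L2 mu Q u -> L2 mu Q v -> {ae mu3, forall x, Omega x ->
  coefs T (fun i z => u i z - v i z) k.+1 i x = coefs T u k.+1 i x - coefs T v k.+1 i x}.
Proof.
move=> Lu Lv; have sc := smooth_line (k.+1%:R * w) (@smooth_sin R).
have := slice_weight_intble (Lv i) sc; have := slice_weight_intble (Lu i) sc.
apply: filterS2 => x hu hv Ox; rewrite /coefs -mulrBr; congr (_ * _).
rewrite -RintegralB//; [|exact: hu|exact: hv].
by apply: eq_Rintegral => t _; rewrite mulrBl.
Qed.

Lemma pnrm2_coef_ge0 v k : 0 <= pnrm2 mu3 Omega (coef T v k).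
Proof. by apply: addr_ge0; exact: nrm2_ge0. Qed.

Definition half_bounded v := exists C : R, forall n,
  \sum_(1 <= k < n) k%:R * w * pnrm2 mu3 Omega (coef T v k) <= C.

Let kw k : 0 <= k%:R * w. Proof. by rewrite mulr_ge0// ltW// omega_gt0. Qed.

Let T20 : 0 < T / 2. Proof. by rewrite divr_gt0. Qed.

Lemma half_nrm2P v : (half_nrm2 Omega T v < +oo)%E <-> half_bounded v.
Proof.
have a0 k : 0 <= k%:R * w * pnrm2 mu3 Omega (coef T v k) by rewrite mulr_ge0// pnrm2_coef_ge0.
have s0 : (0 <= \sum_(1 <= k <oo) (k%:R * w * pnrm2 mu3 Omega (coef T v k))%:E)%E.
  by apply: nneseries_ge0 => k _ _; rewrite lee_fin.
split.
  rewrite /half_nrm2 => h.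
  exists (fine (\sum_(1 <= k <oo) (k%:R * w * pnrm2 mu3 Omega (coef T v k))%:E)%E).
  apply: ereal_series_bound => //.
  move: h s0; case: (limn _) => //= [r _ _|]; first exact: ltry.
  by rewrite gt0_muley ?lte_fin// ltxx.
move=> [C hC]; rewrite /half_nrm2.
apply: (@le_lt_trans _ _ ((T / 2)%:E * C%:E)%E); last exact: ltry.
by rewrite lee_pmul2l ?lte_fin//; exact: ereal_series_le.
Qed.

Lemma half_bounded_sub u v : L2 mu Q u -> L2 mu Q v -> half_bounded u -> half_bounded v ->
  half_bounded (fun i z => u i z - v i z).
Proof.
move=> Lu Lv [C hC] [C' hC']; exists (2 * C + 2 * C') => n.
have Luv := L2_sub mQ Lu Lv.
apply: sum_le_combination (hC n) (hC' n) => k.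
have Lc := coefc_L2 hO k Lu; have Lc' := coefc_L2 hO k Lv.
have Ls := coefs_L2 hO k Lu; have Ls' := coefs_L2 hO k Lv.
have Ec := nrm2_ae mO (coefc_L2 hO k Luv) (L2_sub mO Lc Lc') (fun i => coefc_sub k i Lu Lv).
have Es := nrm2_ae mO (coefs_L2 hO k Luv) (L2_sub mO Ls Ls') (fun i => coefs_sub k i Lu Lv).
have h1 := nrm2_sub_le mO Lc Lc'; have h2 := nrm2_sub_le mO Ls Ls'.
by rewrite -Ec in h1; rewrite -Es in h2; exact: (weighted_le (kw k.+1) h1 h2).
Qed.

Section weight.
Variables (s : point3 R -> R) (S : R).
Hypotheses (ms : measurable_fun Omega s) (sS : forall x, Omega x -> `|s x| <= S).

Lemma wmul3_L2 (a : vfield R (point3 R)) : L2 mu3 Omega a ->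
  L2 mu3 Omega (fun i x => s x * a i x).
Proof. by move=> La i; exact: (scalL2_bnd mO ms sS). Qed.

Lemma wmul_L2 v : L2 mu Q v -> L2 mu Q (wmul s v).
Proof.
move=> Lv i; apply: (scalL2_bnd mQ (M := S)) => //; last by move=> z [Oz _]; exact: sS.
apply: (measurable_comp mO) => //; first by move=> _ [z [Oz _] <-].
exact: measurable_funTS measurable_fst.
Qed.

Definition half_term y v k : R := k%:R * w * pip mu3 Omega
  ((fun i x => s x * coefc T y k i x), (fun i x => s x * coefs T y k i x))
  (perp (coef T v k)).

Lemma half_formE y v : half_form Omega T s y v =
  T / 2 * limn (fun n => \sum_(1 <= k < n) half_term y v k).
Proof. by []. Qed.

Lemma half_termE y v k : L2 mu Q y -> L2 mu Q v -> half_term y v k.+1 = k.+1%:R * w *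
  (ip mu3 Omega (fun i x => s x * coefs T y k.+1 i x) (coefc T v k.+1) -
   ip mu3 Omega (fun i x => s x * coefc T y k.+1 i x) (coefs T v k.+1)).
Proof.
move=> Ly Lv; rewrite /half_term /pip /perp /coef/=; congr (_ * _).
have Lc := wmul3_L2 (coefc_L2 hO k Ly); have Ls := coefs_L2 hO k Lv.
have -> : (fun i x => - coefs T v k.+1 i x) = fun i x => -1 * coefs T v k.+1 i x.
  by apply/funext => i; apply/funext => x; rewrite mulN1r.
by rewrite ip_comm (ip_scalel mO (-1) Ls Lc) mulN1r ip_comm addrC.
Qed.

Lemma wmul3_nrm2_le (a : vfield R (point3 R)) : L2 mu3 Omega a ->
  nrm2 mu3 Omega (fun i x => s x * a i x) <= S ^+ 2 * nrm2 mu3 Omega a.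
Proof.
move=> La; have Ls := wmul3_L2 La; rewrite -nrm2_scale//.
have Lc := L2_scale mO S La.
apply: le_Rintegral => //.
- by apply: intble_sum => // i; exact: (L2_prod mO i Ls Ls).
- by apply: intble_sum => // i; exact: (L2_prod mO i Lc Lc).
- move=> x Ox; apply: ler_sum => i _; rewrite -!expr2 !exprMn ler_wpM2r ?sqr_ge0//.
  rewrite -(real_normK (num_real (s x))) ler_pXn2r ?nnegrE ?sS//.
  exact: le_trans (sS Ox).
Qed.

(** Termwise domination by the half-order energies makes the series of [half_form] absolutely
    convergent, so that its [limn] is a genuine limit. At k = 0 the weight vanishes, which settles
    the index left out by [coefc_L2] and [coefs_L2]. *)
Lemma half_term_le y v k : L2 mu Q y -> L2 mu Q v -> `|half_term y v k| <=
  2^-1 * (S ^+ 2 * (k%:R * w * pnrm2 mu3 Omega (coef T y k)) +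
          k%:R * w * pnrm2 mu3 Omega (coef T v k)).
Proof.
case: k => [|k] Ly Lv.
  exact: zero_weight_le.
rewrite half_termE// normrM (ger0_norm (kw k.+1)).
have Lyc := coefc_L2 hO k Ly; have Lys := coefs_L2 hO k Ly.
have Lvc := coefc_L2 hO k Lv; have Lvs := coefs_L2 hO k Lv.
have h1 := ip_le_nrm2 mO (wmul3_L2 Lys) Lvc; have h2 := ip_le_nrm2 mO (wmul3_L2 Lyc) Lvs.
have h3 := wmul3_nrm2_le Lyc; have h4 := wmul3_nrm2_le Lys.
have E (a b c d : R) : 2^-1 * (c * (a * b) + a * d) = a * (2^-1 * (c * b + d)) by ring.
rewrite E ler_wpM2l// (le_trans (ler_normB _ _))// (le_trans (lerD h1 h2))//.
rewrite /pnrm2 /pip /coef/= -!/(nrm2 _ _ _).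
exact: mean_le h3 h4.
Qed.

Lemma half_form_cvg y v : L2 mu Q y -> L2 mu Q v -> half_bounded y -> half_bounded v ->
  cvgn (fun n => \sum_(1 <= k < n) half_term y v k).
Proof.
move=> Ly Lv [C hC] [C' hC'].
apply: (dominated_series_cvg (C := 2^-1 * (S ^+ 2 * C + C'))) => [k|n].
  exact: half_term_le.
rewrite -mulr_sumr big_split/= -mulr_sumr; apply: ler_wpM2l; first by rewrite invr_ge0.
by apply: lerD; [apply: ler_wpM2l; [exact: sqr_ge0|exact: hC]|exact: hC'].
Qed.

(** [limn] respects subtraction for convergent sequences; the bounded half-order energies supply the
    convergence. *)
Lemma half_form_sub y eta v : L2 mu Q y -> L2 mu Q eta -> L2 mu Q v ->
  half_bounded y -> half_bounded eta -> half_bounded v ->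
  half_form Omega T s (fun i z => y i z - eta i z) v =
  half_form Omega T s y v - half_form Omega T s eta v.
Proof.
move=> Ly Le Lv by_ be bv; have Lye := L2_sub mQ Ly Le.
have c1 := half_form_cvg Ly Lv by_ bv; have c2 := half_form_cvg Le Lv be bv.
suff E n : \sum_(1 <= k < n) half_term (fun i z => y i z - eta i z) v k =
    \sum_(1 <= k < n) half_term y v k - \sum_(1 <= k < n) half_term eta v k.
  rewrite !half_formE -mulrBr; congr (_ * _); apply/cvg_lim => //.
  apply: cvg_trans (cvgB c1 c2); apply: near_eq_cvg; apply: nearW => n.
  exact: esym (E n).
rewrite -sumrB; apply: eq_big_nat => -[//|k] _.
rewrite !half_termE// -mulrBr; congr (_ * _).
have Lvc := coefc_L2 hO k Lv; have Lvs := coefs_L2 hO k Lv.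
have E (b b' b'' : vfield R (point3 R)) (c : vfield R (point3 R)) :
    L2 mu3 Omega b -> L2 mu3 Omega b' -> L2 mu3 Omega b'' -> L2 mu3 Omega c ->
    (forall i, {ae mu3, forall x, Omega x -> b i x = b' i x - b'' i x}) ->
    ip mu3 Omega (fun i x => s x * b i x) c =
    ip mu3 Omega (fun i x => s x * b' i x) c - ip mu3 Omega (fun i x => s x * b'' i x) c.
  move=> Lb Lb' Lb'' Lc h; rewrite -ip_subl//; try exact: wmul3_L2.
  apply: ip_ae => //; first exact: wmul3_L2.
    by apply: L2_sub => //; exact: wmul3_L2.
  by move=> i; apply: ae_mono (h i) => x hx Ox; rewrite hx// mulrBr.
rewrite (E _ _ _ _ (coefs_L2 hO k Lye) (coefs_L2 hO k Ly) (coefs_L2 hO k Le) Lvc); last first.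
  by move=> i; exact: coefs_sub.
rewrite (E _ _ _ _ (coefc_L2 hO k Lye) (coefc_L2 hO k Ly) (coefc_L2 hO k Le) Lvs); last first.
  by move=> i; exact: coefc_sub.
by move: (ip _ _ _ _) (ip _ _ _ _) (ip _ _ _ _) (ip _ _ _ _) => a b c d; ring.
Qed.

End weight.
End half_order_form.

Section real_estimates.
Context {R : realType}.

Lemma frequency_le (k : nat) (w P : R) : 0 < w -> 0 <= P ->
  k.+1%:R * w * P <= w^-1 * ((k.+1%:R * w) ^+ 2 * P).
Proof.
move=> w0 P0.
have -> : w^-1 * ((k.+1%:R * w) ^+ 2 * P) = k.+1%:R * (k.+1%:R * w * P).
  by field; rewrite gt_eqF.
by rewrite ler_peMl ?ler1n// !mulr_ge0// ltW.
Qed.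

Lemma half_period_le (T a s b : R) : 0 < T -> 0 <= a -> T * a + T / 2 * s <= b ->
  s <= 2 / T * b.
Proof.
move=> T0 a0 h; rewrite mulrAC ler_pdivlMr//.
have : 0 <= T * a by rewrite mulr_ge0// ltW.
by move: h; lra.
Qed.

Lemma sum_le_scale (a b : nat -> R) c C n : 0 <= c -> (forall k, a k.+1 <= c * b k.+1) ->
  \sum_(1 <= k < n) b k <= C -> \sum_(1 <= k < n) a k <= c * C.
Proof.
move=> c0 ab bC; apply: le_trans (ler_wpM2l c0 bC).
by rewrite mulr_sumr big_nat [leRHS]big_nat; apply: ler_sum => -[//|k] _.
Qed.

End real_estimates.

Section periodic_fields.
Context {R : realType}.
Variables (Omega : set (point3 R)) (T : R).
Hypotheses (hO : bounded_lipschitz_domain Omega) (T0 : 0 < T).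
Let I : set (point1 R) := `]0, T[%classic.
Let mI : measurable I := I_measurable T.
Let mO : measurable Omega := Omega_measurable hO.
Let Ooo : (leb3 R Omega < +oo)%E := Omega_finite hO.
Let Ioo : (leb1 R I < +oo)%E := I_finite T.
Let mQ : measurable (Q Omega T) := Q_measurable T hO.
Let mu : {measure set (point4 R) -> \bar R} := leb4 R.
Let mu3 : {measure set (point3 R) -> \bar R} := leb3 R.
Local Notation Q := (Q Omega T).
Local Notation w := (omega T).
Implicit Types u v y eta : vfield R (point4 R).

Lemma is_dt_component eta d i phi : is_dt Omega T eta d -> test_function Q phi ->
  \int[mu]_(z in Q) (d i z * phi z) = - \int[mu]_(z in Q) (eta i z * 'D_et phi z).
Proof.
move=> [_ h] tphi.
have sphi := smooth_derivable (x := _) (u := et) tphi.1.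
pose psi : vfield R (point4 R) := fun j z => (j == i)%:R * phi z.
have tpsi j : test_function Q (psi j) by exact: test_functionZ.
have := h psi tpsi; rewrite ip_component => ->; congr (- _).
rewrite -ip_component; congr (ip _ _ _ _); apply/funext => j; apply/funext => z.
by rewrite /psi derive_mulr.
Qed.

Lemma Hcurl1_dt eta : Hcurl1_0per Omega T eta -> is_dt Omega T eta (dt Omega T eta).
Proof. by move=> [_ [d h] _ _]; exact: (xgetPex _ (ex_intro _ d h)). Qed.

Lemma Hcurl1_partial eta i theta : Hcurl1_0per Omega T eta -> smooth theta ->
  theta 0 = theta T -> {ae mu3, forall x, Omega x ->
    partial (leb1 R) I theta (dt Omega T eta i) x =
    - partial (leb1 R) I (fun t : R => 'D_(1 : R) theta t) (eta i) x}.
Proof.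
move=> he st th; have hd := Hcurl1_dt he; have [[Le _] _ _ [u [ue Lu cu pu]]] := he.
apply: (periodic_partial hO T0 (u := u i)) => //.
- by case: hd.
- by move=> phi; exact: is_dt_component.
- by apply: ae_mono ue => z h Qz; exact: h.
- by move=> t tT; apply: Lu; rewrite in_itv.
- move=> t tT eps e0; have tI : t \in `[0, T] by rewrite in_itv.
  have [d d0 hdl] := cu t tI eps e0; exists d => // s sT sd.
  have sI : s \in `[0, T] by rewrite in_itv.
  apply: le_lt_trans (hdl s sI sd).
  exact: (component_le_nrm2 mO i (L2_sub mO (Lu s sI) (Lu t tI))).
- by apply: ae_mono pu => x h Ox; exact: h.
Qed.

Let cosT k : cos (k%:R * w * 0) = cos (k%:R * w * T) :> R.
Proof. by rewrite mulr0 cos0 -mulrA omegaT// cos_turn. Qed.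

Let sinT k : sin (k%:R * w * 0) = sin (k%:R * w * T) :> R.
Proof. by rewrite mulr0 sin0 -mulrA omegaT// sin_turn. Qed.

Lemma dt_coef0 eta i : Hcurl1_0per Omega T eta ->
  {ae mu3, forall x, Omega x -> Defs.coef0 T (dt Omega T eta) i x = 0}.
Proof.
move=> he; have := Hcurl1_partial i he (@smooth_cst _ R 1) erefl.
apply: ae_mono => x h Ox; have := h Ox; rewrite /partial /Defs.coef0.
under eq_Rintegral do rewrite mulr1.
move=> ->; under eq_Rintegral do rewrite derive_cst mulr0.
by rewrite Rintegral_cst// mul0r oppr0 mulr0.
Qed.

Lemma dt_coefc eta k i : Hcurl1_0per Omega T eta -> {ae mu3, forall x, Omega x ->
  coefc T (dt Omega T eta) k i x = k%:R * w * coefs T eta k i x}.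
Proof.
move=> he; have sc := smooth_line (k%:R * w) (@smooth_cos R).
have ss := smooth_line (k%:R * w) (@smooth_sin R).
have Le : scalL2 mu Q (eta i) by case: he => -[].
have := Hcurl1_partial i he sc (cosT k); have := slice_weight_intble hO T0 Le ss.
apply: filterS2 => x hs h Ox; have := h Ox; rewrite /partial /coefc => ->.
transitivity (2 / T * - \int[leb1 R]_(t in I)
    (- (k%:R * w) * (eta i (x, t) * sin (k%:R * w * t)))).
  congr (_ * - _); apply: eq_Rintegral => t _.
  by rewrite derive_cos_line mulrN mulNr mulrCA.
rewrite RintegralZl//; last exact: hs.
by rewrite mulNr opprK /coefs mulrCA.
Qed.

Lemma dt_coefs eta k i : Hcurl1_0per Omega T eta -> {ae mu3, forall x, Omega x ->
  coefs T (dt Omega T eta) k i x = - (k%:R * w) * coefc T eta k i x}.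
Proof.
move=> he; have sc := smooth_line (k%:R * w) (@smooth_cos R).
have ss := smooth_line (k%:R * w) (@smooth_sin R).
have Le : scalL2 mu Q (eta i) by case: he => -[].
have := Hcurl1_partial i he ss (sinT k); have := slice_weight_intble hO T0 Le sc.
apply: filterS2 => x hs h Ox; have := h Ox; rewrite /partial /coefs => ->.
transitivity (2 / T * - \int[leb1 R]_(t in I)
    (k%:R * w * (eta i (x, t) * cos (k%:R * w * t)))).
  by congr (_ * - _); apply: eq_Rintegral => t _; rewrite derive_sin_line mulrCA.
rewrite RintegralZl//; last exact: hs.
by rewrite /coefc -mulNr mulrCA.
Qed.

Lemma Hcurl1_L2 eta : Hcurl1_0per Omega T eta -> L2 mu Q eta.
Proof. by case=> -[]. Qed.

Lemma dt_L2 eta : Hcurl1_0per Omega T eta -> L2 mu Q (dt Omega T eta).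
Proof. by move=> /Hcurl1_dt[]. Qed.

Lemma dt_pnrm2 eta k : Hcurl1_0per Omega T eta ->
  pnrm2 mu3 Omega (coef T (dt Omega T eta) k.+1) =
  (k.+1%:R * w) ^+ 2 * pnrm2 mu3 Omega (coef T eta k.+1).
Proof.
move=> he; have Ld := dt_L2 he; have Le := Hcurl1_L2 he.
have Lc := coefc_L2 hO k Le; have Ls := coefs_L2 hO k Le.
have Ec := nrm2_ae mO (coefc_L2 hO k Ld) (L2_scale mO (k.+1%:R * w) Ls)
  (fun i => dt_coefc k.+1 i he).
have Es := nrm2_ae mO (coefs_L2 hO k Ld) (L2_scale mO (- (k.+1%:R * w)) Lc)
  (fun i => dt_coefs k.+1 i he).
rewrite (nrm2_scale mO _ Ls) in Ec; rewrite (nrm2_scale mO _ Lc) sqrrN in Es.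
transitivity (nrm2 mu3 Omega (coefc T (dt Omega T eta) k.+1) +
  nrm2 mu3 Omega (coefs T (dt Omega T eta) k.+1)); first by [].
by rewrite Ec Es -mulrDr addrC.
Qed.

Lemma fourier_sum_le v n : L2 mu Q v ->
  \sum_(1 <= k < n) pnrm2 mu3 Omega (coef T v k) <= 2 / T * nrm2 mu Q v.
Proof.
move=> Lv; have h := fourier_form_le hO T0 n Lv.
exact: (half_period_le T0 (nrm2_ge0 mu3 Omega (Defs.coef0 T v)) h).
Qed.

(** For k >= 1, k w is at most w^-1 (k w)^2, and (k w)^2 times the k-th energy of [eta] is that of
    its time derivative, summable by Bessel's inequality. *)
Lemma Hcurl1_half_bounded eta : Hcurl1_0per Omega T eta -> half_bounded Omega T eta.
Proof.
move=> he; have Ld := dt_L2 he.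
exists (w^-1 * (2 / T * nrm2 mu Q (dt Omega T eta))) => n.
have w0 : 0 <= w^-1 by rewrite invr_ge0 ltW// omega_gt0.
apply: sum_le_scale w0 _ (fourier_sum_le n Ld) => k.
have := frequency_le k (omega_gt0 T0) (pnrm2_coef_ge0 Omega T eta k.+1).
by rewrite -(dt_pnrm2 k he).
Qed.

Section weight.
Variables (s : point3 R -> R) (S : R).
Hypotheses (ms : measurable_fun Omega s) (sS : forall x, Omega x -> `|s x| <= S).

Lemma partial_wmul (f : point4 R -> R) (b : R -> R) c : scalL2 mu Q f -> smooth b ->
  {ae mu3, forall x, Omega x -> c * \int[leb1 R]_(t in I) (s x * f (x, t) * b t) =
    s x * (c * \int[leb1 R]_(t in I) (f (x, t) * b t))}.
Proof.
move=> Lf sb; have := slice_weight_intble hO T0 Lf sb; apply: ae_mono => x h Ox.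
under eq_Rintegral do rewrite -mulrA.
by rewrite RintegralZl; [exact: mulrCA|exact: mI|exact: h].
Qed.

(** The weight depends on space only, so it commutes with time coefficients for almost every x.
    Moving the rotation from the coefficients of [eta] to those of [v] turns the partial Parseval
    sums of the weighted time derivative and [v] into those of the half-order form. *)
Lemma half_form_dt eta v : Hcurl1_0per Omega T eta -> L2 mu Q v ->
  half_form Omega T s eta v = ip mu Q (wmul s (dt Omega T eta)) v.
Proof.
move=> he Lv; have Ld := dt_L2 he; have Le := Hcurl1_L2 he.
set d := dt Omega T eta in Ld *.
have Lsd := wmul_L2 hO (S := S) ms sS Ld.
(* [half_form] starts at frequency 1, so the Parseval term of frequency 0 has to vanish; it does
   because the time derivative of a periodic field has mean zero. *)
have z0 : ip mu3 Omega (Defs.coef0 T (wmul s d)) (Defs.coef0 T v) = 0.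
  have L0 : L2 mu3 Omega (fun _ _ => 0 : R) by move=> i; exact: scalL2_0.
  rewrite (ip_ae mO (coef0_L2 hO Lsd) L0 (coef0_L2 hO Lv)).
    rewrite /ip (eq_Rintegral _ (g := fun=> 0)) ?Rintegral_cst ?mul0r//.
    by move=> x _; rewrite big1// => i _; rewrite mul0r.
  move=> i; have := partial_wmul T^-1 (Ld i) (@smooth_cst _ R 1).
  have := dt_coef0 i he; apply: filterS2 => x h0 h Ox.
  have E (g : point1 R -> R) :
      \int[leb1 R]_(t in I) (g t * cst (1 : R) t) = \int[leb1 R]_(t in I) g t.
    by apply: eq_Rintegral => t _; rewrite mulr1.
  have := h Ox; rewrite (E (fun t => s x * d i (x, t))) (E (fun t => d i (x, t))) => h1.
  transitivity (T^-1 * \int[leb1 R]_(t in I) (s x * d i (x, t))); first by [].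
  by rewrite h1 -[T^-1 * _]/(Defs.coef0 T d i x) h0// mulr0.
have pE k : pip mu3 Omega (coef T (wmul s d) k.+1) (coef T v k.+1) =
    half_term Omega T s eta v k.+1.
  have Lc := coefc_L2 hO k Le; have Ls := coefs_L2 hO k Le.
  have Lvc := coefc_L2 hO k Lv; have Lvs := coefs_L2 hO k Lv.
  have Lsc := wmul3_L2 hO ms sS Lc; have Lss := wmul3_L2 hO ms sS Ls.
  have Ec := ip_ae mO (coefc_L2 hO k Lsd) (L2_scale mO (k.+1%:R * w) Lss) Lvc.
  have Es := ip_ae mO (coefs_L2 hO k Lsd) (L2_scale mO (- (k.+1%:R * w)) Lsc) Lvs.
  rewrite (half_termE hO ms sS)// /pip /coef/=.
  rewrite Ec; last first.
    move=> i; have := partial_wmul (2 / T) (Ld i) (smooth_line (k.+1%:R * w) (@smooth_cos R)).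
    have := dt_coefc k.+1 i he; apply: filterS2 => x h0 h Ox.
    by rewrite /coefc /wmul h// -/(coefc T d k.+1 i x) h0// mulrCA.
  rewrite Es; last first.
    move=> i; have := partial_wmul (2 / T) (Ld i) (smooth_line (k.+1%:R * w) (@smooth_sin R)).
    have := dt_coefs k.+1 i he; apply: filterS2 => x h0 h Ox.
    by rewrite /coefs /wmul h// -/(coefs T d k.+1 i x) h0// mulrCA.
  by rewrite (ip_scalel mO _ Lss Lvc) (ip_scalel mO _ Lsc Lvs) mulNr mulrBr.
have FE n : fourier_form Omega T n (wmul s d) v =
    T / 2 * \sum_(1 <= k < n) half_term Omega T s eta v k.
  rewrite /fourier_form z0 mulr0 add0r; congr (_ * _).
  by apply: eq_big_nat => -[//|k] _; exact: pE.
have h := fourier_parseval hO T0 Lsd Lv.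
have T2 : T / 2 != 0 by rewrite gt_eqF// divr_gt0.
have h' : \sum_(1 <= k < n) half_term Omega T s eta v k @[n --> \oo] -->
    (T / 2)^-1 * ip mu Q (wmul s d) v.
  apply: cvg_trans (cvgM (cvg_cst (T / 2)^-1) h).
  apply: near_eq_cvg; apply: nearW => n; rewrite /= FE.
  exact: mulKf.
by rewrite half_formE (cvg_lim _ h')// mulVKf.
Qed.

End weight.
End periodic_fields.

(** * Curls of time coefficients and the energy norm *)

Section curl_coefficients.
Context {R : realType}.
Variables (Omega : set (point3 R)) (T : R).
Hypotheses (hO : bounded_lipschitz_domain Omega) (T0 : 0 < T).
Let I : set (point1 R) := `]0, T[%classic.
Let mI : measurable I := I_measurable T.
Let mO : measurable Omega := Omega_measurable hO.
Let Ooo : (leb3 R Omega < +oo)%E := Omega_finite hO.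
Let Ioo : (leb1 R I < +oo)%E := I_finite T.
Let mQ : measurable (Q Omega T) := Q_measurable T hO.
Let mu : {measure set (point4 R) -> \bar R} := leb4 R.
Let mu3 : {measure set (point3 R) -> \bar R} := leb3 R.
Local Notation Q := (Q Omega T).
Local Notation w := (omega T).
Implicit Types u v y eta : vfield R (point4 R).

Lemma is_curl3_unique (a b b' : vfield R (point3 R)) : is_curl3 Omega a b ->
  is_curl3 Omega a b' -> forall i, {ae mu3, forall x, Omega x -> b i x = b' i x}.
Proof.
move=> [Lb hb] [Lb' hb'] i.
suff h : {ae mu3, forall x, Omega x -> b i x - b' i x = 0}.
  by apply: ae_mono h => x h Ox; apply/eqP; rewrite -subr_eq0; apply/eqP; exact: h.
apply: (fundamental3 (openO hO) Ooo (scalL2B mO (Lb i) (Lb' i))) => phi tphi.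
pose psi : vfield R (point3 R) := fun j x => (j == i)%:R * phi x.
have tpsi j : test_function Omega (psi j) by exact: test_functionZ.
have Lphi := test_scalL2 hO tphi.
have := hb psi tpsi; rewrite -(hb' psi tpsi) !ip_component => bb'.
under eq_Rintegral do rewrite mulrBl.
rewrite RintegralB//.
- by rewrite -/mu3 bb' subrr.
- exact: (scalL2M_int mO (Lb i) Lphi).
- exact: (scalL2M_int mO (Lb' i) Lphi).
Qed.

(** [curl3] selects one of the weak curls; any two of them agree almost everywhere, so norms may be
    computed with the most convenient one. *)
Lemma nrm2_curl3 (a b : vfield R (point3 R)) : is_curl3 Omega a b ->
  nrm2 mu3 Omega (curl3 Omega a) = nrm2 mu3 Omega b.
Proof.
move=> ab; have cab : is_curl3 Omega a (curl3 Omega a) := xgetPex _ (ex_intro _ b ab).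
apply: nrm2_ae => //; first by case: cab.
  by case: ab.
exact: is_curl3_unique cab ab.
Qed.

Lemma derive_tensor_space (psi : point3 R -> R) (tau : R -> R) z j : smooth psi ->
  'D_(e4 j) (fun z : point4 R => psi z.1 * tau z.2) z = 'D_(e3 j) psi z.1 * tau z.2.
Proof.
move=> sp; rewrite derive_line.
rewrite (_ : (fun _ => _) = fun t : R => tau z.2 * psi (t *: e3 j + z.1)); last first.
  apply/funext => t; rewrite mulrC; congr (tau _ * psi _).
  by rewrite /= scaler0 add0r.
have sl : smooth (fun t : R => psi (t *: e3 j + z.1)).
  apply: (@smooth_affine _ _ _ (fun t : R => t *: e3 j + z.1) (fun t : R => t *: e3 j)) => //.
  - by move=> t; apply: cvgD; [apply: cvgZr_tmp; exact: cvg_id|exact: cvg_cst].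
  - by move=> t s h; rewrite scalerDl scalerA addrA.
rewrite derive_mulr; last exact: smooth_derivable.
by rewrite mulrC; congr (_ * _); rewrite [RHS]derive_line.
Qed.

Lemma partial_ip u (g : vfield R (point3 R)) theta : L2 mu Q u -> L2 mu3 Omega g ->
  smooth theta -> ip mu Q u (fun i z => g i z.1 * theta z.2) =
  ip mu3 Omega (fun i x => partial (leb1 R) I theta (u i) x) g.
Proof.
move=> Lu Lg st; have [M mt tM] := smooth_weight T0 st.
have Lgt : L2 mu Q (fun i z => g i z.1 * theta z.2).
  by move=> i; exact: (scalL2_tensor mO mI Ioo (Lg i) mt tM).
have Lp : L2 mu3 Omega (fun i x => partial (leb1 R) I theta (u i) x).
  by move=> i; exact: (partial_scalL2 mO mI Ooo Ioo mt tM (Lu i)).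
rewrite (ipE mQ Lu Lgt) (ipE mO Lp Lg); apply: eq_bigr => i _.
exact: (partial_pairing mO mI Ooo Ioo mt tM (Lu i) (Lg i)).
Qed.

(** A field phi(x) theta(t) with [phi] supported in the domain is smooth but may be nonzero at the
    end times. The trace condition in its dual form admits it, and integrating in time first gives
    the weak curl of the coefficient. *)
Lemma is_curl3_partial v theta c : Hcurl0 Omega T v -> tangential_trace_zero Omega T v ->
  smooth theta -> is_curl3 Omega
    (fun i x => c * partial (leb1 R) I theta (v i) x)
    (fun i x => c * partial (leb1 R) I theta (curl Omega T v i) x).
Proof.
move=> hv tv st; have [M mt tM] := smooth_weight T0 st.
have [Lv Lc _] := Hcurl0_weak_pair hv.
have Lpv : L2 mu3 Omega (fun i x => partial (leb1 R) I theta (v i) x).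
  by move=> i; exact: (partial_scalL2 mO mI Ooo Ioo mt tM (Lv i)).
have Lpc : L2 mu3 Omega (fun i x => partial (leb1 R) I theta (curl Omega T v i) x).
  by move=> i; exact: (partial_scalL2 mO mI Ooo Ioo mt tM (Lc i)).
split; first exact: L2_scale.
move=> phi tphi.
have Lphi : L2 mu3 Omega phi by move=> i; exact: test_scalL2.
have Lcp : L2 mu3 Omega (cl_curl e3 phi).
  by move=> i; apply: scalL2B => //; apply: test_scalL2 => //; exact: test_function_derive.
rewrite (ip_scalel mO c Lpc Lphi) (ip_scalel mO c Lpv Lcp); congr (_ * _).
rewrite -(partial_ip Lc Lphi st) -(partial_ip Lv Lcp st) tv; last first.
  move=> i; apply: smoothM; first exact: smooth_fst (tphi i).1.
  exact: smooth_snd.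
apply: eq_Rintegral => z _; apply: eq_bigr => i _; congr (_ * _).
rewrite /cl_curl !derive_tensor_space ?mulrBl//; exact: (tphi _).1.
Qed.

Let coef0_partial v : Defs.coef0 T v =
  fun i x => T^-1 * partial (leb1 R) I (cst 1) (v i) x.
Proof.
apply/funext => i; apply/funext => x; rewrite /Defs.coef0 /partial; congr (_ * _).
by apply: eq_Rintegral => t _; rewrite mulr1.
Qed.

Lemma curl3_coef0 v : Hcurl0 Omega T v -> tangential_trace_zero Omega T v ->
  nrm2 mu3 Omega (curl3 Omega (Defs.coef0 T v)) =
  nrm2 mu3 Omega (Defs.coef0 T (curl Omega T v)).
Proof.
move=> hv tv; apply: nrm2_curl3; rewrite !coef0_partial.
by apply: is_curl3_partial => //; exact: smooth_cst.
Qed.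

Lemma pcurl3_coef v k : Hcurl0 Omega T v -> tangential_trace_zero Omega T v ->
  pnrm2 mu3 Omega (pcurl3 Omega (coef T v k)) =
  pnrm2 mu3 Omega (coef T (curl Omega T v) k).
Proof.
move=> hv tv.
have Ec := nrm2_curl3 (is_curl3_partial (2 / T) hv tv (smooth_line (k%:R * w) (@smooth_cos R))).
have Es := nrm2_curl3 (is_curl3_partial (2 / T) hv tv (smooth_line (k%:R * w) (@smooth_sin R))).
exact: (f_equal2 (fun a b : R => a + b) Ec Es).
Qed.

Definition Hterm v k : R := (1 + k%:R * w) * pnrm2 mu3 Omega (coef T v k) +
  pnrm2 mu3 Omega (pcurl3 Omega (coef T v k)).

Lemma pnrm2_ge0 (p : vfield R (point3 R) * vfield R (point3 R)) : 0 <= pnrm2 mu3 Omega p.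
Proof. by apply: addr_ge0; exact: nrm2_ge0. Qed.

Lemma Hterm_ge0 v k : 0 <= Hterm v k.
Proof.
have w0 := omega_gt0 T0.
by rewrite addr_ge0 ?pnrm2_ge0// mulr_ge0 ?pnrm2_ge0// addr_ge0// mulr_ge0// ltW.
Qed.

Definition Hzero v : R := T * (nrm2 mu3 Omega (Defs.coef0 T v) +
  nrm2 mu3 Omega (curl3 Omega (Defs.coef0 T v))).

Lemma Hnrm2E v : Hnrm2 Omega T v =
  ((Hzero v)%:E + (T / 2)%:E * \sum_(1 <= k <oo) (Hterm v k)%:E)%E.
Proof. by []. Qed.

Lemma Hzero_ge0 v : 0 <= Hzero v.
Proof. by rewrite mulr_ge0 ?addr_ge0 ?nrm2_ge0// ltW. Qed.

Lemma Hsum_ge0 v : (0 <= \sum_(1 <= k <oo) (Hterm v k)%:E)%E.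
Proof. by apply: nneseries_ge0 => k _ _; rewrite lee_fin Hterm_ge0. Qed.

Lemma Hnrm2_ge0 v : (0 <= Hnrm2 Omega T v)%E.
Proof.
rewrite Hnrm2E adde_ge0 ?lee_fin ?Hzero_ge0// mule_ge0 ?Hsum_ge0//.
by rewrite lee_fin divr_ge0// ltW.
Qed.

Lemma energy_le (t s a b c e f g : R) : 0 <= s -> g = b -> e + f <= c ->
  (t * a + s * e) + (t * b + s * f) <= t * (a + g) + s * c.
Proof. by move=> s0 -> h; rewrite addrACA -!mulrDr lerD2l ler_wpM2l. Qed.

Lemma Hterm_le v k : Hcurl0 Omega T v -> tangential_trace_zero Omega T v ->
  pnrm2 mu3 Omega (coef T v k) + pnrm2 mu3 Omega (coef T (curl Omega T v) k) <= Hterm v k.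
Proof.
move=> hv tv; rewrite /Hterm (pcurl3_coef k hv tv) lerD2r.
by rewrite ler_peMl ?pnrm2_ge0// lerDl mulr_ge0// ltW// omega_gt0.
Qed.

(** The partial Parseval sums of [v] and of its curl are compared termwise with those of the energy
    norm, whose weight 1 + k w is at least 1. Finiteness is assumed because [fine] sends an infinite
    norm to 0. *)
Lemma Hnrm2_bound v : Hcurlhalf_0per Omega T v -> Hnrm2 Omega T v \is a fin_num ->
  nrm2 mu Q v + nrm2 mu Q (curl Omega T v) <= fine (Hnrm2 Omega T v).
Proof.
move=> [hv _ tv] vfin; have [Lv Lc _] := Hcurl0_weak_pair hv.
have T2 : 0 < T / 2 by rewrite divr_gt0.
have Soo : (\sum_(1 <= k <oo) (Hterm v k)%:E < +oo)%E.
  move: vfin; rewrite Hnrm2E; have := Hsum_ge0 v.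
  case: (limn _) => [r _ _|_|//]; first exact: ltry.
  by rewrite gt0_muley ?lte_fin.
have Sb := ereal_series_bound (Hterm_ge0 v) Soo.
have Sf : fine (Hnrm2 Omega T v) = Hzero v +
    T / 2 * fine (\sum_(1 <= k <oo) (Hterm v k)%:E)%E.
  rewrite Hnrm2E; have := Hsum_ge0 v; move: Soo.
  by case: (limn _) => [r _ _|//|//].
rewrite Sf.
have h : (fun n => fourier_form Omega T n v v +
    fourier_form Omega T n (curl Omega T v) (curl Omega T v)) @ \oo -->
    ip mu Q v v + ip mu Q (curl Omega T v) (curl Omega T v).
  by apply: cvgD; exact: fourier_parseval.
rewrite /nrm2 -(cvg_lim (@Rhausdorff R) h).
apply: limr_le; [by apply/cvg_ex; eexists; exact: h|apply: nearW => n].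
apply: (@le_trans _ _ (Hzero v + T / 2 * \sum_(1 <= k < n) Hterm v k)); last first.
  by rewrite lerD2l ler_pM2l.
have h2 : \sum_(1 <= k < n) pnrm2 mu3 Omega (coef T v k) +
    \sum_(1 <= k < n) pnrm2 mu3 Omega (coef T (curl Omega T v) k) <=
    \sum_(1 <= k < n) Hterm v k.
  by rewrite -big_split/=; apply: ler_sum => k _; exact: Hterm_le.
exact: (energy_le T _ (ltW T2) (curl3_coef0 hv tv) h2).
Qed.

Lemma smooth_field_L2 (phi : vfield R (point4 R)) : (forall i, smooth (phi i)) -> L2 mu Q phi.
Proof.
apply: smooth_L2; [exact: openQ|exact: Q_finite|exact: (Qbar_compact (T := T) hO)|].
exact: (@Q_Qbar R Omega T).
Qed.

Lemma is_curl_sub y eta : Hcurl0 Omega T y -> Hcurl0 Omega T eta ->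
  is_curl Omega T (fun i z => y i z - eta i z)
    (fun i z => curl Omega T y i z - curl Omega T eta i z).
Proof.
move=> hy he; have [Ly Lcy _] := Hcurl0_weak_pair hy.
have [Le Lce _] := Hcurl0_weak_pair he.
split; first exact: L2_sub.
move=> phi tphi.
have sphi i : smooth (phi i) := (tphi i).1.
have Lphi := smooth_field_L2 sphi; have Lcphi := smooth_field_L2 (cl_curl_smooth sphi).
rewrite (ip_subl mQ Lcy Lce Lphi) (ip_subl mQ Ly Le Lcphi).
by rewrite (Hcurl0_curl hy).2// (Hcurl0_curl he).2.
Qed.

Lemma Hcurl0_sub y eta : Hcurl0 Omega T y -> Hcurl0 Omega T eta ->
  Hcurl0 Omega T (fun i z => y i z - eta i z).
Proof.
move=> hy he; split; last by exists (fun i z => curl Omega T y i z - curl Omega T eta i z); exact: is_curl_sub.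
by apply: L2_sub => //; [case: hy|case: he].
Qed.

Lemma curl_sub_ae y eta i : Hcurl0 Omega T y -> Hcurl0 Omega T eta ->
  {ae mu, forall z, Q z -> curl Omega T (fun i z => y i z - eta i z) i z =
    curl Omega T y i z - curl Omega T eta i z}.
Proof.
move=> hy he; have hs := is_curl_sub hy he.
have hc := Hcurl0_curl (Hcurl0_sub hy he).
apply: (L2_test_unique hO hc.1 hs.1) => phi tphi.
by rewrite hc.2// hs.2.
Qed.

Lemma trace_sub y eta : Hcurl0 Omega T y -> Hcurl0 Omega T eta ->
  tangential_trace_zero Omega T y -> tangential_trace_zero Omega T eta ->
  tangential_trace_zero Omega T (fun i z => y i z - eta i z).
Proof.
move=> hy he ty te phi sphi.
have hc := Hcurl0_curl (Hcurl0_sub hy he).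
have [Ly Lcy _] := Hcurl0_weak_pair hy.
have [Le Lce _] := Hcurl0_weak_pair he.
have Lphi := smooth_field_L2 sphi; have Lcphi := smooth_field_L2 (cl_curl_smooth sphi).
have E := ip_ae mQ hc.1 (L2_sub mQ Lcy Lce) Lphi (fun i => curl_sub_ae i hy he).
rewrite (ip_subl mQ Lcy Lce Lphi) ty// te// in E.
by rewrite (ip_subl mQ Ly Le Lcphi).
Qed.

(** The inf-sup condition is applied to the error, which has to lie in the half-order space; the
    half-order energy of [eta] is controlled by its full time derivative. *)
Lemma Hcurlhalf_sub y eta : Hcurlhalf_0per Omega T y -> Hcurl1_0per Omega T eta ->
  Hcurlhalf_0per Omega T (fun i z => y i z - eta i z).
Proof.
move=> [hy by_ ty] he; have [he0 _ te _] := he; split.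
- exact: Hcurl0_sub.
- apply/(half_nrm2P Omega T0); apply: half_bounded_sub => //.
  + by case: hy.
  + by case: he0.
  + exact/(half_nrm2P Omega T0).
  + exact: Hcurl1_half_bounded.
- exact: trace_sub.
Qed.

End curl_coefficients.

(** * Residuals *)

Lemma lerD4 (R : realType) (a b c d x y : R) : a + d <= x -> b + c <= y ->
  a + b + c + d <= x + y.
Proof. by lra. Qed.

Lemma fine_gt0_fin_num (R : realType) (x : \bar R) : (0 <= x)%E -> 0 < fine x -> x \is a fin_num.
Proof. by case: x => //=; rewrite ltxx. Qed.

Section residual_bound.
Context {R : realType}.

Section cauchy_schwarz_fields.
Context {d} {X : measurableType d}.
Variables (mu : {measure set X -> \bar R}) (D : set X).
Hypothesis mD : measurable D.

(** The four nonnegative quadratic polynomials in t are added before the discriminant is taken; this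
    is Cauchy-Schwarz in the product space and introduces no constant. *)
Lemma cauchy_schwarz4 (u1 u2 u3 u4 x1 x2 x3 x4 : vfield R X) :
  L2 mu D u1 -> L2 mu D u2 -> L2 mu D u3 -> L2 mu D u4 ->
  L2 mu D x1 -> L2 mu D x2 -> L2 mu D x3 -> L2 mu D x4 ->
  ip mu D u1 x1 + ip mu D u2 x2 + ip mu D u3 x3 + ip mu D u4 x4 <=
  Num.sqrt (nrm2 mu D u1 + nrm2 mu D u2 + nrm2 mu D u3 + nrm2 mu D u4) *
  Num.sqrt (nrm2 mu D x1 + nrm2 mu D x2 + nrm2 mu D x3 + nrm2 mu D x4).
Proof.
move=> Lu1 Lu2 Lu3 Lu4 Lx1 Lx2 Lx3 Lx4.
have E t u x : L2 mu D u -> L2 mu D x ->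
    0 <= t ^+ 2 * nrm2 mu D u + nrm2 mu D x + 2 * (t * ip mu D u x).
  move=> Lu Lx; have Lt := L2_scale mD t Lu.
  rewrite -(nrm2_scale mD t Lu) -(ip_scalel mD t Lu Lx) -(nrm2_add mD Lt Lx).
  exact: nrm2_ge0.
have n0 u : 0 <= nrm2 mu D u by exact: nrm2_ge0.
rewrite -sqrtrM ?addr_ge0//; apply: le_trans (ler_norm _) _.
rewrite -sqrtr_sqr ler_wsqrtr//; apply: discriminant_le; rewrite ?addr_ge0// => t.
have := addr_ge0 (addr_ge0 (E t _ _ Lu1 Lx1) (E t _ _ Lu2 Lx2))
  (addr_ge0 (E t _ _ Lu3 Lx3) (E t _ _ Lu4 Lx4)).
move: (ip mu D u1 x1) (ip mu D u2 x2) (ip mu D u3 x3) (ip mu D u4 x4).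
move: (nrm2 mu D u1) (nrm2 mu D u2) (nrm2 mu D u3) (nrm2 mu D u4).
move: (nrm2 mu D x1) (nrm2 mu D x2) (nrm2 mu D x3) (nrm2 mu D x4).
by move=> x1' x2' x3' x4' u1' u2' u3' u4' i1 i2 i3 i4; congr (0 <= _); ring.
Qed.

End cauchy_schwarz_fields.

Lemma infsup_const_gt0 (alpha nu_lo sigma_lo : R) : 0 < alpha -> 0 < nu_lo -> 0 < sigma_lo ->
  0 < infsup_const alpha nu_lo sigma_lo.
Proof.
move=> a0 n0 s0; rewrite /infsup_const !mulr_gt0// ?lt_min ?invr_gt0 ?sqrtr_gt0 ?a0 ?n0//.
by rewrite addr_gt0// mulr_gt0// lt_max a0.
Qed.

Variables (Omega : set (point3 R)) (T : R).
Hypotheses (hO : bounded_lipschitz_domain Omega) (T0 : 0 < T).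
Let mQ : measurable (Q Omega T) := Q_measurable T hO.
Let mu : {measure set (point4 R) -> \bar R} := leb4 R.
Local Notation Q := (Q Omega T).
Local Notation curl := (curl Omega T).
Local Notation dt := (dt Omega T).
Local Notation Hhalf := (Hcurlhalf_0per Omega T).
Local Notation H1 := (Hcurl1_0per Omega T).
Implicit Types v q y p eta zeta : vfield R (point4 R).

Lemma Hhalf_L2 v : Hhalf v -> L2 mu Q v. Proof. by case=> -[]. Qed.

Lemma Hhalf_bounded v : Hhalf v -> half_bounded Omega T v.
Proof. by move=> [_ + _] => /(half_nrm2P Omega T0). Qed.

Lemma Hcurl0_curl_L2 v : Hcurl0 Omega T v -> L2 mu Q (curl v).
Proof. by move=> /Hcurl0_curl[]. Qed.

Lemma ip_wmul_curl_sub (s : point3 R -> R) (S : R) y eta v : measurable_fun Omega s ->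
  (forall x, Omega x -> `|s x| <= S) -> Hcurl0 Omega T y -> Hcurl0 Omega T eta ->
  L2 mu Q v -> ip mu Q (wmul s (curl (fun i z => y i z - eta i z))) v =
  ip mu Q (wmul s (curl y)) v - ip mu Q (wmul s (curl eta)) v.
Proof.
move=> ms sS hy he Lv.
have W u (Lu : L2 mu Q u) := wmul_L2 hO ms sS Lu.
have Lcy := W _ (Hcurl0_curl_L2 hy); have Lce := W _ (Hcurl0_curl_L2 he).
have Lcs := W _ (Hcurl0_curl_L2 (Hcurl0_sub hO hy he)).
rewrite -(ip_subl mQ Lcy Lce Lv).
apply: (ip_ae mQ Lcs (L2_sub mQ Lcy Lce) Lv) => i.
by apply: ae_mono (curl_sub_ae hO i hy he) => z h Qz; rewrite /wmul h// mulrBr.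
Qed.

(* If the norm of (v, q) vanishes or is infinite, then [Hnorm] is the junk value [0] and so is
   the quotient. *)
Lemma pairing_le_Hnorm (A b : R) v q : Hhalf v -> Hhalf q -> 0 <= A ->
  b <= A * Num.sqrt (nrm2 mu Q v + nrm2 mu Q q + nrm2 mu Q (curl q) + nrm2 mu Q (curl v)) ->
  b / Hnorm Omega T v q <= A.
Proof.
move=> hv hq A0 hb.
have [H0|H0] := eqVneq (Hnorm Omega T v q) 0; first by rewrite H0 invr0 mulr0.
have Hp : 0 < Hnorm Omega T v q by rewrite lt_neqAle eq_sym H0 sqrtr_ge0.
rewrite ler_pdivrMr//; apply: (le_trans hb); rewrite ler_wpM2l//.
move: Hp; rewrite /Hnorm sqrtr_gt0 => Hp.
have v0 := Hnrm2_ge0 Omega T0 v; have q0 := Hnrm2_ge0 Omega T0 q.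
have fin : (Hnrm2 Omega T v + Hnrm2 Omega T q)%E \is a fin_num.
  exact: (fine_gt0_fin_num (adde_ge0 v0 q0) Hp).
have [vf qf] : Hnrm2 Omega T v \is a fin_num /\ Hnrm2 Omega T q \is a fin_num.
  by move: fin; rewrite fin_numD => /andP.
have hv2 := Hnrm2_bound hO T0 hv vf; have hq2 := Hnrm2_bound hO T0 hq qf.
by apply: ler_wsqrtr; rewrite (fineD vf qf); exact: (lerD4 hv2 hq2).
Qed.

Section residuals.
Variables (sigma nu : point3 R -> R) (S N alpha : R) (yd : vfield R (point4 R)).
Hypotheses (ms : measurable_fun Omega sigma) (sS : forall x, Omega x -> `|sigma x| <= S).
Hypotheses (mn : measurable_fun Omega nu) (nN : forall x, Omega x -> `|nu x| <= N).
Hypothesis Lyd : L2 mu Q yd.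
Local Notation B := (B Omega T sigma nu alpha).

(** The form of the exact pair is kept whole, to be replaced by its right-hand side. For [eta] and
    [zeta] the half-order terms are written with [dt], so that only L2 pairings remain. *)
Lemma form_sub y p eta zeta v q : Hhalf y -> Hhalf p -> H1 eta -> H1 zeta ->
  Hhalf v -> Hhalf q ->
  B (fun i z => y i z - eta i z) (fun i z => p i z - zeta i z) v q =
  B y p v q - (ip mu Q eta v - ip mu Q (wmul nu (curl zeta)) (curl v) +
    ip mu Q (wmul sigma (dt zeta)) v + ip mu Q (wmul nu (curl eta)) (curl q) +
    ip mu Q (wmul sigma (dt eta)) q + alpha^-1 * ip mu Q zeta q).
Proof.
move=> hy hp he hz hv hq.
have [hy0 _ _] := hy; have [hp0 _ _] := hp; have [he0 _ _ _] := he; have [hz0 _ _ _] := hz.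
have [hv0 _ _] := hv; have [hq0 _ _] := hq.
have Ly := Hhalf_L2 hy; have Lp := Hhalf_L2 hp; have Lv := Hhalf_L2 hv; have Lq := Hhalf_L2 hq.
have Le := Hcurl1_L2 he; have Lz := Hcurl1_L2 hz.
have by_ := Hhalf_bounded hy; have bp := Hhalf_bounded hp.
have bv := Hhalf_bounded hv; have bq := Hhalf_bounded hq.
have be := Hcurl1_half_bounded hO T0 he; have bz := Hcurl1_half_bounded hO T0 hz.
have Lcv := Hcurl0_curl_L2 hv0; have Lcq := Hcurl0_curl_L2 hq0.
rewrite /Defs.B (ip_subl mQ Ly Le Lv) (ip_subl mQ Lp Lz Lq).
rewrite (ip_wmul_curl_sub mn nN hp0 hz0 Lcv) (ip_wmul_curl_sub mn nN hy0 he0 Lcq).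
rewrite (half_form_sub hO T0 ms sS Lp Lz Lv bp bz bv).
rewrite (half_form_sub hO T0 ms sS Ly Le Lq by_ be bq).
rewrite (half_form_dt hO T0 ms sS hz Lv) (half_form_dt hO T0 ms sS he Lq).
move: (half_form _ _ _ _ _) (half_form _ _ _ _ _) => h1 h2.
move: (ip _ _ y _) (ip _ _ eta v) (ip _ _ p _) (ip _ _ zeta q) => i1 i2 i3 i4.
move: (ip _ _ _ _) (ip _ _ _ _) (ip _ _ _ _) (ip _ _ _ _) (ip _ _ _ _) (ip _ _ _ _).
by move=> j1 j2 j3 j4 j5 j6; ring.
Qed.

Lemma residual_L2 eta zeta tau rho : H1 eta -> H1 zeta ->
  Hcurl0 Omega T tau -> Hcurl0 Omega T rho ->
  [/\ L2 mu Q (res1 Omega T sigma yd eta zeta rho),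
      L2 mu Q (res3 Omega T sigma alpha eta zeta tau),
      L2 mu Q (res2 Omega T nu eta tau) & L2 mu Q (res4 Omega T nu zeta rho)].
Proof.
move=> he hz ht hr; have [he0 _ _ _] := he; have [hz0 _ _ _] := hz.
have Lsz := wmul_L2 hO ms sS (dt_L2 hz); have Lse := wmul_L2 hO ms sS (dt_L2 he).
have Lnz := wmul_L2 hO mn nN (Hcurl0_curl_L2 hz0).
have Lne := wmul_L2 hO mn nN (Hcurl0_curl_L2 he0).
have Lct := Hcurl0_curl_L2 ht; have Lcr := Hcurl0_curl_L2 hr.
have [Lt _] := ht; have [Lr _] := hr.
have Le := Hcurl1_L2 he; have Lz := Hcurl1_L2 hz.
split.
- exact: (L2_sub mQ (L2_add mQ (L2_sub mQ Lsz Lcr) Le) Lyd).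
- exact: (L2_add mQ (L2_add mQ Lse Lct) (L2_scale mQ alpha^-1 Lz)).
- exact: (L2_sub mQ Lt Lne).
- exact: (L2_sub mQ Lr Lnz).
Qed.

(** The terms in [rho] and [tau] brought in by the residuals cancel by [curl_ibp]. The minus signs
    are placed on the test fields, whose norms do not see them. *)
Lemma residual_identity y p eta zeta tau rho v q : Hhalf y -> Hhalf p -> H1 eta -> H1 zeta ->
  Hhalf v -> Hhalf q -> Hcurl0 Omega T tau -> Hcurl0 Omega T rho ->
  B y p v q = ip mu Q yd v ->
  B (fun i z => y i z - eta i z) (fun i z => p i z - zeta i z) v q =
  ip mu Q (res1 Omega T sigma yd eta zeta rho) (fun i z => -1 * v i z) +
  ip mu Q (res3 Omega T sigma alpha eta zeta tau) (fun i z => -1 * q i z) +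
  ip mu Q (res2 Omega T nu eta tau) (curl q) +
  ip mu Q (res4 Omega T nu zeta rho) (fun i z => -1 * curl v i z).
Proof.
move=> hy hp he hz hv hq ht hr Bv; rewrite form_sub// Bv.
have [he0 _ _ _] := he; have [hz0 _ _ _] := hz.
have [hv0 _ tv] := hv; have [hq0 _ tq] := hq.
have Lv := Hhalf_L2 hv; have Lq := Hhalf_L2 hq.
have Le := Hcurl1_L2 he; have Lz := Hcurl1_L2 hz.
have Lcv := Hcurl0_curl_L2 hv0; have Lcq := Hcurl0_curl_L2 hq0.
have Lct := Hcurl0_curl_L2 ht; have Lcr := Hcurl0_curl_L2 hr.
have Lt : L2 mu Q tau by case: ht.
have Lr : L2 mu Q rho by case: hr.
have Lsz := wmul_L2 hO ms sS (dt_L2 hz); have Lse := wmul_L2 hO ms sS (dt_L2 he).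
have Lnz := wmul_L2 hO mn nN (Hcurl0_curl_L2 hz0).
have Lne := wmul_L2 hO mn nN (Hcurl0_curl_L2 he0).
have R1 : ip mu Q (res1 Omega T sigma yd eta zeta rho) v =
    ip mu Q (wmul sigma (dt zeta)) v - ip mu Q (curl rho) v + ip mu Q eta v - ip mu Q yd v.
  have L1 := L2_sub mQ Lsz Lcr; have L2 := L2_add mQ L1 Le.
  by rewrite (ip_subl mQ L2 Lyd Lv) (ip_addl mQ L1 Le Lv) (ip_subl mQ Lsz Lcr Lv).
have R3 : ip mu Q (res3 Omega T sigma alpha eta zeta tau) q =
    ip mu Q (wmul sigma (dt eta)) q + ip mu Q (curl tau) q + alpha^-1 * ip mu Q zeta q.
  have L1 := L2_add mQ Lse Lct; have L2 := L2_scale mQ alpha^-1 Lz.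
  by rewrite (ip_addl mQ L1 L2 Lq) (ip_addl mQ Lse Lct Lq) (ip_scalel mQ _ Lz Lq).
have R2 : ip mu Q (res2 Omega T nu eta tau) (curl q) =
    ip mu Q tau (curl q) - ip mu Q (wmul nu (curl eta)) (curl q).
  exact: (ip_subl mQ Lt Lne Lcq).
have R4 : ip mu Q (res4 Omega T nu zeta rho) (curl v) =
    ip mu Q rho (curl v) - ip mu Q (wmul nu (curl zeta)) (curl v).
  exact: (ip_subl mQ Lr Lnz Lcv).
have neg u x : L2 mu Q u -> L2 mu Q x ->
    ip mu Q u (fun i z => -1 * x i z) = - ip mu Q x u.
  by move=> Lu Lx; rewrite ip_comm (ip_scalel mQ (-1) Lx Lu) mulN1r.
have [LR1 LR3 _ LR4] := residual_L2 he hz ht hr.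
rewrite (neg _ _ LR1 Lv) (neg _ _ LR3 Lq) (neg _ _ LR4 Lcv).
rewrite (ip_comm _ _ v) (ip_comm _ _ q) (ip_comm _ _ (curl v)).
rewrite R1 R2 R3 R4 (curl_ibp hO T0 hr hv0 tv) (curl_ibp hO T0 ht hq0 tq).
move: (ip mu Q yd v) (ip mu Q eta v) (ip mu Q (wmul nu (curl zeta)) (curl v)).
move: (ip mu Q (wmul sigma (dt zeta)) v) (ip mu Q (wmul nu (curl eta)) (curl q)).
move: (ip mu Q (wmul sigma (dt eta)) q) (ip mu Q zeta q) (ip mu Q rho (curl v)).
by move: (ip mu Q tau (curl q)) => i1 i2 i3 i4 i5 i6 i7 i8 i9; ring.
Qed.

Lemma residual_bound y p eta zeta tau rho v q : Hhalf y -> Hhalf p -> H1 eta -> H1 zeta ->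
  Hhalf v -> Hhalf q -> Hcurl0 Omega T tau -> Hcurl0 Omega T rho ->
  B y p v q = ip mu Q yd v ->
  B (fun i z => y i z - eta i z) (fun i z => p i z - zeta i z) v q / Hnorm Omega T v q <=
  Num.sqrt (nrm2 mu Q (res1 Omega T sigma yd eta zeta rho) +
    nrm2 mu Q (res3 Omega T sigma alpha eta zeta tau) +
    nrm2 mu Q (res2 Omega T nu eta tau) + nrm2 mu Q (res4 Omega T nu zeta rho)).
Proof.
move=> hy hp he hz hv hq ht hr Bv.
apply: (pairing_le_Hnorm hv hq (sqrtr_ge0 _)).
rewrite (residual_identity hy hp he hz hv hq ht hr Bv).
have [L1 L3 L2 L4] := residual_L2 he hz ht hr.
have [hv0 _ _] := hv; have [hq0 _ _] := hq.
have Lv := Hhalf_L2 hv; have Lq := Hhalf_L2 hq.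
have Lcv := Hcurl0_curl_L2 hv0; have Lcq := Hcurl0_curl_L2 hq0.
have N1 u : Defs.L2 mu Q u -> nrm2 mu Q (fun i z => -1 * u i z) = nrm2 mu Q u.
  by move=> Lu; rewrite (nrm2_scale mQ (-1) Lu) sqrrN expr1n mul1r.
rewrite -(N1 _ Lv) -(N1 _ Lq) -(N1 _ Lcv).
exact: (cauchy_schwarz4 mQ L1 L3 L2 L4 (L2_scale mQ (-1) Lv) (L2_scale mQ (-1) Lq) Lcq
  (L2_scale mQ (-1) Lcv)).
Qed.

End residuals.
End residual_bound.

Theorem theorem2 (R : realType) (Omega : set (point3 R)) (T : R)
  (sigma nu : point3 R -> R) (sigma_lo sigma_hi nu_lo nu_hi alpha : R)
  (yd y p eta zeta : vfield R (point4 R))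
  (hOmega : bounded_lipschitz_domain Omega)
  (hT : 0 < T)
  (msigma : measurable_fun Omega sigma)
  (mnu : measurable_fun Omega nu)
  (hsigma_lo : 0 < sigma_lo)
  (hnu_lo : 0 < nu_lo)
  (hsigma : forall x, Omega x -> sigma_lo <= sigma x <= sigma_hi)
  (hnu : forall x, Omega x -> nu_lo <= nu x <= nu_hi)
  (halpha : 0 < alpha)
  (hyd : L2 (leb4 R) (Q Omega T) yd)
  (hydiv : weakly_divergence_free Omega T yd)
  (hy : Hcurlhalf_0per Omega T y)
  (hp : Hcurlhalf_0per Omega T p)
  (hyp : forall v q, Hcurlhalf_0per Omega T v -> Hcurlhalf_0per Omega T q ->
     B Omega T sigma nu alpha y p v q = ip (leb4 R) (Q Omega T) yd v)
  (heta : Hcurl1_0per Omega T eta)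
  (hzeta : Hcurl1_0per Omega T zeta)
  (hinfsup : infsup Omega T sigma nu alpha (infsup_const alpha nu_lo sigma_lo)) :
  forall tau rho, Hcurl0 Omega T tau -> Hcurl0 Omega T rho ->
    Hnorm Omega T (fun i z => y i z - eta i z) (fun i z => p i z - zeta i z)
    <= (infsup_const alpha nu_lo sigma_lo)^-1 *
       Num.sqrt
         (nrm2 (leb4 R) (Q Omega T) (res1 Omega T sigma yd eta zeta rho) +
          nrm2 (leb4 R) (Q Omega T) (res3 Omega T sigma alpha eta zeta tau) +
          nrm2 (leb4 R) (Q Omega T) (res2 Omega T nu eta tau) +
          nrm2 (leb4 R) (Q Omega T) (res4 Omega T nu zeta rho)).
Proof.
move=> tau rho ht hr.
have c0 := infsup_const_gt0 halpha hnu_lo hsigma_lo.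
have bound (lo hi : R) (s : point3 R -> R) : 0 < lo ->
    (forall x, Omega x -> lo <= s x <= hi) -> forall x, Omega x -> `|s x| <= hi.
  move=> lo0 h x Ox; have /andP[h1 h2] := h x Ox.
  by rewrite ger0_norm// ltW// (lt_le_trans lo0).
have sS := bound _ _ _ hsigma_lo hsigma; have nN := bound _ _ _ hnu_lo hnu.
have hw := Hcurlhalf_sub hOmega hT hy heta; have hz := Hcurlhalf_sub hOmega hT hp hzeta.
(* Multiplication by the positive constant brings the claim into the form of the inf-sup condition
   for the error; the supremum is then bounded quotient by quotient. *)
rewrite -ler_pdivrMl ?invr_gt0// invrK -lee_fin; apply: le_trans (hinfsup _ _ hw hz) _.
apply: ge_ereal_sup => _ [v [q [hv hq _ ->]]]; rewrite lee_fin.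
exact: (residual_bound hOmega hT msigma sS mnu nN hyd hy hp heta hzeta hv hq ht hr (hyp v q hv hq)).
Qed.
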